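(* Let $0<q<1$, $K>0$, $A>0$ be fixed with respect to $N$, and let $\lambda=\min\left\{\frac12q,\ \frac2d(1-q)\right\}$. Suppose conditions (a'), (b'), (c), (d), (e) and (T) of the context hold (boundedness of $\eta$ is not required). Then the convergence rate of the adaptive $k$NN regressor (defined in the context) is bounded, as $N\to\infty$, by $$R-R^*=\begin{cases}\mathcal{O}\left(N^{-\min\{\beta',2\lambda\}}\right) & \text{if } \beta'\neq2\lambda,\\ \mathcal{O}\left(N^{-\beta'}\ln N\right) & \text{if } \beta'=2\lambda.\end{cases}$$ The optimal $q$ (giving the best rate in this bound) is $q^*=4/(d+4)$, and the corresponding convergence rate is $$R-R^*=\begin{cases}\mathcal{O}\left(N^{-\min\left\{\beta',\frac{4}{d+4}\right\}}\right) & \text{if } \beta'\neq\frac{4}{d+4},\\ \mathcal{O}\left(N^{-\beta'}\ln N\right) & \text{if } \beta'=\frac{4}{d+4}.\end{cases}$$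
   Context: Regression setting. $\mathbf{X}\in\mathbb{R}^d$ has probability density $f$, and $Y=\eta(\mathbf{X})+\epsilon\in\mathbb{R}$ with $\mathbb{E}[\epsilon|\mathbf{X}=\mathbf{x}]=0$ for all $\mathbf{x}$. A regressor $g$ is built from $N$ i.i.d. training samples $(\mathbf{X}_i,Y_i)$ with the law of $(\mathbf{X},Y)$, independent of the test pair. Its risk is $R=\mathbb{E}[(g(\mathbf{X})-Y)^2]$, the Bayes risk is $R^*=\mathbb{E}[\epsilon^2]$, and the excess risk is $R-R^*=\mathbb{E}[(g(\mathbf{X})-\eta(\mathbf{X}))^2]$ (expectation over training samples and test point). Let $\|\cdot\|$ be any fixed norm on $\mathbb{R}^d$. $B(\mathbf{x},r)$ is the ball with center $\mathbf{x}$ and radius $r$ in this norm, $V(\cdot)$ denotes volume, and $\mathrm{P}(B(\mathbf{x},r))$ is the probability mass of $B(\mathbf{x},r)$ under the law of $\mathbf{X}$ ($\mathrm{P}^q$ is its $q$-th power). Adaptive $k$NN regressor with parameters $K,A,q$: for a test point $\mathbf{x}$ put $n=\sum_{i=1}^N\mathbf{1}(\mathbf{X}_i\in B(\mathbf{x},A))$ and $k=\lfloor Kn^q\rfloor+1$; then $g(\mathbf{x})=\frac1k\sum_{i=1}^kY^{(i)}$, where $Y^{(i)}$ is the target value of the $i$-th nearest neighbor of $\mathbf{x}$ among $\mathbf{X}_1,\dots,\mathbf{X}_N$ with respect to $\|\cdot\|$. Conditions: there are finite constants $C_a,C_b',C_b'',C_c,M_X,L$, a constant $C_d>0$, and $\beta'>0$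 such that (a') $\operatorname{Var}[Y|\mathbf{X}=\mathbf{x}]\le C_a$ for all $\mathbf{x}$; (b') $\mathbb{E}[\|\mathbf{X}\|^2]\le M_X$, and $\int(1+\|\mathbf{x}\|^2)e^{-bf(\mathbf{x})}f(\mathbf{x})\,d\mathbf{x}\le C_b'b^{-\beta'}$ for all $b\ge0$ (with right side $+\infty$ at $b=0$); (c) for every $r>0$ and every $\mathbf{x}$ in the support of $f$, $|\eta(B(\mathbf{x},r))-\eta(\mathbf{x})|\le C_cr^2$, where $\eta(B(\mathbf{x},r)):=\mathbb{E}[Y|\mathbf{X}\in B(\mathbf{x},r)]$; (d) there is $D>0$ such that $\mathrm{P}(B(\mathbf{x},r))\ge C_df(\mathbf{x})V(B(\mathbf{x},r))$ for all $\mathbf{x}$ and all $0<r<D$; (e) for any $\mathbf{x}_1,\mathbf{x}_2$ with $\|\mathbf{x}_2-\mathbf{x}_1\|\ge D$ (the same $D$ as in (d)), $|\eta(\mathbf{x}_2)-\eta(\mathbf{x}_1)|\le L\|\mathbf{x}_2-\mathbf{x}_1\|$; (T) for any $t>0$, $\mathrm{P}\left(\dfrac{f(\mathbf{X})}{\mathrm{P}^q(B(\mathbf{X},A))}<t^{1-q}\right)\le C_b''t^{\beta'}$ (with the same $q$ and $A$ as in the adaptive regressor). $\mathcal{O}$ is with respect to $N\to\infty$, with constants not depending on $N$. *)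

(* Defs.v *)
From HB Require Import structures.
From mathcomp Require Import all_boot all_order all_algebra.
From mathcomp Require Import all_classical all_reals all_analysis.

Set Implicit Arguments.
Unset Strict Implicit.
Unset Printing Implicit Defensive.

Import Order.TTheory GRing.Theory Num.Theory.
Import numFieldNormedType.Exports.

Local Open Scope classical_set_scope.
Local Open Scope ring_scope.

(* 'rV[T]_n carries the product sigma-algebra, as n.-tuple T does; for T = R
   it is the Borel sigma-algebra of R^n. *)
Definition measure_rV_display : measure_display -> measure_display.
Proof. exact. Qed.

Section measurable_rV.
Context {d} {T : measurableType d}.
Variable n : nat.

Let coord : 'I_n -> 'rV[T]_n -> T := fun i v => v ord0 i.

Let rV_set0 : g_sigma_preimage coord set0.
Proof. exact: sigma_algebra0. Qed.

Let rV_setC A : g_sigma_preimage coord A -> g_sigma_preimage coord (~` A).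
Proof. exact: sigma_algebraC. Qed.

Let rV_bigcup (F : _^nat) : (forall i, g_sigma_preimage coord (F i)) ->
  g_sigma_preimage coord (\bigcup_i (F i)).
Proof. exact: sigma_algebra_bigcup. Qed.

HB.instance Definition _ := @isMeasurable.Build (measure_rV_display d)
  ('rV[T]_n) (g_sigma_preimage coord) rV_set0 rV_setC rV_bigcup.

End measurable_rV.

Lemma measurable_coord d (T : measurableType d) n (i : 'I_n) :
  measurable_fun [set: 'rV[T]_n] (fun v : 'rV[T]_n => v ord0 i).
Proof.
move=> _ Y mY; rewrite setTI; apply: sub_sigma_algebra => /=.
rewrite -bigcup_seq/=; exists i => /=; first by rewrite mem_index_enum.
by exists Y => //; rewrite setTI.
Qed.

Lemma measurable_fun_rVP d1 d2 (T1 : measurableType d1)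
    (T2 : measurableType d2) n (f : T1 -> 'rV[T2]_n) :
  (forall i, measurable_fun [set: T1] (fun x => f x ord0 i)) ->
  measurable_fun [set: T1] f.
Proof.
move=> mf _ Y; rewrite setTI /measurable /= => mY.
have: preimage_set_system setT f
    (g_sigma_preimage (fun (i : 'I_n) (v : 'rV[T2]_n) => v ord0 i))
    (f @^-1` Y) by exists Y => //; rewrite setTI.
rewrite -g_sigma_preimage_comp; move: (f @^-1` Y).
apply: smallest_sub; first exact: sigma_algebra_measurable.
move=> A; rewrite -bigcup_seq/= => -[i _ [B mB <-]].
exact: mf.
Qed.

Section lebesgue_rV.
Context {R : realType}.

Definition rV_cons n (p : measurableTypeR R * 'rV[R]_n) : 'rV[R]_n.+1 :=
  \row_i oapp (p.2 ord0) p.1 (unlift ord0 i).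

Definition rV_uncons n (v : 'rV[R]_n.+1) : measurableTypeR R * 'rV[R]_n :=
  (v ord0 ord0 : measurableTypeR R, \row_j v ord0 (lift ord0 j)).

Lemma rV_consK n : cancel (@rV_cons n) (@rV_uncons n).
Proof.
move=> [a v]; rewrite /rV_uncons /rV_cons; congr pair.
  by rewrite mxE unlift_none.
by apply/rowP => j; rewrite !mxE liftK.
Qed.

Lemma measurable_rV_cons n : measurable_fun setT (@rV_cons n).
Proof.
apply: measurable_fun_rVP => i; rewrite /rV_cons.
under eq_fun do rewrite mxE.
case: (unlift ord0 i) => [j|] /=; last exact: measurable_fst.
exact: (measurableT_comp (measurable_coord j) measurable_snd).
Qed.

Lemma measurable_rV_uncons n : measurable_fun setT (@rV_uncons n).
Proof.
apply: measurable_fun_pair; first exact: measurable_coord.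
apply: measurable_fun_rVP => i.
under eq_fun do rewrite mxE.
exact: measurable_coord.
Qed.

HB.instance Definition _ n :=
  isMeasurableFun.Build _ _ _ _ (@rV_cons n) (@measurable_rV_cons n).

(* Volume on R^n: the n-fold product of the Lebesgue measure of R. *)
Fixpoint lebesgue_rV n : set 'rV[R]_n -> \bar R :=
  match n with
  | 0 => dirac (0 : 'rV[R]_0)
  | m.+1 => pushforward (@lebesgue_measure R \x @lebesgue_rV m)%E (@rV_cons m)
  end.


Let product_sf n (m : {sigma_finite_measure set 'rV[R]_n -> \bar R}) :
  sigma_finite setT (@lebesgue_measure R \x m)%E.
Proof.
have /sigma_finiteP[F [TF ndF Foo]] := sigma_finiteT (@lebesgue_measure R).
have /sigma_finiteP[G [TG ndG Goo]] := sigma_finiteT m.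
exists (fun n => F n `*` G n).
  rewrite -setXTT TF TG predeqE => -[x y]; split.
    move=> [/= [i _ Fnx] [k _ Gky]]; exists (maxn i k) => //; split.
    - by move: x Fnx; exact/subsetPset/ndF/leq_maxl.
    - by move: y Gky; exact/subsetPset/ndG/leq_maxr.
  by move=> [i _ []/= ? ?]; split; exists i.
move=> k; have [? ?] := Foo k; have [? ?] := Goo k.
split; first exact: measurableX.
by rewrite product_measure1E// lte_mul_pinfty// ge0_fin_numE.
Qed.

Let lebesgue_rV_package n :
  {m : {sigma_finite_measure set 'rV[R]_n -> \bar R} | @lebesgue_rV n = m}.
Proof.
elim: n => [|n [m IH]].
  by exists (dirac (0 : 'rV[R]_0)).
pose mu := pushforward (@lebesgue_measure R \x m)%E (@rV_cons n).
have sf : sigma_finite setT mu.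
  have [F TF Foo] := product_sf m.
  exists (fun i => @rV_uncons n @^-1` F i).
    by rewrite -preimage_bigcup -TF preimage_setT.
  move=> i; have [mF Fi] := Foo i; split.
    by rewrite -[X in measurable X]setTI; exact: measurable_rV_uncons.
  rewrite /mu /pushforward -comp_preimage.
  rewrite (_ : _ \o _ = id) ?preimage_id//.
  by apply/funext => p /=; rewrite rV_consK.
have mcons := @measurable_rV_cons n.
pose mm : {measure set 'rV[R]_n.+1 -> \bar R} :=
  @measure_function_pushforward__canonical__measure_function_Measure _ _ _ _ _
    (@lebesgue_measure R \x m)%E _ mcons.
pose sfB := Measure_isSigmaFinite.Build _ _ _ mm sf.
pose mu' : {sigma_finite_measure set 'rV[R]_n.+1 -> \bar R} :=
  HB.pack mu sfB.
by exists (mu' mcons); rewrite /= IH.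
Qed.

Let lebesgue_rV0 n : @lebesgue_rV n set0 = 0%E.
Proof. by have [m ->] := lebesgue_rV_package n; rewrite measure0. Qed.

Let lebesgue_rV_ge0 n A : (0 <= @lebesgue_rV n A)%E.
Proof. by have [m ->] := lebesgue_rV_package n; exact: measure_ge0. Qed.

Let lebesgue_rV_sigma_additive n : semi_sigma_additive (@lebesgue_rV n).
Proof.
have [m ->] := lebesgue_rV_package n.
exact: measure_semi_sigma_additive.
Qed.

HB.instance Definition _ n := isMeasure.Build _ _ _ (@lebesgue_rV n)
  (lebesgue_rV0 n) (@lebesgue_rV_ge0 n) (@lebesgue_rV_sigma_additive n).

Let lebesgue_rV_sigma_finite n : sigma_finite setT (@lebesgue_rV n).
Proof. by have [m ->] := lebesgue_rV_package n; exact: sigma_finiteT. Qed.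

HB.instance Definition _ n := Measure_isSigmaFinite.Build _ _ _
  (@lebesgue_rV n) (lebesgue_rV_sigma_finite n).

Lemma lebesgue_rV_box n (A : 'I_n -> set R) :
  (forall i, measurable (A i)) ->
  (lebesgue_rV [set v : 'rV[R]_n | forall i, A i (v ord0 i)] =
   \prod_(i < n) lebesgue_measure (A i))%E.
Proof.
elim: n A => [|n IH] A mA.
  rewrite big_ord0 /= diracE.
  by rewrite (_ : [set _ | _] = setT) ?in_setT//; apply/seteqP; split => // v _ [].
rewrite big_ord_recl -IH//.
have mB : measurable [set v : 'rV[R]_n | forall i, A (lift ord0 i) (v ord0 i)].
  rewrite (_ : [set _ | _] = \bigcap_(i in [set: 'I_n])
     ((fun v : 'rV[R]_n => v ord0 i) @^-1` A (lift ord0 i))); last first.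
    by apply/seteqP; split => v /= h i //; [move=> _; exact: h|exact: (h i)].
  apply: fin_bigcap_measurable => [|i _]; first exact: finite_finset.
  by rewrite -[X in measurable X]setTI; apply: measurable_coord.
transitivity ((@lebesgue_measure R \x @lebesgue_rV n)%E
  (A ord0 `*` [set v : 'rV[R]_n | forall i, A (lift ord0 i) (v ord0 i)]));
  last exact: (product_measure1E (@lebesgue_measure R) (@lebesgue_rV n) (mA ord0) mB).
rewrite /= /pushforward; congr (_ _); apply/seteqP; split => -[a v] /=.
  move=> h; split.
    by have := h ord0; rewrite /rV_cons mxE unlift_none.
  by move=> i; have := h (lift ord0 i); rewrite /rV_cons mxE liftK.
move=> [ha hv] i; rewrite /rV_cons mxE.
by case: unliftP => [j ->|->].
Qed.

End lebesgue_rV.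

Section knn.
Context {R : realType} {d : nat}.
Implicit Types (nrm : 'rV[R]_d -> R) (x : 'rV[R]_d).

Definition is_norm nrm : Prop :=
  [/\ forall x, nrm x = 0 -> x = 0,
      forall x y, nrm (x + y) <= nrm x + nrm y &
      forall a x, nrm (a *: x) = `|a| * nrm x].

(* Closed or open balls are interchangeable when X has a density: spheres are
   negligible. *)
Definition nball nrm x (r : R) : set 'rV[R]_d := [set y | nrm (y - x) <= r].

(* The sort is stable, so ties in distance are broken by the sample index. *)
Definition neighbors nrm N (xs : 'I_N -> 'rV[R]_d) x : seq 'I_N :=
  sort (fun i j => nrm (xs i - x) <= nrm (xs j - x)) (enum 'I_N).

Definition adaptive_k nrm (K A q : R) N (xs : 'I_N -> 'rV[R]_d) x : nat :=
  let n := (\sum_(i < N) (xs i \in nball nrm x A))%N in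
  (Num.truncn (K * n%:R `^ q)).+1.

(* k <= N fails only for finitely many N, since k <= K N^q + 1 and q < 1; for
   those N the sum ranges over all the samples. *)
Definition adaptive_knn nrm (K A q : R) N (xs : 'I_N -> 'rV[R]_d)
    (ys : 'I_N -> R) x : R :=
  let k := adaptive_k nrm K A q xs x in
  k%:R^-1 * \sum_(i <- take k (neighbors nrm xs x)) ys i.

End knn.

Definition mutually_independent (R : realType) dO (Omega : measurableType dO)
    (P : probability Omega R) dT (T : measurableType dT) (I : eqType)
    (Z : I -> Omega -> T) : Prop :=
  forall (J : seq I) (E : I -> set T), uniq J ->
    (forall i, measurable (E i)) ->
    P (\big[setI/setT]_(i <- J) (Z i @^-1` E i)) =
    (\prod_(i <- J) P (Z i @^-1` E i))%E.

Section regression.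
Context {R : realType} {d : nat} {dO : measure_display}
  {Omega : measurableType dO} (P : probability Omega R).
Implicit Types (X : {RV P >-> 'rV[R]_d}) (Y eps : {RV P >-> R})
  (Xs : nat -> {RV P >-> 'rV[R]_d}) (Ys : nat -> {RV P >-> R})
  (f eta nrm : 'rV[R]_d -> R) (kappa : {mfun 'rV[R]_d >-> pprobability R R}).

Definition has_density X f : Prop :=
  [/\ measurable_fun setT f, forall x, 0 <= f x &
      forall E, measurable E ->
        distribution P X E = (\int[@lebesgue_rV R d]_(x in E) (f x)%:E)%E].

(* None is the test pair, Some i the i-th training pair. *)
Definition data X Y Xs Ys (i : option nat) : Omega -> 'rV[R]_d * R :=
  if i is Some j then fun w => (Xs j w, Ys j w) else fun w => (X w, Y w).

Definition iid_data X Y Xs Ys : Prop :=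
  mutually_independent P (data X Y Xs Ys) /\
  forall i E, measurable E ->
    P (data X Y Xs Ys (Some i) @^-1` E) = P (data X Y Xs Ys None @^-1` E).

(* kappa x is the conditional distribution of Y given X = x; conditional
   expectations and variances given X = x are taken under kappa x. *)
Definition conditional_law X Y kappa : Prop :=
  forall E F, measurable E -> measurable F ->
    P (X @^-1` E `&` Y @^-1` F) =
    (\int[distribution P X]_(x in E) kappa x F)%E.

(* Given X = x, the noise is y - eta x with y distributed as kappa x. *)
Definition regression_model X Y eps eta kappa : Prop :=
  [/\ forall w, Y w = eta (X w) + eps w,
      conditional_law X Y kappa &
      forall x, ('E_(kappa x)[fun y => (y - eta x)%R] = 0)%E].

Definition cond_variance_le kappa (Ca : R) : Prop :=
  forall x, ('V_(kappa x)[idfun] <= Ca%:E)%E.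

(* The bound at b = 0 has right-hand side +oo. *)
Definition weighted_tail nrm X f (MX Cb beta : R) : Prop :=
  ('E_P[fun w => (nrm (X w) ^+ 2)%R] <= MX%:E)%E /\
  forall b : R, 0 < b ->
    (\int[@lebesgue_rV R d]_x
        ((1 + nrm x ^+ 2) * expR (- (b * f x)) * f x)%:E
      <= (Cb * b `^ (- beta))%:E)%E.

(* E[Y | X in B]; only meaningful when P (X in B) > 0. *)
Definition cond_mean_on X Y (B : set 'rV[R]_d) : R :=
  fine 'E_P[fun w => (Y w * \1_B (X w))%R] / fine (distribution P X B).

(* The support of f is taken to be [set x | 0 < f x], the smallest reading, so
   the least restrictive hypothesis. *)
Definition local_bias nrm X Y f eta (Cc : R) : Prop :=
  forall (r : R) x, 0 < r -> 0 < f x ->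
    `|cond_mean_on X Y (nball nrm x r) - eta x| <= Cc * r ^+ 2.

Definition ball_mass_ge nrm X f (Cd D : R) : Prop :=
  forall x (r : R), 0 < r < D ->
    ((Cd * f x)%:E * @lebesgue_rV R d (nball nrm x r)
       <= distribution P X (nball nrm x r))%E.

Definition large_scale_lipschitz nrm eta (L D : R) : Prop :=
  forall x1 x2, D <= nrm (x2 - x1) ->
    `|eta x2 - eta x1| <= L * nrm (x2 - x1).

Definition mass_ratio_tail nrm X f (A q Cb beta : R) : Prop :=
  forall t : R, 0 < t ->
    (P [set w | (f (X w) / fine (distribution P X (nball nrm (X w) A)) `^ q
                 < t `^ (1 - q))%R]
      <= (Cb * t `^ beta)%:E)%E.

Definition risk X Y (g : Omega -> 'rV[R]_d -> R) : \bar R :=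
  'E_P[fun w => ((g w (X w) - Y w) ^+ 2)%R]%E.

Definition bayes_risk eps : \bar R := 'E_P[fun w => (eps w ^+ 2)%R]%E.

Definition knn_excess_risk nrm X Y eps Xs Ys (K A q : R) (N : nat) : \bar R :=
  (risk X Y (fun w => adaptive_knn nrm K A q
     (fun i : 'I_N => Xs i w) (fun i : 'I_N => Ys i w))
   - bayes_risk eps)%E.

End regression.

(* Landau's O for a sequence of extended reals that is eventually finite. *)
Definition ebigO (R : realType) (u : nat -> \bar R) (v : nat -> R) : Prop :=
  (\forall N \near \oo, u N \is a fin_num) /\
  (fun N => fine (u N) : R^o) =O_\oo (fun N => v N : R^o).

Definition knn_lambda (R : realType) (d : nat) (q : R) : R :=
  Num.min (q / 2) (2 / d%:R * (1 - q)).

Definition knn_rate (R : realType) (beta s : R) (N : nat) : R :=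
  if beta == s then N%:R `^ (- beta) * ln N%:R
  else N%:R `^ (- Num.min beta s).

(* Main.v *)
(* Fix a test point x with f x > 0 and put rho t = nrm (t.1 - x) and
   a t = t.2 - eta x, so that g x - eta x is the average of a over the k nearest
   samples. When the ball B(x, A) holds more than k samples, the k nearest ones
   are, given the (k+1)-st, independent and confined to the ball that it bounds:
   in the second moment of the average the diagonal terms are O(1/k) and, by (c),
   the off-diagonal ones are O(r^4), with r the distance of the (k+1)-st sample.
   Otherwise the number of samples in B(x, A) is bounded, which by (d) has
   probability O(exp (- c N f x)), while (e) controls the moments of a. In the
   mean, 1/k is O(min(1, (N f x)^-q)) and r^4 is O(min(1, (N Z x)^(-4(1-q)/d)))
   up to the former term, where Z = (f / P(B(., A))^q)^(1/(1-q)). By (b') and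
   (T), f(X) and Z(X) are below t with probability O(t^beta'), and a sum over
   dyadic values of t gives the rate. *)
Require Import Defs.
From HB Require Import structures.
From mathcomp Require Import all_boot all_order all_algebra.
From mathcomp Require Import all_classical all_reals all_analysis.
From mathcomp Require Import measurable_realfun.
From mathcomp Require Import ring lra zify.

Set Implicit Arguments.
Unset Strict Implicit.
Unset Printing Implicit Defensive.

Import Order.TTheory GRing.Theory Num.Theory.
Import numFieldNormedType.Exports.

Local Open Scope classical_set_scope.
Local Open Scope ring_scope.

(** * Ranking by distance *)

Section rank.
Context {R : realType} {N : nat}.
Implicit Types (delta : 'I_N -> R) (i j : 'I_N).

(** The obstacle is that k is itself a function of the sample, through the number n of points in
    B(x, A), so the (k+1)-st neighbour is not an order statistic of fixed rank. No conditional law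
    is formed. The expectation is split according to the index j of the (k+1)-st neighbour, and two
    coordinates i, i' that precede j are redrawn independently. Once j lies in B(x, A), so do i and
    i', and both count in n wherever they sit in the ball bounded by j. Hence n, k and the rank of j
    do not see the redrawing, and the expectation factors. Breaking ties by index keeps this exact
    when distances coincide; the price is that i ranges over a closed ball if i < j and over an open
    one otherwise, so (c) must be extended to open balls and to radius 0. On the complementary event
    the neighbours may lie outside B(x, A), where only the linear growth of eta given by (e)
    controls them. Their squared distances are then dominated by the average over all samples, whose
    mean is of order 1 + |x|^2: this is the weight that (b') integrates. *)

Definition before delta i j :=
  (delta i < delta j) || ((delta i == delta j) && (i < j)%N).

Definition nrank delta j : nat := (\sum_i before delta i j)%N.

Definition ncount delta (r : R) : nat := (\sum_i (delta i <= r)%R)%N.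

Lemma before_irr delta : irreflexive (before delta).
Proof. by move=> i; rewrite /before ltxx eqxx ltnn. Qed.

Lemma before_trans delta : transitive (before delta).
Proof.
move=> j i l /orP[ij|/andP[/eqP ij ij']] /orP[jl|/andP[/eqP jl jl']];
  apply/orP.
- by left; exact: lt_trans jl.
- by left; rewrite -jl.
- by left; rewrite ij.
- by right; rewrite ij jl eqxx (ltn_trans ij' jl').
Qed.

Lemma beforeNC delta i j : before delta i j -> before delta j i = false.
Proof.
move=> ij; apply/negbTE/negP => ji.
by have := before_trans ij ji; rewrite before_irr.
Qed.

Section sorted_rank.
Variables (delta : 'I_N -> R) (s : seq 'I_N).
Hypotheses (sorted_s : sorted (before delta) s) (perm_s : perm_eq s (enum 'I_N)).

Let us : uniq s. Proof. by rewrite (perm_uniq perm_s) enum_uniq. Qed.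
Let mems i : i \in s. Proof. by rewrite (perm_mem perm_s) mem_enum. Qed.
Let sizes : size s = N. Proof. by rewrite (perm_size perm_s) size_enum_ord. Qed.

Lemma before_index i j : before delta i j = (index i s < index j s)%N.
Proof.
apply/idP/idP => [ij|]; last first.
  exact: (sorted_ltn_index (@before_trans delta) sorted_s).
rewrite ltnNge leq_eqVlt; apply/negP => /orP[/eqP ji|ji].
  have e : j = i by rewrite -(nth_index i (mems j)) ji nth_index.
  by move: ij; rewrite e before_irr.
have /beforeNC := (sorted_ltn_index (@before_trans delta) sorted_s) _ _ (mems j) (mems i) ji.
by rewrite ij.
Qed.

Lemma nrank_index j : nrank delta j = index j s.
Proof.
have js : (index j s <= N)%N by have := index_size j s; rewrite sizes.
rewrite /nrank -(perm_big _ (perm_trans perm_s _))/=; last first.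
  by rewrite enumT; exact: perm_refl.
rewrite (big_nth j) sizes (big_cat_nat (n := index j s))//=.
rewrite big_nat (eq_bigr (fun=> 1%N)) => [|i /andP[_ ij]]; last first.
  by rewrite before_index index_uniq ?ij// sizes (leq_trans ij).
rewrite -big_nat sum_nat_const_nat subn0 muln1.
rewrite big_nat big1 ?addn0// => i /andP[ji iN].
by rewrite before_index index_uniq ?sizes// ltnNge ji.
Qed.

Lemma sorted_take_mem k i : (i \in take k s) = (nrank delta i < k)%N.
Proof. by rewrite nrank_index in_take. Qed.

End sorted_rank.

End rank.

Section rank_exists.
Context {R : realType} {N : nat}.
Implicit Types (delta : 'I_N -> R) (i j : 'I_N).

(** Stability keeps samples at equal distance in the order of [enum], which is the tie-break of
    [before]; so [nrank] is the position in [neighbors]. *)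
Lemma sort_before delta :
  sorted (before delta) (sort (fun i j => delta i <= delta j) (enum 'I_N)).
Proof.
have tot : total (fun i j => delta i <= delta j).
  by move=> i j; exact: le_total.
pose leT' (i j : 'I_N) := (i < j)%N.
have tr : transitive leT' by move=> j i l; exact: ltn_trans.
have se : sorted leT' (enum 'I_N).
  have := iota_ltn_sorted 0 N; rewrite -val_enum_ord sorted_map.
  by apply: sub_sorted.
have := sort_stable tot tr se; apply: sub_sorted => i j /=.
rewrite /before => /andP[ij /implyP ji].
move: ij; rewrite le_eqVlt => /orP[/eqP e|->//].
by apply/orP; right; rewrite e eqxx; apply: ji; rewrite e.
Qed.

Lemma sorted_before_exists delta : exists s : seq 'I_N,
  sorted (before delta) s /\ perm_eq s (enum 'I_N).
Proof. by eexists; split; [exact: sort_before|rewrite perm_sort]. Qed.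

Lemma nrank_inj delta : injective (nrank delta).
Proof.
have [s [ss ps]] := sorted_before_exists delta.
move=> i j; rewrite !(nrank_index ss ps) => ij.
have mems l : l \in s by rewrite (perm_mem ps) mem_enum.
by rewrite -(nth_index i (mems i)) ij nth_index.
Qed.

Lemma before_nrank delta i j : before delta i j = (nrank delta i < nrank delta j)%N.
Proof.
have [s [ss ps]] := sorted_before_exists delta.
by rewrite !(nrank_index ss ps) (before_index ss ps).
Qed.

Lemma nrank_surj delta k : (k < N)%N -> exists j, nrank delta j = k.
Proof.
move=> kN; have [s [ss ps]] := sorted_before_exists delta.
have i0 : 'I_N by exists k.
exists (nth i0 s k); rewrite (nrank_index ss ps) index_uniq//.
  by rewrite (perm_size ps) size_enum_ord.
by rewrite (perm_uniq ps) enum_uniq.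
Qed.

Lemma sum_nrank_lt delta k : (k <= N)%N -> (\sum_i (nrank delta i < k))%N = k.
Proof.
move=> kN; have [s [ss ps]] := sorted_before_exists delta.
transitivity (\sum_(i <- take k s) 1)%N; last first.
  by rewrite sum1_size size_takel// (perm_size ps) size_enum_ord.
have us : uniq (take k s) by rewrite take_uniq// (perm_uniq ps) enum_uniq.
rewrite (big_uniq _ us)/=.
rewrite [RHS]big_mkcond/=; apply: eq_bigr => i _.
by rewrite (sorted_take_mem ss ps); case: ltnP.
Qed.

Lemma ncount_le delta r : (ncount delta r <= N)%N.
Proof.
rewrite -[X in (_ <= X)%N]card_ord -sum1_card; apply: leq_sum => i _.
by case: (_ <= _).
Qed.

(** Used at rank k: a (k+1)-st neighbour farther than r forces at most k samples within r. *)
Lemma ncount_nrank delta r j : r < delta j -> (ncount delta r <= nrank delta j)%N.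
Proof.
move=> rj; apply: leq_sum => i _; rewrite /before.
by case: (leP (delta i) r) => // ir; rewrite (le_lt_trans ir rj).
Qed.

Lemma before_le delta i j : before delta i j -> delta i <= delta j.
Proof. by move=> /orP[/ltW//|/andP[/eqP-> _]]. Qed.

End rank_exists.

Section neighbors.
Context {R : realType} {d N : nat}.
Variables (nrm : 'rV[R]_d -> R) (xs : 'I_N -> 'rV[R]_d) (x : 'rV[R]_d).

Lemma mem_take_neighbors k i :
  (i \in take k (neighbors nrm xs x)) = (nrank (fun i => nrm (xs i - x)%R) i < k)%N.
Proof. by apply: sorted_take_mem; [exact: sort_before|rewrite perm_sort]. Qed.

Lemma neighbors_uniq : uniq (neighbors nrm xs x).
Proof. by rewrite sort_uniq enum_uniq. Qed.

End neighbors.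

(** * Measurability and integrals of nonnegative functions *)

Section measure_utils.
Context {d} {T : measurableType d} {R : realType}.
Local Open Scope ereal_scope.

Lemma prob_integral_cst (P : probability T R) (r : \bar R) : \int[P]_x r = r.
Proof. by have := integral_cst P measurableT r; rewrite /= probability_setT mule1. Qed.

(** The integral of a nonnegative function is a supremum over the simple functions below it, so
    monotonicity holds without measurability. *)
Lemma le_integral_ge0 (mu : {measure set T -> \bar R}) (f g : T -> \bar R) :
  (forall x, 0 <= f x) -> (forall x, f x <= g x) ->
  \int[mu]_x f x <= \int[mu]_x g x.
Proof.
move=> f0 fg; rewrite !ge0_integralTE//; last by move=> x; exact: le_trans (fg x).
apply: le_ereal_sup => _ [h hf <-]; exists h => //= x.
exact: le_trans (fg x).
Qed.

Lemma measurable_bigsum (I : Type) (s : seq I) (h : I -> T -> R) :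
  (forall i, measurable_fun setT (h i)) ->
  measurable_fun setT (fun x => (\sum_(i <- s) h i x)%R).
Proof.
move=> mh; elim: s => [|i s IH].
  by under eq_fun do rewrite big_nil; exact: measurable_cst.
by under eq_fun do rewrite big_cons; exact: measurable_funD.
Qed.

Lemma measurable_bigsumn (I : Type) (s : seq I) (h : I -> T -> nat) :
  (forall i, measurable_fun setT (h i)) ->
  measurable_fun setT (fun x => (\sum_(i <- s) h i x)%N).
Proof.
move=> mh; elim: s => [|i s IH].
  by under eq_fun do rewrite big_nil; exact: measurable_cst.
by under eq_fun do rewrite big_cons; exact: measurable_fun_addn.
Qed.

(** Every set of naturals is measurable, so [F] may be arbitrary; this covers the roundings and
    inverse powers applied to counts. *)
Lemma measurable_natfun d' (U : measurableType d') (h : T -> nat) (F : nat -> U) :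
  measurable_fun setT h -> measurable_fun setT (fun x => F (h x)).
Proof. by move=> mh; apply: (measurableT_comp _ mh). Qed.

Lemma measurable_boolfun d' (U : measurableType d') (h : T -> bool) (F : bool -> U) :
  measurable_fun setT h -> measurable_fun setT (fun x => F (h x)).
Proof. by move=> mh; apply: (measurableT_comp _ mh). Qed.

Lemma measurable_set_bool (h : T -> bool) :
  measurable_fun setT h -> measurable [set x | h x].
Proof.
move=> mh; have := mh measurableT [set true] I; rewrite setTI.
by rewrite (_ : _ @^-1` _ = [set x | h x]).
Qed.

Lemma integral_bool (mu : {measure set T -> \bar R}) (h : T -> bool) :
  measurable_fun setT h -> \int[mu]_x ((h x)%:R%:E) = mu [set x | h x].
Proof.
move=> mh; rewrite -[X in _ = mu X]setIT -integral_indic//; last exact: measurable_set_bool.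
apply: eq_integral => x _; rewrite indicE; congr ((nat_of_bool _)%:R%:E).
by apply/idP/idP; rewrite inE.
Qed.

End measure_utils.

(* The canonical instance itself: 'rV[T]_N would leave reverse_coercion marks in
   the types of the measures, which block rewriting. *)
Notation rowT T N := (@matrix_matrix__canonical__measurable_structure_Measurable _ T N).

(** * Rows of independent samples *)

Section box.
Context {dT} {T : measurableType dT} {N : nat}.

Definition box (E : 'I_N -> set T) : set 'rV[T]_N :=
  [set v | forall i, E i (v ord0 i)].

Lemma measurable_box (E : 'I_N -> set T) :
  (forall i, measurable (E i)) -> measurable (box E).
Proof.
move=> mE; rewrite (_ : box E = \bigcap_(i in [set: 'I_N])
     ((fun v : 'rV[T]_N => v ord0 i) @^-1` E i)); last first.
  by apply/seteqP; split => v /= h i //; [move=> _; exact: h|exact: (h i)].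
apply: fin_bigcap_measurable => [|i _]; first exact: finite_finset.
by rewrite -[X in measurable X]setTI; apply: measurable_coord.
Qed.

Definition boxes : set (set 'rV[T]_N) :=
  [set B | exists2 E, (forall i, measurable (E i)) & B = box E].

Lemma measurable_boxes : @measurable _ 'rV[T]_N = <<s boxes >>.
Proof.
apply/seteqP; split; last first.
  apply: smallest_sub; first exact: sigma_algebra_measurable.
  by move=> _ [E mE ->]; exact: measurable_box.
apply: smallest_sub; first exact: smallest_sigma_algebra.
move=> A; rewrite -bigcup_seq/= => -[i _ [B mB <-]].
apply: sub_sigma_algebra; exists (fun j => if j == i then B else setT).
  by move=> j; case: ifP.
apply/seteqP; split => v /=.
  by move=> [_ Bv] j; case: eqP => // ->.
by move=> /(_ i); rewrite eqxx.
Qed.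

Lemma setI_closed_boxes : setI_closed boxes.
Proof.
move=> _ _ [E mE ->] [F mF ->]; exists (fun i => E i `&` F i).
  by move=> i; exact: measurableI.
by apply/seteqP; split => v /= => [[Ev Fv] i|EF]; split => //; [move=> i; case: (EF i)|move=> i; case: (EF i)].
Qed.

Lemma rV_measure_unique (R : realType) (m1 m2 : {measure set (rowT T N) -> \bar R}) :
  (m1 setT < +oo)%E ->
  (forall E : 'I_N -> set T, (forall i, measurable (E i)) -> m1 (box E) = m2 (box E)) ->
  forall A, measurable A -> m1 A = m2 A.
Proof.
move=> m1oo m12 A mA.
apply: (measure_unique boxes (fun=> setT)) => //.
- exact: measurable_boxes.
- exact: setI_closed_boxes.
- move=> _; exists (fun=> setT) => //; apply/seteqP; split => //.
- by apply/seteqP; split => // v _; exists 0%N.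
- by move=> _ [E mE ->]; exact: m12.
Qed.

End box.

(** * Redrawing one coordinate of an independent row *)

Section upd.
Context {dT} {T : measurableType dT} {N : nat}.

Definition upd (v : 'rV[T]_N) (i : 'I_N) (t : T) : 'rV[T]_N :=
  \row_j if j == i then t else v ord0 j.

Lemma updE v i t j : upd v i t ord0 j = if j == i then t else v ord0 j.
Proof. by rewrite mxE. Qed.

Lemma measurable_upd i :
  measurable_fun setT (fun p : 'rV[T]_N * T => upd p.1 i p.2).
Proof.
apply: measurable_fun_rVP => j; under eq_fun do rewrite updE.
case: eqP => _; first exact: measurable_snd.
exact: (measurableT_comp (measurable_coord j) measurable_fst).
Qed.

Lemma measurable_upd1 v i : measurable_fun setT (upd v i).
Proof.
apply: (measurableT_comp (measurable_upd i) (_ : measurable_fun setT (fun t => (v, t)))).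
by apply: measurable_fun_pair; [exact: measurable_cst|exact: measurable_id].
Qed.

End upd.

Section product_law.
Context {R : realType} {dT} {T : measurableType dT} {N : nat}.
Variables (mu : probability T R) (Q : probability (rowT T N) R).
Hypothesis Qbox : forall E : 'I_N -> set T, (forall i, measurable (E i)) ->
  Q (box E) = (\prod_i mu (E i))%E.

(** This replaces Fubini on an N-fold product: the joint law is known only through its values on
    boxes, and redrawing one coordinate preserves these. *)
Lemma resample_law i A : measurable A ->
  Q A = pushforward (Q \x mu)%E (fun p => upd p.1 i p.2) A.
Proof.
move=> mA.
apply: (@rV_measure_unique _ _ _ _ Q (measure_function_pushforward__canonical__measure_function_Measure (Q \x mu)%E (measurable_upd i))) => //.
  by apply: (le_lt_trans (probability_le1 Q _)) => //; rewrite ltry.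
move=> E mE; rewrite /= /pushforward.
(* The old i-th coordinate is forgotten, so the preimage of a box leaves its i-th side free and asks
   [E i] of the new draw. *)
pose F j := if j == i then setT else E j.
have mF j : measurable (F j) by rewrite /F; case: ifP.
rewrite (_ : _ @^-1` _ = box F `*` E i); last first.
  apply/seteqP; split => -[v t] /= h.
    split; last by have := h i; rewrite updE eqxx.
    by move=> j; rewrite /F; case: eqP => // /eqP ji; have := h j; rewrite updE (negbTE ji).
  move=> j; rewrite updE; case: eqP => [->|/eqP ji]; first exact: h.2.
  by have := h.1 j; rewrite /F (negbTE ji).
rewrite product_measure1E//; last exact: measurable_box.
transitivity (Q (box F) * mu (E i))%E => //.
rewrite !Qbox// muleC.
have [D1 D2] : (\prod_j mu (E j) = mu (E i) * \prod_(j | j != i) mu (E j))%E /\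
  (\prod_j mu (F j) = mu (F i) * \prod_(j | j != i) mu (F j))%E.
  by split; rewrite [LHS](bigD1 i).
rewrite D1 D2 {1}/F eqxx probability_setT mul1e.
by congr (_ * _)%E; apply: eq_bigr => j ji; rewrite /F (negbTE ji).
Qed.

Lemma ge0_resample (i : 'I_N) (h : 'rV[T]_N -> \bar R) :
  measurable_fun [set: 'rV[T]_N] h -> (forall v, 0 <= h v)%E ->
  (\int[Q]_v h v = \int[Q]_v \int[mu]_t h (upd v i t))%E.
Proof.
move=> mh h0.
rewrite (eq_measure_integral (measure_function_pushforward__canonical__measure_function_Measure
  (Q \x mu)%E (measurable_upd i))); last by move=> A mA _; exact: resample_law.
rewrite ge0_integral_pushforward//; last exact: measurable_upd.
rewrite preimage_setT.
rewrite fubini_tonelli1// => [|p]; last exact: h0.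
by apply: measurableT_comp => //; exact: measurable_upd.
Qed.

Lemma integrable_resample (i : 'I_N) (h : 'rV[T]_N -> \bar R) :
  Q.-integrable setT h -> (Q \x mu)%E.-integrable setT (fun p => h (upd p.1 i p.2)).
Proof.
move=> /integrableP[mh ih].
have mh' : measurable_fun setT (fun p : 'rV[T]_N * T => h (upd p.1 i p.2)).
  by apply: measurableT_comp => //; exact: measurable_upd.
apply/integrableP; split => //.
rewrite fubini_tonelli1//; last exact: measurableT_comp.
move: ih; rewrite (ge0_resample i)//; exact: measurableT_comp.
Qed.

Lemma integral_resample (i : 'I_N) (h : 'rV[T]_N -> \bar R) :
  Q.-integrable setT h ->
  (\int[Q]_v h v = \int[Q]_v \int[mu]_t h (upd v i t))%E.
Proof.
move=> ih; have [mh _] := integrableP _ _ _ ih.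
have ih' := integrable_resample i ih.
rewrite (integral12_prod_meas1 ih').
rewrite (eq_measure_integral (measure_function_pushforward__canonical__measure_function_Measure
  (Q \x mu)%E (measurable_upd i))); last by move=> A mA _; exact: resample_law.
by rewrite integral_pushforward//; exact: measurable_upd.
Qed.

Lemma integrable_resample1 (i : 'I_N) (h : 'rV[T]_N -> \bar R) :
  Q.-integrable setT h ->
  Q.-integrable setT (fun v => \int[mu]_t h (upd v i t))%E.
Proof. by move=> /(integrable_resample i)/integrable_fubini_F. Qed.

Lemma ge0_integral_coord (i : 'I_N) (h : T -> \bar R) :
  measurable_fun setT h -> (forall t, 0 <= h t)%E ->
  (\int[Q]_v h (v ord0 i) = \int[mu]_t h t)%E.
Proof.
move=> mh h0.
rewrite (ge0_resample i)//; last first.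
  by apply: measurableT_comp => //; exact: measurable_coord.
under eq_integral do under eq_integral do rewrite updE eqxx.
exact: prob_integral_cst.
Qed.

End product_law.

(** * Mean, variance and lower tail of a binomial count *)

Section counts.
Context {R : realType} {dT} {T : measurableType dT} {N : nat}.
Variables (mu : probability T R) (Q : probability (rowT T N) R).
Hypothesis Qbox : forall E : 'I_N -> set T, (forall i, measurable (E i)) ->
  Q (box E) = (\prod_i mu (E i))%E.
Variables (b : T -> bool) (mb : measurable_fun setT b).

Definition cnt (v : 'rV[T]_N) : nat := (\sum_i b (v ord0 i))%N.

Let p := fine (mu [set t | b t]).
Let mB : measurable [set t | b t]. Proof. exact: measurable_set_bool. Qed.
Let pE : mu [set t | b t] = p%:E. Proof. by rewrite fineK// fin_num_measure. Qed.
Let p0 : 0 <= p. Proof. by rewrite -lee_fin -pE. Qed.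
Let p1 : p <= 1. Proof. by rewrite -lee_fin -pE probability_le1. Qed.

Let mbi i : measurable_fun setT (fun v : rowT T N => b (v ord0 i)).
Proof. by apply: measurableT_comp => //; exact: measurable_coord. Qed.

Lemma measurable_cnt : measurable_fun [set: rowT T N] cnt.
Proof.
apply: measurable_bigsumn => i; exact: (measurable_boolfun nat_of_bool (mbi i)).
Qed.

Lemma coord_prob i : Q [set v | b (v ord0 i)] = p%:E.
Proof.
rewrite -(integral_bool Q (mbi i)) -pE -(integral_bool mu mb).
apply: (ge0_integral_coord Qbox i (h := fun t => (b t)%:R%:E)) => //.
exact/measurable_EFinP/(measurable_boolfun (fun c : bool => c%:R : R) mb).
Qed.

Lemma coord2_prob i j : i != j ->
  Q [set v | b (v ord0 i) && b (v ord0 j)] = (p ^+ 2)%:E.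
Proof.
move=> ij; pose E l := if (l == i) || (l == j) then [set t | b t] else setT.
have mE l : measurable (E l) by rewrite /E; case: ifP.
transitivity (Q (box E)).
  congr (Q _).
  apply/seteqP; split => v /=.
    by move=> /andP[bi bj] l; rewrite /E; case: eqP => [->|]//=; case: eqP => [->|].
  by move=> h; have := h i; have := h j; rewrite /E !eqxx/= orbT => -> ->.
rewrite Qbox// [LHS](bigD1 i)//= [X in (_ * X)%E](bigD1 j)/=; last by rewrite eq_sym.
rewrite {1}/E eqxx/= {1}/E eqxx orbT/= [X in (_ * (_ * X))%E]big1 ?mule1.
  by rewrite pE -EFinM expr2.
by move=> l /andP[li lj]; rewrite /E (negbTE li) (negbTE lj)/= probability_setT.
Qed.

Let u := N%:R * p.

Lemma integral_cnt : (\int[Q]_v (cnt v)%:R%:E = u%:E)%E.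
Proof.
under eq_integral do rewrite natr_sum -sumEFin.
rewrite ge0_integral_sum//; last first.
  move=> i; apply/measurable_EFinP.
  exact: (measurable_boolfun (fun c : bool => c%:R : R) (mbi i)).
rewrite (eq_bigr (fun=> p%:E)) => [|i _]; last first.
  by rewrite integral_bool//; exact: coord_prob.
by rewrite sumEFin sumr_const card_ord -mulr_natl.
Qed.

Lemma integral_cnt2 :
  (\int[Q]_v ((cnt v)%:R ^+ 2)%:E = (u + N%:R * (N%:R - 1) * p ^+ 2)%:E)%E.
Proof.
have mij i j : measurable_fun setT (fun v : rowT T N => b (v ord0 i) && b (v ord0 j)).
  exact: measurable_and.
have e v : (((cnt v)%:R ^+ 2 : R)%:E =
    \sum_i \sum_j (b (v ord0 i) && b (v ord0 j))%:R%:E)%E.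
  rewrite /cnt natr_sum expr2 mulr_suml; under [RHS]eq_bigr do rewrite sumEFin.
  rewrite sumEFin; congr _%:E; apply: eq_bigr => i _; rewrite mulr_sumr.
  by apply: eq_bigr => j _; rewrite -natrM mulnb.
under eq_integral do rewrite e.
have mij' i j : measurable_fun [set: rowT T N]
    (fun v => (b (v ord0 i) && b (v ord0 j))%:R%:E : \bar R).
  apply/measurable_EFinP; exact: (measurable_boolfun (fun c : bool => c%:R : R) (mij i j)).
rewrite ge0_integral_sum//; last 2 first.
  by move=> i; exact: emeasurable_sum.
  by move=> i v _; exact: sume_ge0.
transitivity (\sum_(i < N) (p + (N%:R - 1) * p ^+ 2)%:E)%E; last first.
  by rewrite sumEFin sumr_const card_ord -mulr_natl; congr _%:E; rewrite /u; ring.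
apply: eq_bigr => i _.
rewrite ge0_integral_sum//.
rewrite [LHS](bigD1 i)//= EFinD; congr (_ + _)%E.
  rewrite integral_bool// -(coord_prob i); congr (Q _).
  by apply/seteqP; split => v /=; rewrite andbb.
rewrite (eq_bigr (fun=> (p ^+ 2)%:E)); last first.
  by move=> j ji; rewrite integral_bool//; apply: coord2_prob; rewrite eq_sym.
rewrite sumEFin sumr_const; congr EFin.
rewrite -[LHS]mulr_natl; congr (_ * _).
rewrite (cardC1 i) card_ord.
by case: (N) i => [[]//|n _]; rewrite -natr1 addrK.
Qed.

Lemma cnt_variance : (\int[Q]_v (((cnt v)%:R - u) ^+ 2)%:E <= u%:E)%E.
Proof.
have u0 : 0 <= u by rewrite mulr_ge0.
have mc : measurable_fun [set: rowT T N] (fun v => (cnt v)%:R : R).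
  exact: (measurable_natfun (fun n : nat => n%:R : R) measurable_cnt).
(* The cross term of the square is moved to the left, so that only integrals of nonnegative
   functions are added and no subtraction occurs in [\bar R]. *)
have H : (\int[Q]_v (((cnt v)%:R - u) ^+ 2)%:E + (2 * u * u)%:E =
   (u + N%:R * (N%:R - 1) * p ^+ 2)%:E + (u ^+ 2)%:E)%E.
  rewrite -integral_cnt2 -(prob_integral_cst Q (u ^+ 2)%:E) -ge0_integralD//=; last 2 first.
  - by apply/measurable_EFinP; exact: measurable_funX.
  - by move=> v _; rewrite lee_fin sqr_ge0.
  rewrite (EFinM _ u) -integral_cnt -ge0_integralZl//; last 2 first.
  - by apply/measurable_EFinP.
  - by rewrite lee_fin mulr_ge0.
  rewrite -ge0_integralD//=; last 4 first.
  - by move=> v _; rewrite lee_fin sqr_ge0.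
  - by apply/measurable_EFinP; apply: measurable_funX; apply: measurable_funB => //; exact: measurable_cst.
  - by move=> v _; rewrite -EFinM lee_fin !mulr_ge0.
  - by apply: measurable_funeM; apply/measurable_EFinP.
  apply: eq_integral => v _; rewrite -!EFinM -!EFinD; congr _%:E; ring.
have -> : (\int[Q]_v (((cnt v)%:R - u) ^+ 2)%:E = (u - u * p)%:E)%E.
  move: H; case: (integral _ _ _) => [r| |]//=.
  by rewrite -!EFinD => -[h]; congr _%:E; rewrite /u in h *; lra.
by rewrite lee_fin gerBl mulr_ge0.
Qed.

Lemma cnt_chebyshev (A : set (rowT T N)) (s : R) : 0 < s -> measurable A ->
  (forall v, A v -> s <= `|(cnt v)%:R - u|) -> (Q A <= (u / s ^+ 2)%:E)%E.
Proof.
move=> s0 mA As.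
have s20 : 0 < s ^+ 2 by rewrite exprn_gt0.
have : ((s ^+ 2)%:E * Q A <= u%:E)%E.
  apply: le_trans cnt_variance.
  rewrite -[X in Q X]setIT -integral_indic// -ge0_integralZl//; last 2 first.
  - exact/measurable_EFinP/measurable_indic.
  - by rewrite lee_fin ltW.
  apply: le_integral_ge0 => v; rewrite -EFinM lee_fin indicE.
    by rewrite mulr_ge0// ltW.
  case: (boolP (v \in A)) => [/set_mem/As sv|_]; last by rewrite mulr0 sqr_ge0.
  by rewrite mulr1 -(real_normK (num_real (_ - u))) ler_pXn2r// nnegrE ltW.
by rewrite -lee_pdivlMl// mulrC EFinM.
Qed.

Let block_count (m c : nat) : (c.+1 * m <= N)%N ->
  (m <= \sum_(i < N) (i %/ m == c))%N.
Proof.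
move=> cmN; case: (posnP m) => [->//|m0].
rewrite -(big_mkord xpredT (fun i => nat_of_bool (i %/ m == c)%N)).
rewrite (big_cat_nat (n := (c * m)%N))//=; last by rewrite (leq_trans _ cmN)// leq_mul.
rewrite (big_cat_nat (m := (c * m)%N) (n := (c.+1 * m)%N))//=; last by rewrite leq_mul.
rewrite (leq_trans _ (leq_addl _ _))// (leq_trans _ (leq_addr _ _))//.
rewrite big_nat (eq_bigr (fun=> 1%N)) => [|i /andP[ci ic]]; last first.
  by rewrite eqn_leq -ltnS ltn_divLR// ic leq_divRL// ci.
by rewrite -big_nat sum_nat_const_nat mulSn addnK muln1.
Qed.

(* If b holds at most n1 times, it fails throughout one of n1 + 1 disjoint blocks
   of N %/ n1.+1 coordinates. *)
Lemma cnt_le_exp (n1 : nat) :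
  (Q [set v | (cnt v <= n1)%N] <=
    (n1.+1%:R * expR (- (p * (N %/ n1.+1)%:R)))%:E)%E.
Proof.
set m := (N %/ n1.+1)%N.
pose E (c : nat) (i : 'I_N) := if (i %/ m == c)%N then [set t | ~~ b t] else setT.
have mE c i : measurable (E c i).
  rewrite /E; case: ifP => // _.
  by apply: measurable_set_bool; exact: measurable_neg.
have mC : measurable [set v : rowT T N | (cnt v <= n1)%N].
  by apply: measurable_set_bool; apply: measurable_fun_leq => //; exact: measurable_cnt.
have QE (c : 'I_n1.+1) : (Q (box (E c)) <= (expR (- (p * m%:R)))%:E)%E.
  rewrite Qbox// (_ : (\prod_i mu (E c i) = (\prod_(i < N) (1 - (i %/ m == c)%N%:R * p))%:E)%E).
    rewrite lee_fin.
    apply: (@le_trans _ _ (\prod_(i < N) expR (- ((i %/ m == c)%N%:R * p)))).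
      apply: ler_prod => i _; rewrite expR_ge1Dx andbT subr_ge0.
      by case: (_ == _); rewrite ?mul0r ?mul1r.
    rewrite -expR_sum ler_expR sumrN lerN2 -mulr_suml mulrC ler_wpM2r//.
    rewrite -natr_sum ler_nat block_count//.
    by rewrite (leq_trans _ (leq_trunc_div N n1.+1))// mulnC leq_mul.
  rewrite -prodEFin; apply: eq_bigr => i _; rewrite /E; case: eqP => _.
    rewrite (_ : [set t | _] = ~` [set t | b t]).
      by rewrite probability_setC// pE mul1r EFinB.
    by apply/seteqP; split => t /= /negP.
  by rewrite probability_setT mul0r subr0.
have sub : [set v : rowT T N | (cnt v <= n1)%N] `<=` \big[setU/set0]_(c < n1.+1) box (E c).
  move=> v /= cv; apply: contrapT => nbig.
  have ex (c : 'I_n1.+1) : exists i : 'I_N, (i %/ m == c)%N && b (v ord0 i).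
    apply: contrapT => nc; apply: nbig; rewrite -bigcup_mkord_ord.
    exists c => //=; rewrite inord_val => i; rewrite /E; case: ifP => // ic.
    by apply/negP => bi; apply: nc; exists i; rewrite ic.
  (* One success is chosen in each block. The block can be read off the index, so these n1 + 1
     successes are distinct. *)
  pose g c := xchoose (ex c).
  have gP c : (g c %/ m == c)%N && b (v ord0 (g c)) by exact: xchooseP (ex c).
  have ginj : injective g.
    move=> c c' gcc; apply/val_inj => /=.
    by have /andP[/eqP <- _] := gP c; have /andP[/eqP <- _] := gP c'; rewrite gcc.
  have : (n1.+1 <= cnt v)%N.
    rewrite -[X in (X <= _)%N](card_ord n1.+1) -(card_imset predT ginj).
    rewrite /cnt -[X in (_ <= X)%N](_ : #|[set i | b (v ord0 i)]%SET| = _).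
      apply: subset_leq_card; apply/fintype.subsetP => i /imsetP[c _ ->].
      by rewrite finset.inE; have /andP[] := gP c.
    by rewrite -sum1_card big_mkcond/=; apply: eq_bigr => i _; rewrite finset.inE; case: (b _).
  by rewrite ltnNge cv.
apply: (@le_trans _ _ (\sum_(c < n1.+1) Q (box (E c)))%E).
  by apply: (@content_subadditive _ _ _ Q _ (fun c => box (E c)) n1.+1) => // k _; exact: measurable_box.
apply: (@le_trans _ _ (\sum_(c < n1.+1) (expR (- (p * m%:R)))%:E)%E).
  by apply: lee_sum => c _; exact: QE.
by rewrite sumEFin sumr_const card_ord mulr_natl.
Qed.

End counts.

(** * Second moment of a nearest-neighbour average *)

Section nn_average.
Context {R : realType} {dT} {T : measurableType dT} {S : Type} {N : nat}.
Variables (mu : probability T R) (Q : probability (rowT T N) R).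
Hypothesis Qbox : forall E : 'I_N -> set T, (forall i, measurable (E i)) ->
  Q (box E) = (\prod_i mu (E i))%E.
Variables (pi : T -> S) (rho a : T -> R).
Hypotheses (mrho : measurable_fun setT rho) (ma : measurable_fun setT a).
Hypotheses (rho0 : forall t, 0 <= rho t)
  (pi_rho : forall t t', pi t = pi t' -> rho t = rho t').
Variables (C1 C2 CB : R).
Hypotheses (C10 : 0 <= C1) (C20 : 0 <= C2) (CB0 : 0 <= CB).
Hypothesis cond_var : forall w : T -> R, measurable_fun setT w ->
  (forall t, 0 <= w t) -> (forall t t', pi t = pi t' -> w t = w t') ->
  (\int[mu]_t (w t * a t ^+ 2)%:E <= \int[mu]_t (w t * (C1 + C2 * rho t ^+ 2))%:E)%E.

Definition dist_row (v : 'rV[T]_N) (i : 'I_N) : R := rho (v ord0 i).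
Local Notation delta := dist_row.

Lemma measurable_dist_row i : measurable_fun [set: rowT T N] (delta ^~ i).
Proof. by apply: measurableT_comp => //; exact: measurable_coord. Qed.
Hint Resolve measurable_dist_row : core.

Lemma measurable_a_row i : measurable_fun [set: rowT T N] (fun v => a (v ord0 i)).
Proof. by apply: measurableT_comp => //; exact: measurable_coord. Qed.

(** [cond_var] is the integrated form of E[a^2 | pi] <= C1 + C2 rho^2, with [pi] the projection of a
    sample to its point. The weight may depend on the whole row, but on the i-th sample only through
    its point; redrawing that sample reduces the claim to a single one. *)
Lemma cond_var_row i (w : 'rV[T]_N -> R) :
  measurable_fun [set: rowT T N] w -> (forall v, 0 <= w v) ->
  (forall v t t', pi t = pi t' -> w (upd v i t) = w (upd v i t')) ->
  (\int[Q]_v (w v * a (v ord0 i) ^+ 2)%:E <=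
   \int[Q]_v (w v * (C1 + C2 * delta v i ^+ 2))%:E)%E.
Proof.
move=> mw w0 wpi.
have ma' := measurable_a_row i.
rewrite (ge0_resample Qbox i); last 2 first.
- by apply/measurable_EFinP; apply: measurable_funM => //; exact: measurable_funX.
- by move=> v; rewrite lee_fin mulr_ge0// sqr_ge0.
rewrite [leRHS](ge0_resample Qbox i); last 2 first.
- apply/measurable_EFinP; apply: measurable_funM => //.
  apply: measurable_funD; first exact: measurable_cst.
  by apply: measurable_funM; [exact: measurable_cst|exact: measurable_funX].
- by move=> v; rewrite lee_fin mulr_ge0// addr_ge0// mulr_ge0// sqr_ge0.
apply: le_integral_ge0 => v.
  by apply: integral_ge0 => t _; rewrite lee_fin mulr_ge0// sqr_ge0.
under eq_integral do rewrite updE eqxx.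
under [leRHS]eq_integral do rewrite /delta updE eqxx.
apply: cond_var => //; last by move=> t t' tt'; exact: wpi.
exact: (measurableT_comp mw (measurable_upd1 v i)).
Qed.

(* The indices before j are those of the points in the open (or closed, if
   their index is smaller) ball of radius [delta v j]. *)
Definition inball (o : bool) (r : R) (t : T) : bool :=
  if o then rho t <= r else rho t < r.

Lemma before_inball v i j : before (delta v) i j = inball (i < j)%N (delta v j) (v ord0 i).
Proof.
rewrite /before /inball /delta; case: ltnP => ij; rewrite ?andbT ?andbF ?orbF//.
by rewrite le_eqVlt orbC.
Qed.

Lemma measurable_inball o r : measurable_fun setT (inball o r).
Proof.
rewrite /inball; case: o.
  by apply: measurable_fun_ler => //; exact: measurable_cst.
by apply: measurable_fun_ltr => //; exact: measurable_cst.
Qed.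

Lemma measurable_before i j : measurable_fun [set: rowT T N] (fun v => before (delta v) i j).
Proof.
apply: measurable_or; first exact: measurable_fun_ltr.
apply: measurable_and; first exact: measurable_fun_eqr.
exact: measurable_cst.
Qed.

Lemma measurable_nrank j : measurable_fun [set: rowT T N] (fun v => nrank (delta v) j).
Proof.
apply: measurable_bigsumn => i.
exact: (measurable_boolfun nat_of_bool (measurable_before i j)).
Qed.

Lemma measurable_ncount r : measurable_fun [set: rowT T N] (fun v => ncount (delta v) r).
Proof.
apply: measurable_bigsumn => i; apply: (measurable_boolfun nat_of_bool).
by apply: measurable_fun_ler => //; exact: measurable_cst.
Qed.

Variables (kk : nat -> nat) (A : R).
Hypotheses (kk0 : forall n, (0 < kk n)%N) (A0 : 0 <= A).

Definition nn_number (v : 'rV[T]_N) := kk (ncount (delta v) A).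
Local Notation k := nn_number.

Lemma measurable_nn_number : measurable_fun [set: rowT T N] k.
Proof. exact: (measurable_natfun kk (measurable_ncount A)). Qed.

Definition nn_mean (v : 'rV[T]_N) : R :=
  (k v)%:R^-1 * \sum_i (nrank (delta v) i < k v)%N%:R * a (v ord0 i).

(** Ranks start at 0, so rank [k v] is that of the (k+1)-st nearest sample. The bound by [A] ensures
    that all samples preceding j are counted in the number that determines [k v]. *)
Definition next_nn (v : 'rV[T]_N) (j : 'I_N) : bool :=
  (nrank (delta v) j == k v) && (delta v j <= A).

Lemma measurable_next_nn j : measurable_fun [set: rowT T N] (next_nn ^~ j).
Proof.
apply: measurable_and.
  by apply: measurable_fun_eqn; [exact: measurable_nrank|exact: measurable_nn_number].
by apply: measurable_fun_ler => //; exact: measurable_cst.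
Qed.

Section pair.
Hypothesis ia : mu.-integrable setT (EFin \o a).
Hypothesis ball_bias : forall o (r : R), 0 <= r ->
  (`|\int[mu]_t ((inball o r t)%:R * a t)%:E|
     <= (CB * r ^+ 2)%:E * mu [set t | inball o r t])%E.
Variables (i i' j : 'I_N) (ii' : i != i').

(* When i and i' precede j and delta v j <= A, the rank of j and the number of
   neighbours are rank' v and k' v, which ignore the coordinates i and i'. *)
Let rank' (v : 'rV[T]_N) := (2 + \sum_(l | (l != i) && (l != i')) before (delta v) l j)%N.
Let k' (v : 'rV[T]_N) :=
  kk (2 + \sum_(l | (l != i) && (l != i')) (delta v l <= A)%R)%N.
Let Theta v : R := ((rank' v == k' v) && (delta v j <= A))%:R * (k' v)%:R ^- 2.

Lemma next_nn_pair v :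
  (next_nn v j)%:R * (k v)%:R ^- 2 *
    (before (delta v) i j)%:R * (before (delta v) i' j)%:R =
  Theta v * (before (delta v) i j)%:R * (before (delta v) i' j)%:R.
Proof.
case bi: (before (delta v) i j); last by rewrite !(mulr0, mul0r).
case bi': (before (delta v) i' j); last by rewrite !(mulr0, mul0r).
rewrite !mulr1 /next_nn /Theta.
case: (leP (delta v j) A) => jA; last by rewrite !andbF !mul0r.
rewrite !andbT.
have split2 (F : 'I_N -> bool) : F i -> F i' ->
    (\sum_l F l = 2 + \sum_(l | (l != i) && (l != i')) F l)%N.
  move=> Fi Fi'; rewrite (bigD1 i)//= (bigD1 i')//=; last by rewrite eq_sym.
  by rewrite Fi Fi' addnA.
rewrite /nrank (split2 (fun l => before (delta v) l j))// -/(rank' v).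
suff -> : k v = k' v by [].
rewrite /k' /nn_number /ncount (split2 (fun l => delta v l <= A))//.
  exact: le_trans (before_le bi) jA.
exact: le_trans (before_le bi') jA.
Qed.

Lemma dist_row_upd v i0 t l : delta (upd v i0 t) l = if l == i0 then rho t else delta v l.
Proof. by rewrite /delta updE; case: eqP. Qed.

Let beforeE_upd v i0 t l : l != i0 -> j != i0 ->
  before (delta (upd v i0 t)) l j = before (delta v) l j.
Proof. by move=> li ji; rewrite /before !dist_row_upd (negbTE li) (negbTE ji). Qed.

Let Theta_upd v i0 t : (i0 == i) || (i0 == i') -> j != i0 -> Theta (upd v i0 t) = Theta v.
Proof.
move=> i0i ji; have li0 l : (l != i) && (l != i') -> l != i0.
  by move=> /andP[li li']; case/orP: i0i => /eqP ->.
rewrite /Theta dist_row_upd (negbTE ji).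
have -> : rank' (upd v i0 t) = rank' v.
  by rewrite /rank'; congr addn; apply: eq_bigr => l /li0 ll; rewrite beforeE_upd.
have -> // : k' (upd v i0 t) = k' v.
rewrite /k'; congr (kk (_ + _)); apply: eq_bigr => l /li0 ll.
by rewrite dist_row_upd (negbTE ll).
Qed.

Let Theta0 v : 0 <= Theta v.
Proof. by rewrite mulr_ge0// invr_ge0 exprn_ge0. Qed.

(** Coordinates i and i' are redrawn in turn. [Theta] and [delta v j] are constant along both, so
    the radius is frozen and each factor becomes an integral over one sample. *)
Lemma integral_pair (g g' : R -> T -> R) : j != i -> j != i' ->
  (forall r, mu.-integrable setT (EFin \o g r)) ->
  (forall r, mu.-integrable setT (EFin \o g' r)) ->
  let h v := (Theta v * g (delta v j) (v ord0 i) * g' (delta v j) (v ord0 i'))%:E in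
  let G v := (Theta v * fine (\int[mu]_t (g (delta v j) t)%:E) *
     fine (\int[mu]_t (g' (delta v j) t)%:E))%:E in
  Q.-integrable setT h ->
  Q.-integrable setT G /\ (\int[Q]_v h v = \int[Q]_v G v)%E.
Proof.
move=> ji ji' ig ig' h G ih.
have ih1 := integrable_resample1 Qbox i ih.
have ih2 := integrable_resample1 Qbox i' ih1.
have e v : (\int[mu]_t \int[mu]_t0 h (upd (upd v i' t) i t0) = G v)%E.
  transitivity (\int[mu]_t ((Theta v * fine (\int[mu]_t (g (delta v j) t)%:E))%:E * (g' (delta v j) t)%:E))%E.
    apply: eq_integral => t _.
    transitivity (\int[mu]_t0 ((Theta v * g' (delta v j) t)%:E * (g (delta v j) t0)%:E))%E.
      apply: eq_integral => t0 _; rewrite /h -EFinM; congr EFin.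
      rewrite !Theta_upd ?eqxx ?orbT//.
      rewrite !dist_row_upd (negbTE ji) (negbTE ji') !updE eqxx.
      rewrite [i' == i]eq_sym (negbTE ii') eqxx.
      by rewrite mulrAC.
    rewrite integralZl//; last exact: ig.
    rewrite -[X in (_ * X)%E]fineK; last exact: integrable_fin_num (ig _).
    by rewrite -!EFinM; congr EFin; rewrite mulrAC.
  rewrite integralZl//; last exact: ig'.
  rewrite -[X in (_ * X)%E]fineK; last exact: integrable_fin_num (ig' _).
  by rewrite -!EFinM.
split.
  by apply: eq_integrable ih2 => // v _; exact: e.
rewrite (integral_resample Qbox i ih) (integral_resample Qbox i' ih1).
by apply: eq_integral => v _; exact: e.
Qed.

Let mpair : measurable_fun [set: rowT T N] (fun v => (next_nn v j)%:R * (k v)%:R ^- 2 *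
    (before (delta v) i j)%:R * (before (delta v) i' j)%:R : R).
Proof.
apply: measurable_funM; last exact: (measurable_boolfun (fun c : bool => c%:R : R) (measurable_before i' j)).
apply: measurable_funM; last exact: (measurable_boolfun (fun c : bool => c%:R : R) (measurable_before i j)).
apply: measurable_funM.
  exact: (measurable_boolfun (fun c : bool => c%:R : R) (measurable_next_nn j)).
exact: (measurable_natfun (fun n : nat => n%:R ^- 2 : R) measurable_nn_number).
Qed.

Let pair_le1 v : (next_nn v j)%:R * (k v)%:R ^- 2 *
    (before (delta v) i j)%:R * (before (delta v) i' j)%:R <=
    ((delta v i <= A) && (delta v i' <= A) && (delta v j <= A))%:R :> R.
Proof.
case bi: (before (delta v) i j); last by rewrite !(mulr0, mul0r) ler0n.
case bi': (before (delta v) i' j); last by rewrite !(mulr0, mul0r) ler0n.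
rewrite !mulr1 /next_nn.
case: (leP (delta v j) A) => jA; last by rewrite !andbF !mul0r ler0n.
rewrite (le_trans (before_le bi) jA) (le_trans (before_le bi') jA)/=.
rewrite mulr_ile1// ?invr_ge0 ?exprn_ge0//; first by case: (_ && _).
by rewrite invf_le1 ?exprn_gt0 ?ltr0n ?kk0// exprn_ege1// ler1n kk0.
Qed.

Lemma integrable_a2_row l :
  Q.-integrable setT (fun v => ((delta v l <= A)%R%:R * a (v ord0 l) ^+ 2)%:E).
Proof.
have mw : measurable_fun [set: rowT T N] (fun v => (delta v l <= A)%R%:R : R).
  apply: (measurable_boolfun (fun c : bool => c%:R : R)).
  by apply: measurable_fun_ler => //; exact: measurable_cst.
apply/integrableP; split.
  apply/measurable_EFinP; apply: measurable_funM => //.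
  by apply: measurable_funX; exact: measurable_a_row.
rewrite (eq_integral (fun v => ((delta v l <= A)%R%:R * a (v ord0 l) ^+ 2)%:E)); last first.
  by move=> v _; rewrite gee0_abs// lee_fin mulr_ge0// sqr_ge0.
apply: le_lt_trans (cond_var_row (i := l) mw _ _) _ => //.
  by move=> v t t' /pi_rho tt'; rewrite !dist_row_upd eqxx tt'.
apply: (@le_lt_trans _ _ (C1 + C2 * A ^+ 2)%:E); last by rewrite ltry.
rewrite -[leRHS](prob_integral_cst Q); apply: le_integral_ge0 => v; rewrite lee_fin.
  by rewrite mulr_ge0// addr_ge0// mulr_ge0// sqr_ge0.
case: (leP (delta v l) A) => lA; rewrite ?mul1r ?mul0r.
  by rewrite lerD2l ler_wpM2l// ler_pXn2r// nnegrE rho0.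
by rewrite addr_ge0// mulr_ge0// sqr_ge0.
Qed.

(** Off-diagonal terms: after factoring, [ball_bias] bounds each single-sample integral by CB r^2
    times the mass of the ball with r = delta v j. That bound is the integral of an indicator times
    a constant, so the same factoring, read backwards, gives the right-hand side. *)
Lemma next_nn_pair_le :
  Q.-integrable setT (fun v => ((next_nn v j)%:R * (k v)%:R ^- 2 *
    (before (delta v) i j)%:R * (before (delta v) i' j)%:R *
      (a (v ord0 i) * a (v ord0 i')))%:E) /\
  (\int[Q]_v ((next_nn v j)%:R * (k v)%:R ^- 2 *
    (before (delta v) i j)%:R * (before (delta v) i' j)%:R *
      (a (v ord0 i) * a (v ord0 i')))%:E <=
   \int[Q]_v ((next_nn v j)%:R * (k v)%:R ^- 2 *
    (before (delta v) i j)%:R * (before (delta v) i' j)%:R *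
      (CB ^+ 2 * delta v j ^+ 4))%:E)%E.
Proof.
set h := (X in Q.-integrable setT X).
set ht := (X in (_ <= \int[Q]_v X v)%E).
(* Integrability from |a a'| <= a^2 + a'^2, both samples being confined to the ball of radius A. *)
have ih : Q.-integrable setT h.
  have := integrableD measurableT (integrable_a2_row i) (integrable_a2_row i').
  apply: le_integrable => //.
    apply/measurable_EFinP; apply: measurable_funM => //.
    by apply: measurable_funM; exact: measurable_a_row.
  move=> v _; rewrite /h -EFinD !abse_EFin lee_fin normrM ger0_norm//.
  apply: (le_trans (ler_wpM2r (normr_ge0 _) (pair_le1 v))).
  rewrite [leRHS]ger0_norm; last by rewrite addr_ge0// mulr_ge0// sqr_ge0.
  case: (leP (delta v i) A) => iA; last by rewrite !mul0r add0r mulr_ge0// sqr_ge0.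
  case: (leP (delta v i') A) => iA'; last by rewrite !mul0r addr0 mulr_ge0// sqr_ge0.
  rewrite !mul1r; case: (leP (delta v j) A) => _; last first.
    by rewrite mul0r addr_ge0// sqr_ge0.
  rewrite mul1r normrM -(real_normK (num_real (a (v ord0 i)))).
  rewrite -(real_normK (num_real (a (v ord0 i')))).
  by have := normr_ge0 (a (v ord0 i)); have := normr_ge0 (a (v ord0 i')); nra.
split=> //.
have iht : Q.-integrable setT ht.
  have := finite_measure_integrable_cst Q (CB ^+ 2 * A ^+ 4) measurableT.
  apply: le_integrable => //.
    apply/measurable_EFinP; apply: measurable_funM => //.
    by apply: measurable_funM; [exact: measurable_cst|exact: measurable_funX].
  move=> v _; rewrite /ht !abse_EFin lee_fin /=.
  rewrite [leLHS]ger0_norm; last by rewrite mulr_ge0// mulr_ge0 ?sqr_ge0 ?exprn_ge0 ?rho0.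
  rewrite [leRHS]ger0_norm; last by rewrite mulr_ge0 ?sqr_ge0 ?exprn_ge0.
  apply: (le_trans (ler_wpM2r _ (pair_le1 v))).
    by rewrite mulr_ge0 ?sqr_ge0 ?exprn_ge0 ?rho0.
  case: (leP (delta v j) A) => jA; last first.
    by rewrite andbF mul0r mulr_ge0 ?sqr_ge0 ?exprn_ge0 ?rho0.
  rewrite andbT; case: (_ && _); rewrite ?mul0r ?mul1r.
    by rewrite ler_wpM2l ?sqr_ge0// ler_pXn2r// nnegrE rho0.
  by rewrite mulr_ge0 ?sqr_ge0 ?exprn_ge0 ?rho0.
change (\int[Q]_v h v <= \int[Q]_v ht v)%E.
(* No sample precedes itself, so both integrands vanish when j is i or i'. *)
have [ji|ji] := eqVneq j i.
  rewrite (_ : h = ht)//; apply/funext => v; rewrite /h /ht -ji before_irr.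
  by rewrite !(mulr0, mul0r).
have [ji'|ji'] := eqVneq j i'.
  rewrite (_ : h = ht)//; apply/funext => v; rewrite /h /ht -ji' before_irr.
  by rewrite !(mulr0, mul0r).
pose g o r t := (inball o r t)%:R * a t.
pose gt o r t := (inball o r t)%:R * (CB * r ^+ 2).
have mb o r : measurable_fun setT (fun t => (inball o r t)%:R : R).
  exact: (measurable_boolfun (fun c : bool => c%:R : R) (measurable_inball o r)).
have ig o r : mu.-integrable setT (EFin \o g o r).
  apply: le_integrable ia => //.
    by apply/measurable_EFinP; exact: measurable_funM.
  move=> t _; rewrite /= lee_fin normrM ler_piMl//.
  by case: (inball _ _ _); rewrite ?normr1 ?normr0.
have igt o r : mu.-integrable setT (EFin \o gt o r).
  have := finite_measure_integrable_cst mu (CB * r ^+ 2) measurableT.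
  apply: le_integrable => //.
    by apply/measurable_EFinP; apply: measurable_funM => //; exact: measurable_cst.
  move=> t _; rewrite /= lee_fin normrM ler_piMl//.
  by case: (inball _ _ _); rewrite ?normr1 ?normr0.
have le_g o r : 0 <= r -> `|fine (\int[mu]_t (g o r t)%:E)| <= fine (\int[mu]_t (gt o r t)%:E).
  move=> r0; have := ball_bias o r0; rewrite -lee_fin.
  rewrite (_ : (\int[mu]_t (gt o r t)%:E = (CB * r ^+ 2)%:E * mu [set t | inball o r t])%E); last first.
    rewrite -integral_bool; last exact: measurable_inball.
    rewrite -ge0_integralZl//; last 2 first.
    - exact/measurable_EFinP.
    - by rewrite lee_fin mulr_ge0 ?sqr_ge0.
    by apply: eq_integral => t _; rewrite -EFinM mulrC.
  rewrite fineK//; last by rewrite fin_numM// fin_num_measure//; apply: measurable_set_bool; exact: measurable_inball.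
  by rewrite -{1}(fineK (integrable_fin_num measurableT (ig o r))) abse_EFin.
have hE : h = fun v => (Theta v * g (i < j)%N (delta v j) (v ord0 i) * g (i' < j)%N (delta v j) (v ord0 i'))%:E.
  apply/funext => v; rewrite /h next_nn_pair !before_inball /g; congr EFin; ring.
have htE : ht = fun v => (Theta v * gt (i < j)%N (delta v j) (v ord0 i) * gt (i' < j)%N (delta v j) (v ord0 i'))%:E.
  apply/funext => v; rewrite /ht next_nn_pair !before_inball /gt; congr EFin; ring.
rewrite hE in ih *; rewrite htE in iht *.
have [iG ->] := integral_pair ji ji' (ig _) (ig _) ih.
have [iGt ->] := integral_pair ji ji' (igt _) (igt _) iht.
apply: le_integral => // v _; rewrite lee_fin -[leLHS]mulrA -[leRHS]mulrA ler_wpM2l//.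
have d0 : 0 <= delta v j by exact: rho0.
apply: le_trans (ler_norm _) _; rewrite normrM.
by apply: ler_pM => //; exact: le_g.
Qed.

End pair.

Lemma dist_row_pi v i t t' : pi t = pi t' -> delta (upd v i t) = delta (upd v i t').
Proof. by move=> tt'; apply/funext => l; rewrite !dist_row_upd (pi_rho tt'). Qed.

Let C := C1 + C2 * A ^+ 2.
Let C0 : 0 <= C. Proof. by rewrite addr_ge0// mulr_ge0// sqr_ge0. Qed.

Lemma measurable_nn_mean : measurable_fun [set: rowT T N] nn_mean.
Proof.
apply: measurable_funM.
  exact: (measurable_natfun (fun n : nat => n%:R^-1 : R) measurable_nn_number).
apply: measurable_bigsum => i; apply: measurable_funM; last exact: measurable_a_row.
apply: (measurable_boolfun (fun c : bool => c%:R : R)).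
by apply: measurable_fun_ltn; [exact: measurable_nrank|exact: measurable_nn_number].
Qed.

Lemma next_nn_mean v j : (next_nn v j)%:R * nn_mean v ^+ 2 =
  \sum_i \sum_i' (next_nn v j)%:R * (k v)%:R ^- 2 *
    (before (delta v) i j)%:R * (before (delta v) i' j)%:R *
      (a (v ord0 i) * a (v ord0 i')).
Proof.
have [/andP[/eqP jk jA]|/negbTE nj] := boolP (next_nn v j); last first.
  by rewrite mul0r big1// => i _; rewrite big1// => i' _; rewrite !mul0r.
rewrite mul1r /nn_mean exprMn exprVn [X in _ * X = _]expr2 mulr_suml mulr_sumr.
apply: eq_bigr => i _; rewrite !mulr_sumr; apply: eq_bigr => i' _.
rewrite mul1r -jk -!before_nrank; ring.
Qed.

Section good.
Hypothesis ia : mu.-integrable setT (EFin \o a).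
Hypothesis ball_bias : forall o (r : R), 0 <= r ->
  (`|\int[mu]_t ((inball o r t)%:R * a t)%:E|
     <= (CB * r ^+ 2)%:E * mu [set t | inball o r t])%E.

Let mbefore i j : measurable_fun [set: rowT T N] (fun v => (before (delta v) i j)%:R : R).
Proof. exact: (measurable_boolfun (fun c : bool => c%:R : R) (measurable_before i j)). Qed.

Let mnextk j : measurable_fun [set: rowT T N] (fun v => (next_nn v j)%:R * (k v)%:R ^- 2 : R).
Proof.
apply: measurable_funM.
  exact: (measurable_boolfun (fun c : bool => c%:R : R) (measurable_next_nn j)).
exact: (measurable_natfun (fun n : nat => n%:R ^- 2 : R) measurable_nn_number).
Qed.

Let H i i' j v := (next_nn v j)%:R * (k v)%:R ^- 2 *
    (before (delta v) i j)%:R * (before (delta v) i' j)%:R *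
      (a (v ord0 i) * a (v ord0 i')).
Let HB i i' j v := (next_nn v j)%:R * (k v)%:R ^- 2 *
    (before (delta v) i j)%:R * (before (delta v) i' j)%:R *
      (if i == i' then C else CB ^+ 2 * delta v j ^+ 4).

Let HB0 i i' j v : 0 <= HB i i' j v.
Proof.
rewrite /HB mulr_ge0//.
by case: eqP => // _; rewrite mulr_ge0 ?sqr_ge0// exprn_ge0// rho0.
Qed.

Let mHB i i' j : measurable_fun [set: rowT T N] (HB i i' j).
Proof.
apply: measurable_funM.
  by apply: measurable_funM => //; apply: measurable_funM.
case: eqP => _; first exact: measurable_cst.
by apply: measurable_funM; [exact: measurable_cst|exact: measurable_funX].
Qed.

(** On the diagonal the weight depends on the points alone, so [cond_var_row] replaces a^2 by C1 +
    C2 rho^2, which is at most [C] since i precedes j and j is within A. *)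
Let H_le i i' j : Q.-integrable setT (EFin \o H i i' j) /\
  (\int[Q]_v (H i i' j v)%:E <= \int[Q]_v (HB i i' j v)%:E)%E.
Proof.
have [<-|ii'] := eqVneq i i'; last first.
  rewrite /HB (negbTE ii'); exact: next_nn_pair_le.
have HE v : H i i j v = (next_nn v j)%:R * (k v)%:R ^- 2 *
    (before (delta v) i j)%:R * a (v ord0 i) ^+ 2.
  have bb : (before (delta v) i j)%:R * (before (delta v) i j)%:R = (before (delta v) i j)%:R :> R.
    by rewrite -natrM mulnb andbb.
  rewrite /H -[in RHS]bb; ring.
have le : (\int[Q]_v (H i i j v)%:E <= \int[Q]_v (HB i i j v)%:E)%E.
  under eq_integral do rewrite HE.
  apply: (le_trans (cond_var_row (i := i) _ _ _)).
  - by apply: measurable_funM.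
  - by move=> v; rewrite mulr_ge0.
  - by move=> v t t' tt'; rewrite /next_nn /nn_number (dist_row_pi v i tt').
  apply: le_integral_ge0 => v; rewrite lee_fin.
    by rewrite mulr_ge0// ?mulr_ge0// addr_ge0// mulr_ge0// sqr_ge0.
  rewrite /HB eqxx -[X in _ <= X * _]mulrA -natrM mulnb andbb.
  case nj: (next_nn v j); last by rewrite !mul0r.
  case bi: (before _ _ _); last by rewrite !mulr0 !mul0r.
  rewrite !mulr1 mul1r ler_wpM2l ?invr_ge0 ?exprn_ge0// lerD2l ler_wpM2l//.
  rewrite ler_pXn2r// ?nnegrE ?rho0//.
  by move: nj => /andP[_ jA]; exact: le_trans (before_le bi) jA.
split => //.
have mH : measurable_fun [set: rowT T N] (H i i j).
  apply: measurable_funM; first by apply: measurable_funM => //; apply: measurable_funM.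
  by apply: measurable_funM; exact: measurable_a_row.
apply/integrableP; split; first exact/measurable_EFinP.
rewrite (eq_integral (EFin \o H i i j)); last first.
  by move=> v _; rewrite gee0_abs//= lee_fin HE mulr_ge0 ?sqr_ge0// mulr_ge0.
apply: (le_lt_trans le).
apply: (@le_lt_trans _ _ C%:E); last by rewrite ltry.
rewrite -[leRHS](prob_integral_cst Q); apply: le_integral_ge0 => v; rewrite lee_fin//.
rewrite /HB eqxx -[X in X * _ <= _]mulrA -natrM mulnb andbb.
rewrite ler_piMl// mulr_ile1//; last by case: (before _ _ _).
rewrite mulr_ile1// ?invr_ge0 ?exprn_ge0//; first by case: (next_nn _ _).
by rewrite invf_le1 ?exprn_gt0 ?ltr0n ?kk0// exprn_ege1// ler1n kk0.
Qed.

Lemma next_nn_part j :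
  (\int[Q]_v ((next_nn v j)%:R * nn_mean v ^+ 2)%:E <=
   \int[Q]_v ((next_nn v j)%:R * (C * (k v)%:R^-1 + CB ^+ 2 * delta v j ^+ 4))%:E)%E.
Proof.
rewrite (eq_integral (fun v => \sum_i \sum_i' (H i i' j v)%:E)%E); last first.
  by move=> v _; rewrite next_nn_mean -sumEFin; apply: eq_bigr => i _; rewrite -sumEFin.
have iH i i' := (H_le i i' j).1.
rewrite integral_sum//; last by move=> i; apply: integrable_sum => // i' _; exact: iH.
rewrite (eq_bigr (fun i => \sum_i' \int[Q]_v (H i i' j v)%:E)%E); last first.
  by move=> i _; rewrite integral_sum//; move=> i'; exact: iH.
apply: (@le_trans _ _ (\sum_i \sum_i' \int[Q]_v (HB i i' j v)%:E)%E).
  by apply: lee_sum => i _; apply: lee_sum => i' _; exact: (H_le i i' j).2.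
rewrite (eq_bigr (fun i => \int[Q]_v \sum_i' (HB i i' j v)%:E)%E); last first.
  move=> i _; rewrite ge0_integral_sum//.
    by move=> i'; exact/measurable_EFinP.
  by move=> i' v _; rewrite lee_fin.
rewrite -ge0_integral_sum//; last 2 first.
- by move=> i; apply: emeasurable_sum => i'; exact/measurable_EFinP.
- by move=> i v _; apply: sume_ge0 => i' _; rewrite lee_fin.
apply: le_integral_ge0 => v.
  by apply: sume_ge0 => i _; apply: sume_ge0 => i' _; rewrite lee_fin.
under eq_bigr do rewrite sumEFin.
rewrite sumEFin lee_fin.
case nj: (next_nn v j); last first.
  rewrite mul0r big1// => i _; rewrite big1// => i' _.
  by rewrite /HB nj !mul0r.
rewrite mul1r.
have jk : nrank (delta v) j = k v by move: nj => /andP[/eqP].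
have k0 : 0 < (k v)%:R :> R by rewrite ltr0n kk0.
have sb : \sum_i (before (delta v) i j)%:R = (k v)%:R :> R by rewrite -jk -natr_sum.
(* Exactly k indices precede j: the k diagonal terms C / k^2 add up to C / k, and the off-diagonal
   pairs, fewer than k^2, to at most the bias term. *)
apply: (@le_trans _ _ (\sum_i (k v)%:R ^- 2 * (before (delta v) i j)%:R *
   (C + (k v)%:R * (CB ^+ 2 * delta v j ^+ 4)))).
  apply: ler_sum => i _.
  rewrite (bigD1 i)//= {1}/HB eqxx nj mul1r -[X in X * C]mulrA -natrM mulnb andbb.
  rewrite [leRHS]mulrDr lerD2l -[X in _ <= _ * (X * _)]sb [X in _ <= _ * X]mulr_suml [leRHS]mulr_sumr.
  rewrite [leRHS](bigD1 i)//=.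
  have X0 : 0 <= CB ^+ 2 * delta v j ^+ 4 by rewrite mulr_ge0 ?sqr_ge0// exprn_ge0// rho0.
  apply: ler_wpDl; first by apply: mulr_ge0 => //; apply: mulr_ge0.
  by apply: ler_sum => i' ii'; rewrite /HB nj mul1r [i == i']eq_sym (negbTE ii') mulrA.
rewrite -mulr_suml -mulr_sumr sb.
rewrite le_eqVlt; apply/orP; left; apply/eqP; field.
by rewrite gt_eqF.
Qed.

Lemma good_part :
  (\int[Q]_v (\sum_j (next_nn v j)%:R * nn_mean v ^+ 2)%:E <=
   \int[Q]_v (\sum_j (next_nn v j)%:R * (C * (k v)%:R^-1 + CB ^+ 2 * delta v j ^+ 4))%:E)%E.
Proof.
have mn j : measurable_fun [set: rowT T N] (fun v => (next_nn v j)%:R : R).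
  exact: (measurable_boolfun (fun c : bool => c%:R : R) (measurable_next_nn j)).
under eq_integral do rewrite -sumEFin.
rewrite ge0_integral_sum//; last 2 first.
- move=> j; apply/measurable_EFinP; apply: measurable_funM => //.
  by apply: measurable_funX; exact: measurable_nn_mean.
- by move=> j v _; rewrite lee_fin mulr_ge0// sqr_ge0.
under [leRHS]eq_integral do rewrite -sumEFin.
rewrite [leRHS]ge0_integral_sum//; last 2 first.
- move=> j; apply/measurable_EFinP; apply: measurable_funM => //.
  apply: measurable_funD; apply: measurable_funM; try exact: measurable_cst.
    exact: (measurable_natfun (fun n : nat => n%:R^-1 : R) measurable_nn_number).
  exact: measurable_funX.
- move=> j v _; rewrite lee_fin mulr_ge0// addr_ge0// mulr_ge0 ?sqr_ge0 ?exprn_ge0 ?rho0//.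
by apply: lee_sum => j _; exact: next_nn_part.
Qed.

End good.

(** Cauchy-Schwarz with 0-1 weights: after symmetrizing the double sum it is 2 y y' <= y^2 + y'^2
    termwise. *)
Lemma sum_sqr_le (c : 'I_N -> bool) (y : 'I_N -> R) :
  (\sum_i (c i)%:R * y i) ^+ 2 <= (\sum_i (c i)%:R) * \sum_i (c i)%:R * y i ^+ 2.
Proof.
rewrite expr2 !mulr_suml.
pose F i i' : R := (c i)%:R * (c i')%:R * (y i' ^+ 2).
have e : \sum_i (c i)%:R * (\sum_i' (c i')%:R * y i' ^+ 2) = 2^-1 * (\sum_i \sum_i' (F i i' + F i' i)).
  have -> : \sum_i \sum_i' (F i i' + F i' i) = (\sum_i \sum_i' F i i') *+ 2.
    rewrite mulr2n -[X in _ = _ + X]exchange_big -big_split/=.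
    by apply: eq_bigr => i _; rewrite -big_split.
  rewrite -[X in _ = _ * X]mulr_natl mulrA mulVf ?pnatr_eq0// mul1r.
  by apply: eq_bigr => i _; rewrite mulr_sumr; apply: eq_bigr => i' _; rewrite /F mulrA.
rewrite e mulr_sumr; apply: ler_sum => i _.
rewrite !mulr_sumr; apply: ler_sum => i' _.
have := sqr_ge0 (y i - y i'); rewrite sqrrB /F.
by case: (c i); case: (c i'); rewrite /= ?mulr0n ?mulr1n ?mul0r ?mulr0 ?mul1r ?addr0 ?mulr0//; nra.
Qed.

Section bad.
Variables (n0 : nat) (M : R).
Hypothesis few : forall n, (n <= N)%N -> (n <= kk n)%N -> (n <= n0)%N /\ ((kk n).*2 <= N)%N.
Hypothesis rho2M : (\int[mu]_t (rho t ^+ 2)%:E <= M%:E)%E.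
Let b t := rho t <= A.
Let p := fine (mu [set t | b t]).

Let isbad v := (ncount (delta v) A <= k v)%N.
Let near_ v i : bool := (nrank (delta v) i < k v)%N.

Let mbad : measurable_fun [set: rowT T N] isbad.
Proof. by apply: measurable_fun_leq; [exact: measurable_ncount|exact: measurable_nn_number]. Qed.
Let mnear i : measurable_fun [set: rowT T N] (near_ ^~ i).
Proof. by apply: measurable_fun_ltn; [exact: measurable_nrank|exact: measurable_nn_number]. Qed.

Let w i v : R := (isbad v)%:R * (k v)%:R^-1 * (near_ v i)%:R.

Let w0 i v : 0 <= w i v. Proof. by rewrite /w mulr_ge0// mulr_ge0// invr_ge0. Qed.
Let mw i : measurable_fun [set: rowT T N] (w i).
Proof.
apply: measurable_funM; last exact: (measurable_boolfun (fun c : bool => c%:R : R) (mnear i)).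
apply: measurable_funM.
  exact: (measurable_boolfun (fun c : bool => c%:R : R) mbad).
exact: (measurable_natfun (fun n : nat => n%:R^-1 : R) measurable_nn_number).
Qed.

Let isbad_n0 v : isbad v -> (ncount (delta v) A <= n0)%N /\ ((k v).*2 <= N)%N.
Proof. exact: few (ncount_le _ _). Qed.

Let sum_near v : isbad v -> \sum_i (near_ v i)%:R = (k v)%:R :> R.
Proof.
move=> /isbad_n0[_ kN]; rewrite -natr_sum sum_nrank_lt//.
by rewrite (leq_trans _ kN)// -addnn leq_addr.
Qed.

Let bad_mean_le v : (isbad v)%:R * nn_mean v ^+ 2 <= \sum_i w i v * a (v ord0 i) ^+ 2.
Proof.
case bv: (isbad v); last by rewrite mul0r sumr_ge0// => i _; rewrite mulr_ge0// sqr_ge0.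
have k0 : (k v)%:R != 0 :> R by rewrite pnatr_eq0 -lt0n kk0.
rewrite mul1r /nn_mean exprMn.
apply: (@le_trans _ _ ((k v)%:R^-1 ^+ 2 * ((k v)%:R * \sum_i (near_ v i)%:R * a (v ord0 i) ^+ 2))).
  by rewrite ler_wpM2l ?sqr_ge0// -(sum_near bv); exact: sum_sqr_le.
rewrite mulrA [X in X * _ <= _](_ : _ = (k v)%:R^-1) ?mulr_sumr; last by field.
by apply: ler_sum => i _; rewrite /w bv mul1r mulrA.
Qed.

(* At least half of the samples are not among the k nearest, hence are at least
   as far as any of these. *)
Let near_far v i : isbad v -> near_ v i ->
  delta v i ^+ 2 <= 2 / N%:R * \sum_l delta v l ^+ 2.
Proof.
move=> bv ni; have [_ kN] := isbad_n0 bv.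
have kN' : (k v <= N)%N by rewrite (leq_trans _ kN)// -addnn leq_addr.
have N0 : 0 < N%:R :> R.
  by rewrite ltr0n (leq_trans _ kN')// kk0.
have : (N - k v)%:R * delta v i ^+ 2 <= \sum_l delta v l ^+ 2.
  have -> : (N - k v)%N = (\sum_l (k v <= nrank (delta v) l))%N.
    apply/eqP; rewrite -(eqn_add2r (k v)) subnK// -[X in _ == (_ + X)%N](sum_nrank_lt (delta v) kN').
    rewrite -big_split/= (eq_bigr (fun=> 1%N)) ?sum_nat_const ?card_ord ?muln1//.
    by move=> l _; rewrite ltnNge; case: (_ <= _)%N.
  rewrite natr_sum mulr_suml; apply: ler_sum => l _.
  case: leqP => kl; last by rewrite mul0r sqr_ge0.
  rewrite mul1r ler_pXn2r// ?nnegrE ?rho0//.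
  by apply: before_le; rewrite before_nrank (leq_trans ni kl).
have : N%:R <= 2 * (N - k v)%:R :> R.
  by rewrite -natrM ler_nat mul2n -addnn; move: kN kN'; rewrite -addnn; lia.
have := sqr_ge0 (delta v i).
set D2 := delta v i ^+ 2; set S2 := \sum_l _; set q := (N - k v)%:R => D0 Nq qS.
by rewrite mulrAC ler_pdivlMr//; nra.
Qed.

Lemma far_moment l :
  (\int[Q]_v ((ncount (delta v) A <= n0)%N%:R * delta v l ^+ 2)%:E <=
    M%:E * Q [set v | (cnt b v <= n0.+1)%N])%E.
Proof.
(* Leaving out the sample l makes the count independent of its distance. *)
pose cl v := (\sum_(i | i != l) (delta v i <= A)%R)%N.
have mcl : measurable_fun [set: rowT T N] (fun v => (cl v <= n0)%N).
  apply: measurable_fun_leq => //.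
  rewrite /cl; under eq_fun do rewrite big_mkcond/=.
  apply: measurable_bigsumn => i; case: (i != l) => //.
  apply: (measurable_boolfun nat_of_bool).
  by apply: measurable_fun_ler => //; exact: measurable_cst.
have mcl' : measurable_fun [set: rowT T N] (fun v => (cl v <= n0)%N%:R : R).
  exact: (measurable_boolfun (fun c : bool => c%:R : R) mcl).
apply: (@le_trans _ _ (\int[Q]_v ((cl v <= n0)%N%:R * delta v l ^+ 2)%:E)%E).
  apply: le_integral_ge0 => v; rewrite lee_fin; first by rewrite mulr_ge0// sqr_ge0.
  rewrite ler_wpM2r ?sqr_ge0// ler_nat.
  case: (leqP (ncount (delta v) A) n0) => //= h.
  rewrite (_ : (cl v <= n0)%N = true)//.
  by rewrite (leq_trans _ h)// /ncount (bigD1 l)//= leq_addl.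
rewrite (ge0_resample Qbox l); last 2 first.
- by apply/measurable_EFinP; apply: measurable_funM => //; exact: measurable_funX.
- by move=> v; rewrite lee_fin mulr_ge0// sqr_ge0.
apply: (@le_trans _ _ (\int[Q]_v (M%:E * (cl v <= n0)%N%:R%:E))%E).
  apply: le_integral_ge0 => v.
    by apply: integral_ge0 => t _; rewrite lee_fin mulr_ge0// sqr_ge0.
  have -> : (\int[mu]_t ((cl (upd v l t) <= n0)%N%:R * delta (upd v l t) l ^+ 2)%:E =
     \int[mu]_t ((cl v <= n0)%N%:R%:E * (rho t ^+ 2)%:E))%E.
    apply: eq_integral => t _; rewrite -EFinM dist_row_upd eqxx; congr (_%:R * _)%:E.
    congr (nat_of_bool (_ <= _)%N); apply: eq_bigr => i il.
    by rewrite dist_row_upd (negbTE il).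
  rewrite ge0_integralZl//; last 2 first.
  - by apply/measurable_EFinP; exact: measurable_funX.
  - by move=> t _; rewrite lee_fin sqr_ge0.
  by rewrite muleC lee_wpmul2r.
have M0 : 0 <= M.
  rewrite -lee_fin; apply: le_trans rho2M; apply: integral_ge0 => t _.
  by rewrite lee_fin sqr_ge0.
rewrite ge0_integralZl//; last exact/measurable_EFinP.
rewrite lee_wpmul2l// integral_bool// le_measure ?inE//.
- exact: measurable_set_bool.
- apply: measurable_set_bool; apply: measurable_fun_leq => //.
  by apply: measurable_cnt; apply: measurable_fun_ler => //; exact: measurable_cst.
(* Putting the sample l back adds at most one to the count, whence [n0.+1]. *)
- move=> v /= h; rewrite /cnt (bigD1 l)//=.
  by apply: (@leq_add _ _ 1) => //; case: (b _).
Qed.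

(** Here neighbours may be farther than A, so rho is not bounded by A. Cauchy-Schwarz bounds the
    squared mean by the mean of a^2, hence by that of C1 + C2 rho^2; [near_far] replaces each rho^2
    by 2 / N times the sum over all samples, and [far_moment] bounds each of these N terms by M
    times an exponentially small probability. *)
Lemma bad_part :
  (\int[Q]_v ((isbad v)%:R * nn_mean v ^+ 2)%:E <=
   ((C1 + 2 * C2 * M) * (n0.+2%:R * expR (- (p * (N %/ n0.+2)%:R))))%:E)%E.
Proof.
have mb : measurable_fun setT b.
  by apply: measurable_fun_ler => //; exact: measurable_cst.
have M0 : 0 <= M.
  rewrite -lee_fin; apply: le_trans rho2M; apply: integral_ge0 => t _.
  by rewrite lee_fin sqr_ge0.
apply: (@le_trans _ _ (\int[Q]_v (\sum_i (w i v * a (v ord0 i) ^+ 2)%:E))%E).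
  apply: le_integral_ge0 => v; first by rewrite lee_fin mulr_ge0// sqr_ge0.
  by rewrite sumEFin lee_fin.
rewrite ge0_integral_sum//; last 2 first.
- move=> i; apply/measurable_EFinP; apply: measurable_funM => //.
  by apply: measurable_funX; exact: measurable_a_row.
- by move=> i v _; rewrite lee_fin mulr_ge0// sqr_ge0.
apply: (@le_trans _ _ (\sum_i \int[Q]_v (w i v * (C1 + C2 * delta v i ^+ 2))%:E)%E).
  apply: lee_sum => i _; apply: cond_var_row => // v t t' tt'.
  by rewrite /w /isbad /near_ /nn_number (dist_row_pi v i tt').
rewrite -ge0_integral_sum//; last 2 first.
- move=> i; apply/measurable_EFinP; apply: measurable_funM => //.
  apply: measurable_funD; first exact: measurable_cst.
  by apply: measurable_funM; [exact: measurable_cst|exact: measurable_funX].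
- by move=> i v _; rewrite lee_fin mulr_ge0// addr_ge0// mulr_ge0// sqr_ge0.
pose e v : R := (ncount (delta v) A <= n0)%N%:R.
have me0 : measurable_fun [set: rowT T N] (fun v => (ncount (delta v) A <= n0)%N).
  by apply: measurable_fun_leq => //; exact: measurable_ncount.
have me : measurable_fun [set: rowT T N] e.
  exact: (measurable_boolfun (fun c : bool => c%:R : R) me0).
apply: (@le_trans _ _ (\int[Q]_v (C1%:E * (e v)%:E + (C2 * (2 / N%:R))%:E * \sum_l (e v * delta v l ^+ 2)%:E))%E).
  apply: le_integral_ge0 => v.
    by apply: sume_ge0 => i _; rewrite lee_fin mulr_ge0// addr_ge0// mulr_ge0// sqr_ge0.
  rewrite !sumEFin -!EFinM -EFinD lee_fin -mulr_sumr.
  case bv: (isbad v); last first.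
    rewrite big1; first by rewrite addr_ge0 ?mulr_ge0 ?ler0n ?sumr_ge0// => l _; rewrite sqr_ge0.
    by move=> i _; rewrite /w bv !mul0r.
  have [-> kN] : e v = 1 /\ ((k v).*2 <= N)%N by have [h h'] := isbad_n0 bv; rewrite /e h.
  rewrite mulr1 mul1r.
  have k0 : (k v)%:R != 0 :> R by rewrite pnatr_eq0 -lt0n kk0.
  (* The weights are those of an average, so a bound common to all near samples passes to the
     sum. *)
  have sw : \sum_i w i v = 1.
    by rewrite /w bv -mulr_sumr sum_near// mul1r mulVf.
  rewrite -[leRHS]mul1r -[X in X * _]sw mulr_suml; apply: ler_sum => i _.
  rewrite /w; case ni: (near_ v i); last by rewrite mulr0 !mul0r.
  rewrite ler_wpM2l//.
  by rewrite lerD2l -mulrA ler_wpM2l// near_far.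
rewrite ge0_integralD//; last 4 first.
- by move=> v _; rewrite -EFinM lee_fin mulr_ge0.
- by apply: measurable_funeM; exact/measurable_EFinP.
- move=> v _; rewrite sumEFin -EFinM lee_fin !mulr_ge0// sumr_ge0// => l _.
  by rewrite mulr_ge0// sqr_ge0.
- apply: measurable_funeM; apply: emeasurable_sum => l; apply/measurable_EFinP.
  by apply: measurable_funM => //; exact: measurable_funX.
rewrite ge0_integralZl//; last 2 first.
- by apply/measurable_EFinP.
- by move=> v _; rewrite lee_fin.
rewrite ge0_integralZl//; last 3 first.
- apply: emeasurable_sum => l; apply/measurable_EFinP.
  by apply: measurable_funM => //; exact: measurable_funX.
- by move=> v _; apply: sume_ge0 => l _; rewrite lee_fin mulr_ge0// sqr_ge0.
- by rewrite lee_fin !mulr_ge0.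
rewrite ge0_integral_sum//; last 2 first.
- move=> l; apply/measurable_EFinP.
  by apply: measurable_funM => //; exact: measurable_funX.
- by move=> l v _; rewrite lee_fin mulr_ge0// sqr_ge0.
rewrite integral_bool//.
have Qe := cnt_le_exp Qbox mb n0.+1.
set E := (_ * expR _) in Qe.
rewrite [X in (_ <= X%:E)%E]mulrDl EFinD; apply: leeD.
  rewrite EFinM lee_wpmul2l//; apply: le_trans Qe.
  apply: le_measure; rewrite ?inE.
  - exact: measurable_set_bool.
  - by apply: measurable_set_bool; apply: measurable_fun_leq => //; exact: measurable_cnt.
  - by move=> v /= h; exact: leqW.
apply: (@le_trans _ _ ((C2 * (2 / N%:R))%:E * \sum_(l < N) (M * E)%:E)%E).
  rewrite lee_wpmul2l ?lee_fin ?mulr_ge0//; apply: lee_sum => l _.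
  apply: (le_trans (far_moment l)).
  by rewrite EFinM lee_wpmul2l.
rewrite sumEFin sumr_const card_ord -EFinM lee_fin -(mulr_natl (M * E) N).
have [N0|N0] := posnP N.
  have -> : N%:R = 0 :> R by rewrite N0.
  by rewrite mul0r mulr0 !mulr_ge0.
rewrite (_ : _ * (N%:R * _) = 2 * C2 * M * E)//.
by field; rewrite pnatr_eq0 -lt0n.
Qed.

End bad.

(** The radius r is free. In the good case the (k+1)-st distance is at most r, or lies between r and
    A; the latter forces at most k samples within r and costs A^4 times the probability of that
    event. *)
Lemma nn_mean_bound (n0 : nat) (M r : R) :
  mu.-integrable setT (EFin \o a) ->
  (forall o (r : R), 0 <= r ->
  (`|\int[mu]_t ((inball o r t)%:R * a t)%:E|
     <= (CB * r ^+ 2)%:E * mu [set t | inball o r t])%E) ->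
  (forall n, (n <= N)%N -> (n <= kk n)%N -> (n <= n0)%N /\ ((kk n).*2 <= N)%N) ->
  (\int[mu]_t (rho t ^+ 2)%:E <= M%:E)%E ->
  0 <= r ->
  (\int[Q]_v (nn_mean v ^+ 2)%:E <=
    ((C1 + C2 * A ^+ 2)%:E * \int[Q]_v (k v)%:R^-1%:E) +
    ((CB ^+ 2)%:E * ((r ^+ 4)%:E + (A ^+ 4)%:E * Q [set v | (ncount (delta v) r <= k v)%N]) +
    ((C1 + 2 * C2 * M) * (n0.+2%:R * expR (- (fine (mu [set t | rho t <= A]) * (N %/ n0.+2)%:R))))%:E))%E.
Proof.
move=> ia bias few rho2M r0.
have mn j : measurable_fun [set: rowT T N] (fun v => (next_nn v j)%:R : R).
  exact: (measurable_boolfun (fun c : bool => c%:R : R) (measurable_next_nn j)).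
have mk : measurable_fun [set: rowT T N] (fun v => (k v)%:R^-1 : R).
  exact: (measurable_natfun (fun n : nat => n%:R^-1 : R) measurable_nn_number).
have mr : measurable_fun [set: rowT T N] (fun v => (ncount (delta v) r <= k v)%N).
  by apply: measurable_fun_leq; [exact: measurable_ncount|exact: measurable_nn_number].
have mrR : measurable_fun [set: rowT T N] (fun v => (ncount (delta v) r <= k v)%N%:R : R).
  exact: (measurable_boolfun (fun c : bool => c%:R : R) mr).
pose bad v := (ncount (delta v) A <= k v)%N.
have mbad : measurable_fun [set: rowT T N] (fun v => (bad v)%:R : R).
  apply: (measurable_boolfun (fun c : bool => c%:R : R)).
  by apply: measurable_fun_leq; [exact: measurable_ncount|exact: measurable_nn_number].
have mm2 := measurable_funX 2 measurable_nn_mean.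
apply: (@le_trans _ _ (\int[Q]_v ((\sum_j (next_nn v j)%:R * nn_mean v ^+ 2)%:E +
    ((bad v)%:R * nn_mean v ^+ 2)%:E))%E).
  apply: le_integral_ge0 => v; first by rewrite lee_fin sqr_ge0.
  rewrite -EFinD lee_fin -mulr_suml -mulrDl ler_peMl ?sqr_ge0//.
  (* If n > k, a sample of rank k exists, and it lies within A, since otherwise [ncount_nrank] would
     give n <= k. So the good and bad cases cover everything. *)
  rewrite /bad; case: leqP => [_|kn]; first by rewrite lerDr sumr_ge0.
  have kN : (k v < N)%N by rewrite (leq_trans kn)// ncount_le.
  have [j jk] := nrank_surj (delta v) kN.
  rewrite addr0 (bigD1 j)//= (_ : next_nn v j = true).
    by rewrite lerDl sumr_ge0.
  rewrite /next_nn jk eqxx/= leNgt; apply/negP => /ncount_nrank.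
  by rewrite jk leqNgt kn.
rewrite ge0_integralD//; last 4 first.
- by move=> v _; rewrite lee_fin sumr_ge0// => j _; rewrite mulr_ge0// sqr_ge0.
- by apply/measurable_EFinP; apply: measurable_bigsum => j; exact: measurable_funM.
- by move=> v _; rewrite lee_fin mulr_ge0// sqr_ge0.
- by apply/measurable_EFinP; exact: measurable_funM.
rewrite [leRHS]addeA; apply: leeD; last exact: (bad_part few rho2M).
apply: (le_trans (good_part ia bias)).
have inv0 v : 0 <= C * (k v)%:R^-1 by rewrite mulr_ge0// invr_ge0.
apply: (@le_trans _ _ (\int[Q]_v (C%:E * (k v)%:R^-1%:E + (CB ^+ 2)%:E * ((r ^+ 4)%:E + (A ^+ 4)%:E * (ncount (delta v) r <= k v)%N%:R%:E)))%E).
  apply: le_integral_ge0 => v.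
    rewrite lee_fin sumr_ge0// => j _; rewrite mulr_ge0// addr_ge0//.
    by rewrite mulr_ge0 ?sqr_ge0// exprn_ge0// rho0.
  rewrite -!(EFinM, EFinD) lee_fin.
  have B0 : 0 <= C / (k v)%:R + CB ^+ 2 * (r ^+ 4 + A ^+ 4 * (ncount (delta v) r <= k v)%N%:R).
    by rewrite addr_ge0// mulr_ge0 ?sqr_ge0// addr_ge0 ?exprn_ge0// mulr_ge0 ?exprn_ge0.
  (* Ranks are distinct, so the sum over j has at most one nonzero term. *)
  have [[j nj]|nn] := pselect (exists j, next_nn v j); last first.
    rewrite big1// => j _; case nj: (next_nn v j); last by rewrite mul0r.
    by exfalso; apply: nn; exists j.
  rewrite (bigD1 j)//= big1 ?addr0 => [|l lj]; last first.
    case nl: (next_nn v l); last by rewrite mul0r.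
    have /andP[/eqP lk _] := nl; have /andP[/eqP jk _] := nj.
    by move: lj; rewrite (nrank_inj (etrans lk (esym jk))) eqxx.
  rewrite nj mul1r lerD2l ler_wpM2l ?sqr_ge0//.
  have /andP[/eqP jk jA] := nj.
  have [rj|jr] := ltP r (delta v j).
    rewrite -jk ncount_nrank// mulr1 ler_wpDl ?exprn_ge0//.
    by rewrite ler_pXn2r// nnegrE rho0.
  rewrite ler_wpDr ?mulr_ge0 ?exprn_ge0//.
  by rewrite ler_pXn2r// nnegrE rho0.
rewrite ge0_integralD//; last 4 first.
- by move=> v _; rewrite -EFinM lee_fin.
- by apply: measurable_funeM; exact/measurable_EFinP.
- by move=> v _; rewrite -!(EFinM, EFinD) lee_fin mulr_ge0 ?sqr_ge0// addr_ge0 ?mulr_ge0 ?exprn_ge0.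
- apply: measurable_funeM; apply: emeasurable_funD; first exact: measurable_cst.
  by apply: measurable_funeM; exact/measurable_EFinP.
rewrite ge0_integralZl//; last by apply/measurable_EFinP.
rewrite ge0_integralZl//; last 3 first.
- apply: emeasurable_funD; first exact: measurable_cst.
  by apply: measurable_funeM; exact/measurable_EFinP.
- by move=> v _; rewrite -!(EFinM, EFinD) lee_fin addr_ge0 ?mulr_ge0 ?exprn_ge0.
- by rewrite lee_fin sqr_ge0.
rewrite ge0_integralD//; last 3 first.
- by move=> v _; rewrite lee_fin exprn_ge0.
- by move=> v _; rewrite -EFinM lee_fin mulr_ge0 ?exprn_ge0.
- by apply: measurable_funeM; exact/measurable_EFinP.
rewrite prob_integral_cst ge0_integralZl//; last 2 first.
- exact/measurable_EFinP.
- by rewrite lee_fin exprn_ge0.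
by rewrite integral_bool.
Qed.

End nn_average.

(** * The neighbour number as a function of the local count *)

Section knum.
Context {R : realType}.
Variables (K q : R).
Hypotheses (K0 : 0 < K) (q0 : 0 < q) (q1 : q < 1).

Definition knum (n : nat) : nat := (Num.truncn (K * n%:R `^ q)).+1.

Let Kn0 n : 0 <= K * n%:R `^ q. Proof. by rewrite mulr_ge0 ?(ltW K0) ?powR_ge0. Qed.

Lemma knum_gt0 n : (0 < knum n)%N. Proof. by []. Qed.

Lemma knum_ge n : K * n%:R `^ q <= (knum n)%:R.
Proof. by rewrite ltW// truncnS_gt. Qed.

Lemma knum_le n : (knum n)%:R <= K * n%:R `^ q + 1.
Proof. by rewrite -natr1 lerD2r truncn_le. Qed.

Lemma knum_homo m n : (m <= n)%N -> (knum m <= knum n)%N.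
Proof.
move=> mn; rewrite ltnS; apply: le_truncn.
by rewrite ler_wpM2l ?(ltW K0)// ge0_ler_powR ?nnegrE ?ler_nat ?(ltW q0).
Qed.

(** For n >= 1, n <= K n^q + 1 <= (K + 1) n^q gives n^(1-q) <= K + 1, a bound independent of N. By
    monotonicity k is then bounded too, so 2 k <= N for large N. *)
Lemma knum_few : exists n0 N0 : nat, forall N, (N0 <= N)%N -> forall n,
  (n <= knum n)%N -> (n <= n0)%N /\ ((knum n).*2 <= N)%N.
Proof.
have K1 : 0 <= K + 1 by rewrite addr_ge0 ?ltW.
exists (Num.truncn ((K + 1) `^ (1 - q)^-1)).
exists (knum (Num.truncn ((K + 1) `^ (1 - q)^-1))).*2 => N NN0 n nk.
suff nn0 : (n <= Num.truncn ((K + 1) `^ (1 - q)^-1))%N.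
  by split => //; apply: leq_trans NN0; rewrite leq_double knum_homo.
have [->//|n0] := posnP n.
rewrite truncn_ge_nat ?powR_ge0//.
have nr0 : 0 < n%:R :> R by rewrite ltr0n.
have nq1 : 1 <= n%:R `^ q by rewrite -[leLHS](powRr0 n%:R) ler_powR ?ler1n ?(ltW q0).
have le1 : n%:R <= (K + 1) * n%:R `^ q.
  have : n%:R <= (knum n)%:R :> R by rewrite ler_nat.
  have := knum_le n; nra.
have le2 : n%:R `^ (1 - q) <= K + 1.
  rewrite powRB; last by rewrite [_ == 0]gt_eqF ?implybT.
  by rewrite powRr1 ?(ltW nr0)// ler_pdivrMr ?powR_gt0.
have q1' : 1 - q != 0 by rewrite subr_eq0 gt_eqF.
have e : n%:R = (n%:R `^ (1 - q)) `^ (1 - q)^-1.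
  by rewrite -powRrM mulfV// powRr1// ltW.
rewrite [leLHS]e.
by rewrite ge0_ler_powR ?invr_ge0 ?subr_ge0 ?(ltW q1) ?nnegrE ?powR_ge0.
Qed.

End knum.

Section adaptive_counts.
Context {R : realType} {dT} {T : measurableType dT} {N : nat}.
Variables (mu : probability T R) (Q : probability (rowT T N) R).
Hypothesis Qbox : forall E : 'I_N -> set T, (forall i, measurable (E i)) ->
  Q (box E) = (\prod_i mu (E i))%E.
Variables (bA br : T -> bool) (mbA : measurable_fun setT bA) (mbr : measurable_fun setT br).
Variables (K q : R).
Hypotheses (K0 : 0 < K) (q0 : 0 < q) (q1 : q < 1).
Let u := N%:R * fine (mu [set t | bA t]).
Let w := N%:R * fine (mu [set t | br t]).
Local Notation k v := (knum K q (cnt bA v)).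

Let mc b : measurable_fun setT b -> measurable_fun [set: rowT T N] (fun v => (cnt b v)%:R : R).
Proof. by move=> mb; exact: (measurable_natfun (fun n : nat => n%:R : R) (measurable_cnt mb)). Qed.

Let powq_ge1 (x : R) : 1 <= x -> x^-1 <= x `^ (- q).
Proof.
move=> x1; have x0 : 0 < x by exact: lt_le_trans x1.
by rewrite -powR_inv1 ?(ltW x0)// ler_powR// lerN2 ltW.
Qed.

(** By Chebyshev the count is at most u / 2 with probability at most 4 / u <= 4 u^-q, and there 1 /
    k <= 1; elsewhere k >= K (u / 2)^q, which yields 2^q / K. *)
Lemma integral_inv_knum : 1 <= u ->
  (\int[Q]_v ((k v)%:R^-1)%:E <= ((4 + 2 `^ q / K) * u `^ (- q))%:E)%E.
Proof.
move=> u1; have u0 : 0 < u by exact: lt_le_trans u1.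
pose E := [set v : rowT T N | (cnt bA v)%:R <= u / 2].
have mE : measurable E.
  by apply: measurable_set_bool; apply: measurable_fun_ler; [exact: mc|exact: measurable_cst].
have QE : (Q E <= (4 * u `^ (- q))%:E)%E.
  apply: (@le_trans _ _ (u / (u / 2) ^+ 2)%:E).
    apply: (cnt_chebyshev Qbox mbA) => //; first by rewrite divr_gt0.
    by move=> v; rewrite /E /= -/u => vu; rewrite distrC (le_trans _ (ler_norm _))//; lra.
  rewrite lee_fin [leLHS](_ : _ = 4 * u^-1); last by field; rewrite gt_eqF.
  by rewrite ler_wpM2l// powq_ge1.
pose c := (K * (u / 2) `^ q)^-1.
have c0 : 0 <= c by rewrite invr_ge0 mulr_ge0 ?powR_ge0// ltW.
apply: (@le_trans _ _ (\int[Q]_v ((\1_E v)%:E + c%:E))%E).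
  apply: le_integral_ge0 => v; first by rewrite lee_fin invr_ge0.
  rewrite -EFinD lee_fin indicE.
  have [vE|vE] := boolP (v \in E).
    by rewrite ler_wpDr// invf_le1// ler1n.
  have uq : 0 < K * (u / 2) `^ q by rewrite mulr_gt0// powR_gt0// divr_gt0.
  rewrite add0r lef_pV2 ?posrE//.
  apply: le_trans (knum_ge K q _).
  rewrite ler_wpM2l ?(ltW K0)// ge0_ler_powR ?nnegrE ?(ltW q0)//.
    by rewrite divr_ge0 ?(ltW u0).
  by move: vE; rewrite notin_setE /E/= => /negP; rewrite -ltNge => /ltW.
rewrite ge0_integralD//; last first.
  exact/measurable_EFinP/measurable_indic.
rewrite prob_integral_cst integral_indic// setIT mulrDl EFinD; apply: leeD => //.
rewrite lee_fin /c powRM ?invr_ge0 ?(ltW u0)// powRN -[2^-1]powR_inv1// -powRrM mulN1r powRN.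
rewrite le_eqVlt; apply/orP; left; apply/eqP; field.
by rewrite !gt_eqF// powR_gt0.
Qed.

(** If the count in the large ball is below 2 u, then k <= K (2 u)^q + 1 <= (2^q K + 1) u^q <= w /
    2. So the event needs that count to double its mean, or the count in the small ball to fall to
    half of its mean; Chebyshev gives 1 / u and 4 / w <= 2 u^-q. *)
Lemma prob_cnt_le_knum : 1 <= u -> 2 * (2 `^ q * K + 1) * u `^ q <= w ->
  (Q [set v | (cnt br v <= k v)%N] <= (3 * u `^ (- q))%:E)%E.
Proof.
move=> u1 uw; have u0 : 0 < u by exact: lt_le_trans u1.
have uq1 : 1 <= u `^ q by rewrite -[leLHS](powRr0 u) ler_powR// ltW.
have K2 : 0 < 2 `^ q * K by rewrite mulr_gt0// powR_gt0.
have w0 : 0 < w by nra.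
pose E1 := [set v : rowT T N | 2 * u <= (cnt bA v)%:R].
pose E2 := [set v : rowT T N | (cnt br v)%:R <= w / 2].
have mE1 : measurable E1.
  by apply: measurable_set_bool; apply: measurable_fun_ler; [exact: measurable_cst|exact: mc].
have mE2 : measurable E2.
  by apply: measurable_set_bool; apply: measurable_fun_ler; [exact: mc|exact: measurable_cst].
have QE1 : (Q E1 <= (u `^ (- q))%:E)%E.
  apply: (@le_trans _ _ (u / u ^+ 2)%:E).
    apply: (cnt_chebyshev Qbox mbA) => //.
    by move=> v; rewrite /E1 /= -/u => vu; rewrite (le_trans _ (ler_norm _))//; lra.
  rewrite lee_fin [leLHS](_ : _ = u^-1); last by field; rewrite gt_eqF.
  by rewrite powq_ge1.
have QE2 : (Q E2 <= (2 * u `^ (- q))%:E)%E.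
  apply: (@le_trans _ _ (w / (w / 2) ^+ 2)%:E).
    apply: (cnt_chebyshev Qbox mbr) => //; first by rewrite divr_gt0.
    by move=> v; rewrite /E2 /= -/w => vu; rewrite distrC (le_trans _ (ler_norm _))//; lra.
  rewrite lee_fin [leLHS](_ : _ = 4 / w); last by field; rewrite gt_eqF.
  rewrite ler_pdivrMr// powRN mulrAC ler_pdivlMr//; nra.
have mk : measurable [set v : rowT T N | (cnt br v <= k v)%N].
  apply: measurable_set_bool; apply: measurable_fun_leq; first exact: measurable_cnt.
  exact: (measurable_natfun (knum K q) (measurable_cnt mbA)).
apply: (@le_trans _ _ (Q (E1 `|` E2))).
  apply: le_measure; rewrite ?inE//; first exact: measurableU.
  move=> v /= vk; apply: contrapT => /not_orP[]; rewrite /E1 /E2/= => /negP n1 /negP n2.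
  move: n1 n2; rewrite -!ltNge => n1 n2.
  have k1 : (k v)%:R <= K * (cnt bA v)%:R `^ q + 1 by exact: knum_le.
  have : (cnt bA v)%:R `^ q <= (2 * u) `^ q.
    by apply: ge0_ler_powR; rewrite ?nnegrE ?(ltW q0)//; [nra|exact: ltW].
  rewrite powRM// ?(ltW u0)// => le1.
  have : (cnt br v)%:R <= (k v)%:R :> R by rewrite ler_nat.
  have : K * (cnt bA v)%:R `^ q <= K * (2 `^ q * u `^ q) by rewrite ler_wpM2l// ltW.
  have e : K * (2 `^ q * u `^ q) = 2 `^ q * K * u `^ q by ring.
  rewrite e; nra.
apply: (@le_trans _ _ (Q E1 + Q E2)%E); first exact: measureU2.
rewrite (_ : 3 * _ = u `^ (- q) + 2 * u `^ (- q)); last by ring.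
by rewrite EFinD leeD.
Qed.

End adaptive_counts.

(** * Norms and balls *)

Section norm.
Context {R : realType} {d : nat}.
Variables (nrm : 'rV[R]_d -> R) (nrm_norm : is_norm nrm).
Local Notation V := (rowT (Real_sort__canonical__measurable_structure_Measurable R) d).

Let nrm_eq0 x : nrm x = 0 -> x = 0. Proof. by case: nrm_norm => h _ _; exact: h. Qed.
Let nrmD x y : nrm (x + y) <= nrm x + nrm y. Proof. by case: nrm_norm. Qed.
Let nrmZ a x : nrm (a *: x) = `|a| * nrm x. Proof. by case: nrm_norm. Qed.

Lemma is_norm0 : nrm 0 = 0.
Proof. by rewrite -(scale0r (0 : 'rV[R]_d)) nrmZ normr0 mul0r. Qed.

Lemma is_normN x : nrm (- x) = nrm x.
Proof. by rewrite -scaleN1r nrmZ normrN1 mul1r. Qed.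

Lemma is_norm_ge0 x : 0 <= nrm x.
Proof. by have := nrmD x (- x); rewrite subrr is_norm0 is_normN; lra. Qed.

Lemma is_norm_distC x y : nrm (x - y) = nrm (y - x).
Proof. by rewrite -is_normN opprB. Qed.

Lemma is_norm_dist_triangle y x z : nrm (x - z) <= nrm (x - y) + nrm (y - z).
Proof. by rewrite (le_trans _ (nrmD _ _))// addrA subrK. Qed.

Let Cn : R := 1 + \sum_(i < d) nrm (delta_mx 0 i).
Let Cn0 : 0 < Cn.
Proof. by rewrite ltr_pwDl// sumr_ge0// => i _; exact: is_norm_ge0. Qed.

Let nrm_sum (I : Type) (s : seq I) (F : I -> 'rV[R]_d) :
  nrm (\sum_(i <- s) F i) <= \sum_(i <- s) nrm (F i).
Proof.
elim: s => [|i s IH]; first by rewrite !big_nil is_norm0.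
by rewrite !big_cons (le_trans (nrmD _ _))// lerD2l.
Qed.

(** This half of the equivalence with the sup norm follows from the triangle inequality on the
    canonical basis. It places cubes inside balls, for measurability and for volume. *)
Lemma is_norm_le_coord : exists2 C : R, 0 < C &
  forall (x : 'rV[R]_d) (s : R), 0 <= s -> (forall i, `|x ord0 i| <= s) -> nrm x <= C * s.
Proof.
exists Cn => // x s s0 xs; rewrite [x]row_sum_delta.
apply: (le_trans (nrm_sum _ _)).
rewrite /Cn mulrDl mul1r ler_wpDl// mulr_suml; apply: ler_sum => i _.
by rewrite nrmZ mulrC ler_wpM2l// is_norm_ge0.
Qed.

Lemma is_norm_exists (r : R) : (0 < d)%N -> 0 <= r -> exists x, nrm x = r.
Proof.
move=> d0 r0; pose e : 'rV[R]_d := delta_mx 0 (Ordinal d0).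
have e0 : nrm e != 0.
  apply/eqP => /nrm_eq0 /rowP /(_ (Ordinal d0)); rewrite !mxE !eqxx/= => /eqP.
  by rewrite oner_eq0.
exists ((r / nrm e) *: e); rewrite nrmZ ger0_norm ?divr_ge0 ?is_norm_ge0//.
by rewrite divfK.
Qed.

(** The sigma-algebra on rows is generated by the coordinates, not by open sets, so the strict
    sublevel sets are exhausted by boxes instead of using continuity. *)
Lemma measurable_is_norm : measurable_fun [set: V] nrm.
Proof.
have [C C0 nrmC] := is_norm_le_coord.
move=> mD; apply: (measurability _ (RGenInftyO.measurableE R)) => //.
move=> _ [_ [c ->] <-]; rewrite setTI.
(* The set where nrm < c is a countable union of cubes with rational centres. *)
pose toR (q : 'rV[rat]_d) : 'rV[R]_d := map_mx ratr q.
pose F (p : 'rV[rat]_d * nat) : set V :=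
  if nrm (toR p.1) + C * p.2.+1%:R^-1 < c
  then \bigcap_(i in [set: 'I_d]) [set x : V | `|x ord0 i - ratr (p.1 ord0 i)| <= p.2.+1%:R^-1]
  else set0.
rewrite (_ : _ @^-1` _ = \bigcup_p F p).
  apply: countable_bigcupT_measurable => [|p]; first exact: countableP.
  rewrite /F; case: ifP => _ //.
  apply: fin_bigcap_measurable => [|i _]; first exact: finite_finset.
  apply: measurable_set_bool; apply: measurable_fun_ler; last exact: measurable_cst.
  apply: measurableT_comp => //; apply: measurable_funB; last exact: measurable_cst.
  exact: measurable_coord.
have close (x : 'rV[R]_d) (q : 'rV[rat]_d) m : (forall i, `|x ord0 i - ratr (q ord0 i)| <= m.+1%:R^-1) ->
    nrm (x - toR q) <= C * m.+1%:R^-1.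
  by move=> xq; apply: nrmC => [|i]; rewrite ?invr_ge0// !mxE.
apply/seteqP; split => x /=; rewrite in_itv/=.
  (* The error C / m.+1 is spent twice, between x and the rational centre and in the test defining
     [F]; hence the factor 2. *)
  move=> xc; pose e := (c - nrm x) / (2 * C).
  have e0 : 0 < e by rewrite divr_gt0 ?subr_gt0 ?mulr_gt0.
  have [m me] : exists m, m.+1%:R^-1 < e.
    exists (Num.truncn e^-1).
    by rewrite -[ltRHS]invrK ltf_pV2 ?posrE ?invr_gt0// truncnS_gt.
  have m0 : 0 < m.+1%:R^-1 :> R by rewrite invr_gt0.
  have ex i : exists q : rat, `|x ord0 i - ratr q| <= m.+1%:R^-1.
    set s := _^-1 in m0 *; have : x ord0 i - s < x ord0 i + s by lra.
    move=> /rat_in_itvoo[q]; rewrite in_itv/= => /andP[q1 q2].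
    by exists q; rewrite ler_norml; apply/andP; split; lra.
  have [g gP] := choice ex.
  pose q : 'rV[rat]_d := \row_i g i.
  have xq i : `|x ord0 i - ratr (q ord0 i)| <= m.+1%:R^-1 by rewrite mxE.
  exists (q, m) => //; rewrite /F/= ifT; first by move=> i _ /=.
  have := close x q m xq; have := is_norm_dist_triangle x (toR q) 0.
  rewrite !subr0 is_norm_distC => h1 h2.
  have : C * m.+1%:R^-1 < C * e by rewrite ltr_pM2l.
  rewrite (_ : C * e = (c - nrm x) / 2); last by rewrite /e; field; rewrite gt_eqF.
  move=> h3; move: h1 h2 h3; move: (C / _) (nrm (x - _)) (nrm (toR q)) (nrm x) => s1 s2 s3 s4; lra.
move=> [[q m] _]; rewrite /F/=; case: ifP => // qc xq.
have := close x q m (fun i => xq i I); have := is_norm_dist_triangle (toR q) x 0.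
rewrite !subr0 => h1 h2; move: h1 h2 qc; rewrite is_norm_distC.
by move: (C / _) (nrm (_ - _)) (nrm (toR q)) (nrm x) => s1 s2 s3 s4 h1 h2 h3; lra.
Qed.

Lemma measurable_nball x r : measurable (nball nrm x r : set V).
Proof.
apply: measurable_set_bool; apply: measurable_fun_ler; last exact: measurable_cst.
apply: (measurableT_comp measurable_is_norm).
apply: measurable_fun_rVP => i; under eq_fun do rewrite !mxE.
apply: measurable_funB; last exact: measurable_cst.
exact: measurable_coord.
Qed.

Lemma nball_volume : exists2 c : R, 0 < c & forall x r, 0 < r ->
  ((c * r ^+ d)%:E <= @lebesgue_rV R d (nball nrm x r))%E.
Proof.
have [C C0 nrmC] := is_norm_le_coord.
exists ((2 / C) ^+ d); first by rewrite exprn_gt0// divr_gt0.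
move=> x r r0.
(* The cube of half side r / C lies in the ball of radius r. *)
pose B (i : 'I_d) : set (measurableTypeR R) := `[x ord0 i - r / C, x ord0 i + r / C]%classic.
have mB i : measurable (B i) by exact: measurable_itv.
apply: (@le_trans _ _ (lebesgue_rV [set v : 'rV[R]_d | forall i, B i (v ord0 i)])); last first.
  apply: le_measure; rewrite ?inE//; last 2 first.
  - exact: measurable_nball.
  - move=> v /= vB; rewrite /nball/= (_ : r = C * (r / C)); last by field; rewrite gt_eqF.
    apply: nrmC => [|i]; first by rewrite divr_ge0 ?ltW.
    by have := vB i; rewrite /B/= in_itv/= !mxE ler_norml => /andP[? ?]; apply/andP; split; lra.
  rewrite (_ : [set v | _] = \bigcap_(i in [set: 'I_d]) ((fun v : 'rV[R]_d => v ord0 i) @^-1` B i)).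
    apply: fin_bigcap_measurable => [|i _]; first exact: finite_finset.
    have mi := @measurable_coord _ (measurableTypeR R) d i measurableT (B i) (mB i).
    by rewrite setTI in mi; exact: mi.
  by apply/seteqP; split => v /= h i //; [move=> _; exact: h|exact: (h i)].
rewrite lebesgue_rV_box// (eq_bigr (fun=> (2 / C * r)%:E)); last first.
  move=> i _; rewrite lebesgue_measure_itv/= lte_fin.
  have rC : 0 < r / C by rewrite divr_gt0.
  rewrite ifT; last by lra.
  by rewrite -EFinD; congr EFin; field; rewrite gt_eqF.
by rewrite prodEFin lee_fin prodr_const card_ord -exprMn.
Qed.

End norm.

(** * Laws, disintegration and densities *)

Section law.
Context {R : realType} {d1 d2} {O : measurableType d1} {T : measurableType d2}.
Variables (P : probability O R).

Definition law (h : O -> T) (mh : measurable_fun setT h) : probability T R :=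
  distribution P (HB.pack h (isMeasurableFun.Build _ _ _ _ h mh) : {mfun O >-> T}).

Lemma lawE (h : O -> T) (mh : measurable_fun setT h) A : law mh A = P (h @^-1` A).
Proof. by []. Qed.

Lemma ge0_integral_law (h : O -> T) (mh : measurable_fun setT h) (F : T -> \bar R) :
  measurable_fun setT F -> (forall t, 0 <= F t)%E ->
  (\int[law mh]_t F t = \int[P]_w F (h w))%E.
Proof. by move=> mF F0; rewrite ge0_integral_distribution. Qed.

Lemma integral_law (h : O -> T) (mh : measurable_fun setT h) (F : T -> \bar R) :
  measurable_fun setT F -> P.-integrable setT (F \o h) ->
  (\int[law mh]_t F t = \int[P]_w F (h w))%E.
Proof. by move=> mF iF; rewrite integral_distribution. Qed.

End law.

Notation pairT A B := (Datatypes_prod__canonical__measurable_structure_Measurable A B).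
Notation realT R := (Real_sort__canonical__measurable_structure_Measurable R).

Section iid.
Context {R : realType} {dO dT} {O : measurableType dO} {T : measurableType dT}.
Variables (P : probability O R) (Z : option nat -> O -> T).
Hypothesis mZ : forall i, measurable_fun setT (Z i).
Hypothesis indep : mutually_independent P Z.
Hypothesis ident : forall i E, measurable E -> P (Z (Some i) @^-1` E) = P (Z None @^-1` E).

Let mu : probability T R := law P (mZ None).

Definition sample_row n (idx : 'I_n -> option nat) (w : O) : 'rV[T]_n := \row_i Z (idx i) w.

Lemma measurable_sample_row n (idx : 'I_n -> option nat) :
  measurable_fun setT (sample_row idx : O -> rowT T n).
Proof.
apply: measurable_fun_rVP => i; rewrite /sample_row; under eq_fun do rewrite mxE.
exact: mZ.
Qed.

Lemma sample_row_box n (idx : 'I_n -> option nat) : injective idx ->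
  forall E : 'I_n -> set T, (forall i, measurable (E i)) ->
  law P (measurable_sample_row idx) (box E) = (\prod_i mu (E i))%E.
Proof.
move=> idx_inj E mE; rewrite lawE.
(* Independence is stated for events indexed by [option nat], so the sides of the box are carried
   along [idx]. *)
pose E' o := if [pick i | idx i == o] is Some i then E i else setT.
have mE' o : measurable (E' o) by rewrite /E'; case: pickP.
have E'E i : E' (idx i) = E i.
  rewrite /E'; case: pickP => [j /eqP/idx_inj -> //|/(_ i)].
  by rewrite eqxx.
have u : uniq [seq idx i | i <- enum 'I_n].
  by rewrite map_inj_uniq ?enum_uniq.
have := indep u mE'.
rewrite !big_map -!enumT !big_enum/= => h.
transitivity (\prod_i P (Z (idx i) @^-1` E' (idx i)))%E; last first.
  apply: eq_bigr => i _; rewrite E'E lawE; case: (idx i) => // k; exact: ident.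
rewrite -h; congr (P _); apply/seteqP; split => w /=.
  move=> wE; elim/big_ind : _ => //= i _; rewrite E'E.
  by have := wE i; rewrite mxE.
move=> wE i; rewrite mxE.
by move: wE; rewrite (bigD1 i)//= => -[]; rewrite E'E.
Qed.

Let mu_row N := law P (@measurable_sample_row N (fun i => Some (val i))).

Lemma train_row_box N (E : 'I_N -> set T) : (forall i, measurable (E i)) ->
  mu_row N (box E) = (\prod_i mu (E i))%E.
Proof. by apply: sample_row_box => i j [] /val_inj. Qed.

(* The test pair is the coordinate 0 of a row of N + 1 independent pairs, and
   resampling it decouples it from the training data. *)
Lemma ge0_integral_test_train N (H : T * 'rV[T]_N -> \bar R) :
  measurable_fun [set: pairT T (rowT T N)] H -> (forall p, 0 <= H p)%E ->
  (\int[P]_w H (Z None w, sample_row (fun i : 'I_N => Some (val i)) w) =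
   \int[mu]_t \int[mu_row N]_v H (t, v))%E.
Proof.
move=> mH H0.
pose idx (i : 'I_N.+1) : option nat := omap val (unlift ord0 i).
have idx_inj : injective idx.
  move=> i j; rewrite /idx.
  by case: unliftP => [i' ->|->]; case: unliftP => [j' ->|->] //= -[] /val_inj ->.
pose rest (v : 'rV[T]_N.+1) : 'rV[T]_N := \row_i v ord0 (lift ord0 i).
have mrest : measurable_fun [set: rowT T N.+1] (rest : _ -> rowT T N).
  apply: measurable_fun_rVP => i; under eq_fun do rewrite mxE.
  exact: measurable_coord.
pose Q1 := law P (measurable_sample_row idx).
have mH1 : measurable_fun [set: rowT T N.+1] (fun v => H (v ord0 ord0, rest v)).
  apply: (measurableT_comp mH); apply: measurable_fun_pair => //.
  exact: measurable_coord.
transitivity (\int[Q1]_v H (v ord0 ord0, rest v))%E.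
  rewrite /Q1 ge0_integral_law//. apply: eq_integral => w _; congr H; congr pair.
    by rewrite mxE /idx unlift_none.
  by apply/rowP => i; rewrite !mxE /idx liftK.
rewrite (ge0_resample (sample_row_box idx_inj) ord0)//.
rewrite [RHS](@fubini_tonelli _ _ _ _ _ mu (mu_row N) H)//.
have mG : measurable_fun [set: rowT T N] (fun v => \int[mu]_t H (t, v))%E.
  exact: (@measurable_fun_fubini_tonelli_G _ _ _ _ _ mu H).
transitivity (\int[Q1]_v \int[mu]_t H (t, rest v))%E.
  apply: eq_integral => v _; apply: eq_integral => t _.
  rewrite updE eqxx; congr (H (_, _)); apply/rowP => i.
  by rewrite !mxE eq_sym (negbTE (neq_lift _ _)).
rewrite ge0_integral_law//; last 2 first.
- exact: (measurableT_comp mG mrest).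
- by move=> v; exact: integral_ge0.
rewrite [RHS]ge0_integral_law//; last by move=> v; exact: integral_ge0.
apply: eq_integral => w _; apply: eq_integral => t _; congr (H (_, _)).
by apply/rowP => i; rewrite !mxE /idx liftK.
Qed.

End iid.

Section prod_unique.
Context {R : realType} {dA dB} {A : measurableType dA} {B : measurableType dB}.

Lemma prod_measure_unique (m1 m2 : {measure set (pairT A B) -> \bar R}) :
  (m1 setT < +oo)%E ->
  (forall E F, measurable E -> measurable F -> m1 (E `*` F) = m2 (E `*` F)) ->
  forall C, measurable C -> m1 C = m2 C.
Proof.
move=> m1oo m12 C mC.
apply: (measure_unique [set E `*` F | E in measurable & F in measurable] (fun=> setT)) => //.
- exact: measurable_prod_measurableType.
- move=> _ _ [E mE [F mF <-]] [E' mE' [F' mF' <-]].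
  exists (E `&` E'); first exact: measurableI.
  by exists (F `&` F'); [exact: measurableI|rewrite setXI].
- by move=> _; exists setT => //; exists setT => //; rewrite setXTT.
- by apply/seteqP; split => // p _; exists 0%N.
- by move=> _ [E mE [F mF <-]]; exact: m12.
Qed.

End prod_unique.

Section disintegration.
Context {R : realType} {dA dB} {A : measurableType dA} {B : measurableType dB}.
Variables (kappa : A -> pprobability B R) (mkappa : measurable_fun setT kappa).
Variables (PX : probability A R) (mu : probability (pairT A B) R).
Hypothesis muE : forall E F, measurable E -> measurable F ->
  mu (E `*` F) = (\int[PX]_(x in E) kappa x F)%E.

(** The measure PX(dx) kappa x (dy) is built as a composition of kernels issued from a one-point
    space; the Dirac kernel of [pr] keeps x beside y. *)
Let PX' : unit -> pprobability A R := fun=> (PX : pprobability A R).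
Let mPX' : measurable_fun setT PX'. Proof. exact: measurable_cst. Qed.
Let kappa' (p : unit * A) : pprobability B R := kappa p.2.
Let mkappa' : measurable_fun setT kappa'.
Proof. by apply: measurableT_comp => //; exact: measurable_snd. Qed.
Let pr (p : (unit * A) * B) : A * B := (p.1.2, p.2).
Let mpr : measurable_fun setT pr.
Proof.
apply: measurable_fun_pair; last exact: measurable_snd.
exact: measurableT_comp measurable_snd measurable_fst.
Qed.

Let kk := mkcomp (kprobability mkappa') (kdirac mpr).
Let joint := mkcomp (kprobability mPX') kk tt.

Let integral_joint (phi : pairT A B -> \bar R) : measurable_fun setT phi ->
  (forall p, 0 <= phi p)%E ->
  (\int[joint]_p phi p = \int[PX]_x \int[kappa x]_y phi (x, y))%E.
Proof.
move=> mphi phi0.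
rewrite /joint integral_kcomp//; apply: eq_integral => x _.
rewrite /kk integral_kcomp//; apply: eq_integral => y _.
by rewrite integral_dirac// diracT mul1e.
Qed.

Lemma ge0_integral_disintegration (phi : pairT A B -> \bar R) :
  measurable_fun setT phi -> (forall p, 0 <= phi p)%E ->
  (\int[mu]_p phi p = \int[PX]_x \int[kappa x]_y phi (x, y))%E.
Proof.
move=> mphi phi0; rewrite -integral_joint//.
apply: eq_measure_integral => C mC _.
apply: prod_measure_unique mC => //.
  by apply: (le_lt_trans (probability_le1 mu measurableT)); rewrite ltry.
move=> E F mE mF; rewrite -[LHS]/(mu (E `*` F)) muE//.
have mEF : measurable (E `*` F) by exact: measurableX.
transitivity (\int[joint]_p (\1_(E `*` F) p)%:E)%E; last first.
  by have := @integral_indic _ _ _ joint setT measurableT _ mEF; rewrite setIT.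
rewrite integral_joint//; last exact/measurable_EFinP/measurable_indic.
rewrite integral_mkcond; apply: eq_integral => x _.
rewrite patchE; case: ifPn => xE.
  rewrite -[X in kappa x X = _]setIT -integral_indic//; apply: eq_integral => y _.
  by rewrite !indicE in_setX xE.
rewrite integral0_eq// => y _; rewrite indicE in_setX.
by rewrite (negbTE xE).
Qed.

End disintegration.

Section density.
Context {R : realType} {dA} {A : measurableType dA}.
Variables (lam : {sigma_finite_measure set A -> \bar R}) (PX : probability A R).
Variables (f : A -> R).
Hypotheses (mf : measurable_fun setT f) (f0 : forall x, 0 <= f x).
Hypothesis PXE : forall E, measurable E -> PX E = (\int[lam]_(x in E) (f x)%:E)%E.

(* Layer cake: h x is the length of the interval [0, h x[. *)
Lemma ge0_integral_density (h : A -> R) : measurable_fun setT h -> (forall x, 0 <= h x) ->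
  (\int[PX]_x (h x)%:E = \int[lam]_x (h x * f x)%:E)%E.
Proof.
move=> mh h0.
pose b (p : A * R) : bool := (0 <= p.2) && (p.2 < h p.1).
have mb : measurable_fun [set: pairT A (realT R)] b.
  apply: measurable_and.
    by apply: measurable_fun_ler; [exact: measurable_cst|exact: measurable_snd].
  apply: measurable_fun_ltr; first exact: measurable_snd.
  exact: measurableT_comp mh measurable_fst.
have mbR : measurable_fun [set: pairT A (realT R)] (fun p => (b p)%:R : R).
  exact: (measurable_boolfun (fun c : bool => c%:R : R) mb).
have hE x : (\int[@lebesgue_measure R]_t (b (x, t))%:R%:E = (h x)%:E)%E.
  have -> : (\int[@lebesgue_measure R]_t (b (x, t))%:R%:E =
      \int[@lebesgue_measure R]_t (\1_(`[0, h x[%classic) t)%:E)%E.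
    apply: eq_integral => t _; rewrite indicE; congr ((nat_of_bool _)%:R%:E).
    by apply/idP/idP; rewrite inE /b/= in_itv.
  rewrite integral_indic// setIT.
  rewrite -[LHS]/(lebesgue_measure (`[0, h x[%classic : set (measurableTypeR R))).
  rewrite lebesgue_measure_itv/= lte_fin.
  case: ltP => hx; first by rewrite -EFinB subr0.
  by have /eqP -> : h x == 0 by rewrite eq_le hx h0.
under eq_integral do rewrite -hE.
rewrite (@fubini_tonelli _ _ _ _ _ PX (@lebesgue_measure R) (fun p => (b p)%:R%:E))//; last first.
  exact/measurable_EFinP.
have mfbR : measurable_fun [set: pairT A (realT R)] (fun p => (b p)%:R * f p.1 : R).
  by apply: measurable_funM => //; exact: measurableT_comp mf measurable_fst.
(* At a fixed level t the inner integral is the probability of a measurable set, to which the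
   density hypothesis applies. *)
transitivity (\int[@lebesgue_measure R]_t \int[lam]_x ((b (x, t))%:R * f x)%:E)%E.
  apply: eq_integral => t _.
  have mbt : measurable_fun setT (fun x => b (x, t)).
    by apply: (measurableT_comp mb); exact: measurable_pair2.
  rewrite integral_bool// -[LHS]/(PX [set x | b (x, t)]) PXE; last exact: measurable_set_bool.
  rewrite integral_mkcond; apply: eq_integral => x _; rewrite patchE.
  case: ifPn; rewrite ?inE ?notin_setE/= => bx; first by rewrite bx mul1r.
  by rewrite (negbTE (introN idP bx)) mul0r.
rewrite -(@fubini_tonelli _ _ _ _ _ lam (@lebesgue_measure R) (fun p => ((b p)%:R * f p.1)%:E))//; last 2 first.
- exact/measurable_EFinP.
- by move=> p; rewrite lee_fin mulr_ge0.
apply: eq_integral => x _ /=; rewrite mulrC EFinM -hE -ge0_integralZl//.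
- by apply: eq_integral => t _; rewrite -EFinM mulrC.
- by apply/measurable_EFinP; apply: (measurableT_comp mbR); exact: measurable_pair1.
- by rewrite lee_fin.
Qed.

End density.

(** * Mean and variance under the conditional law *)

Section centered.
Context {R : realType} (nu : probability (realT R) R) (m v : R).
Hypothesis mean0 : ('E_nu[fun y => (y - m)%R] = 0)%E.

Let mid : measurable_fun [set: realT R] (fun y : R => y - m).
Proof. by apply: measurable_funB; [exact: measurable_id|exact: measurable_cst]. Qed.

(** The integral is the difference of those of the positive and negative parts, and in [\bar R] it
    is infinite as soon as one of them is, since +oo - +oo is -oo. A zero mean thus makes both
    finite. *)
Lemma centered_integrable : nu.-integrable setT (EFin \o (fun y : R => y - m)).
Proof.
move: mean0; rewrite unlock => e0.
have mE : measurable_fun [set: realT R] (EFin \o (fun y : R => y - m)).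
  exact/measurable_EFinP.
have p0 : (0 <= \int[nu]_y ((EFin \o (fun y : R => (y - m)%R))^\+ y))%E.
  by apply: integral_ge0 => y _; exact: funepos_ge0.
have n0 : (0 <= \int[nu]_y ((EFin \o (fun y : R => (y - m)%R))^\- y))%E.
  by apply: integral_ge0 => y _; exact: funeneg_ge0.
apply/integrableP; split => //.
rewrite -/(abse \o _) fune_abse ge0_integralD//; last 2 first.
- exact: measurable_funepos.
- exact: measurable_funeneg.
have := integralE nu setT (EFin \o (fun y : R => y - m)).
rewrite [X in X = _]e0.
set ip := integral nu _ _ in p0 *; set im := integral nu _ _ in n0 *.
case: ip p0 => [p| |]// p0; case: im n0 => [n| |]// n0 _.
by rewrite -EFinD ltry.
Qed.

Lemma centered_mean : (\int[nu]_y (y - m)%:E = 0)%E.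
Proof. by move: mean0; rewrite unlock. Qed.

Let id_mean : ('E_nu[idfun] = m%:E)%E.
Proof.
rewrite unlock /=.
rewrite (eq_integral (fun y => ((EFin \o (fun y : R => (y - m)%R)) y + (EFin \o cst m) y)%E)).
  rewrite integralD//; last 2 first.
  - exact: centered_integrable.
  - exact: finite_measure_integrable_cst.
  rewrite centered_mean add0e; exact: (prob_integral_cst nu m%:E).
by move=> y _ /=; rewrite -EFinD subrK.
Qed.

Lemma centered_variance : ('V_nu[idfun] = \int[nu]_y ((y - m) ^+ 2)%:E)%E.
Proof.
rewrite /variance unlock id_mean/= unlock.
by apply: eq_integral => y _; rewrite expr2.
Qed.

Hypothesis var_le : ('V_nu[idfun] <= v%:E)%E.

Lemma second_moment c :
  (\int[nu]_y ((y - c) ^+ 2)%:E = \int[nu]_y ((y - m) ^+ 2)%:E + ((m - c) ^+ 2)%:E)%E.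
Proof.
have m2 (a : R) : measurable_fun [set: realT R] (fun y : R => (y - a) ^+ 2).
  by apply: measurable_funX; apply: measurable_funB; [exact: measurable_id|exact: measurable_cst].
have i2 : nu.-integrable setT (EFin \o (fun y : R => (y - m) ^+ 2)).
  apply/integrableP; split; first exact/measurable_EFinP.
  rewrite (eq_integral (EFin \o (fun y : R => (y - m) ^+ 2))); last first.
    by move=> y _; rewrite gee0_abs//= lee_fin sqr_ge0.
  by rewrite -centered_variance (le_lt_trans var_le)// ltry.
have i1 : nu.-integrable setT (fun y => ((2 * (m - c))%:E * (EFin \o (fun y : R => (y - m)%R)) y)%E).
  by apply: integrableZl => //; exact: centered_integrable.
have i0 := finite_measure_integrable_cst nu ((m - c) ^+ 2) measurableT.
rewrite (eq_integral (fun y => (((EFin \o (fun y : R => ((y - m) ^+ 2)%R)) \+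
  (fun y => (2 * (m - c))%:E * (EFin \o (fun y : R => (y - m)%R)) y)) y + (EFin \o cst ((m - c) ^+ 2)%R) y)%E)); last first.
  by move=> y _ /=; rewrite -!EFinM -!EFinD; congr EFin; ring.
rewrite integralD//; last exact: integrableD.
rewrite integralD// integralZl//; last exact: centered_integrable.
rewrite centered_mean mule0 adde0; congr (_ + _)%E.
exact: (prob_integral_cst nu ((m - c) ^+ 2)%:E).
Qed.

End centered.

Section regression_kernel.
Context {R : realType} {dA} {A : measurableType dA}.
Variables (kappa : A -> pprobability (realT R) R) (mkappa : measurable_fun setT kappa).
Variables (PX : probability A R) (mu : probability (pairT A (realT R)) R).
Hypothesis muE : forall E F, measurable E -> measurable F ->
  mu (E `*` F) = (\int[PX]_(x in E) kappa x F)%E.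
Variables (eta : A -> R) (Ca : R).
Hypothesis mean0 : forall x, ('E_(kappa x)[fun y => (y - eta x)%R] = 0)%E.
Hypothesis var_le : forall x, ('V_(kappa x)[idfun] <= Ca%:E)%E.

(** Measurability of eta is not assumed but derived: eta is the mean of the kernel, a difference of
    two kernel integrals of nonnegative functions. *)
Lemma measurable_eta : measurable_fun setT eta.
Proof.
have mk U : measurable U -> measurable_fun setT (kappa ^~ U).
  exact: (measurable_kernel (kprobability mkappa)).
have mid : measurable_fun [set: realT R] (EFin \o (fun y : R => y)).
  by apply/measurable_EFinP; exact: measurable_id.
have mp := @measurable_fun_integral_kernel _ _ _ _ R kappa mk _ (funepos_ge0 _) (measurable_funepos mid).
have mn := @measurable_fun_integral_kernel _ _ _ _ R kappa mk _ (funeneg_ge0 _) (measurable_funeneg mid).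
rewrite (_ : eta = fine \o (fun x => (\int[kappa x]_y y%:E)%E)).
  apply: (measurableT_comp (fine_measurable measurableT)).
  under eq_fun do rewrite integralE.
  exact: emeasurable_funB.
apply/funext => x /=.
have i1 := centered_integrable (mean0 x).
rewrite (eq_integral (fun y => ((EFin \o (fun y : R => (y - eta x)%R)) y + (EFin \o cst (eta x)) y)%E)).
  rewrite integralD//; last exact: finite_measure_integrable_cst.
  rewrite centered_mean// add0e.
  by have := prob_integral_cst (kappa x) (eta x)%:E; rewrite /= => ->.
by move=> y _ /=; rewrite -EFinD subrK.
Qed.

Let bayes x : \bar R := (\int[kappa x]_y ((y - eta x) ^+ 2)%:E)%E.

Lemma bayes_le x : (bayes x <= Ca%:E)%E.
Proof. by rewrite /bayes -centered_variance//; exact: mean0. Qed.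

Lemma bayes_ge0 x : (0 <= bayes x)%E.
Proof. by apply: integral_ge0 => y _; rewrite lee_fin sqr_ge0. Qed.

Let m2 (a : R) : measurable_fun [set: realT R] (fun y : R => (y - a) ^+ 2).
Proof. by apply: measurable_funX; apply: measurable_funB; [exact: measurable_id|exact: measurable_cst]. Qed.

Let msq (g : A -> R) : measurable_fun setT g ->
  measurable_fun [set: pairT A (realT R)] (fun t => (g t.1 - t.2) ^+ 2).
Proof.
move=> mg; apply: measurable_funX; apply: measurable_funB; last exact: measurable_snd.
exact: measurableT_comp mg measurable_fst.
Qed.

(** The cross term vanishes under each [kappa x]. The identity is stated as a sum, so that it holds
    even if the first term is infinite. *)
Lemma integral_sqr_error (g : A -> R) : measurable_fun setT g ->
  (\int[mu]_t ((g t.1 - t.2) ^+ 2)%:E =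
   \int[PX]_x ((g x - eta x) ^+ 2)%:E + \int[mu]_t ((t.2 - eta t.1) ^+ 2)%:E)%E.
Proof.
move=> mg; have meta := measurable_eta.
have mb : measurable_fun setT bayes.
  pose phi (t : pairT A (realT R)) := ((t.2 - eta t.1) ^+ 2)%:E.
  have mphi : measurable_fun setT phi.
    apply/measurable_EFinP; have := msq meta.
    by under eq_fun do rewrite -sqrrN opprB.
  apply: (@measurable_fun_integral_sfinite_kernel _ _ _ _ R phi (kprobability mkappa)) => // t.
  by rewrite lee_fin sqr_ge0.
rewrite !(ge0_integral_disintegration mkappa muE)//=; last 4 first.
- apply/measurable_EFinP; have := msq meta.
  by under eq_fun do rewrite -sqrrN opprB.
- by move=> t; rewrite lee_fin sqr_ge0.
- by apply/measurable_EFinP; exact: msq.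
- by move=> t; rewrite lee_fin sqr_ge0.
rewrite -ge0_integralD//; last 3 first.
- by move=> x _; rewrite lee_fin sqr_ge0.
- by apply/measurable_EFinP; apply: measurable_funX; exact: measurable_funB.
- by move=> x _; exact: bayes_ge0.
apply: eq_integral => x _.
rewrite (eq_integral (fun y : R => ((y - g x) ^+ 2)%:E)); last first.
  by move=> y _; rewrite -sqrrN opprB.
rewrite (second_moment (mean0 x) (var_le x)) addeC; congr (_%:E + _)%E.
by rewrite -sqrrN opprB.
Qed.

Lemma integral_noise_le : (\int[mu]_t ((t.2 - eta t.1) ^+ 2)%:E <= Ca%:E)%E.
Proof.
have meta := measurable_eta.
rewrite (ge0_integral_disintegration mkappa muE)//=; last 2 first.
- apply/measurable_EFinP; have := msq meta.
  by under eq_fun do rewrite -sqrrN opprB.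
- by move=> t; rewrite lee_fin sqr_ge0.
rewrite -[leRHS](prob_integral_cst PX); apply: le_integral_ge0 => x; [exact: bayes_ge0|exact: bayes_le].
Qed.

(** The source of the conditional second moment bound for the nearest-neighbour average: the weight
    leaves the inner integral, where variance plus squared bias is at most Ca + B. *)
Lemma cond_sqr_le (w : A * R -> R) (c : R) (B : A -> R) :
  measurable_fun [set: pairT A (realT R)] w -> (forall t, 0 <= w t) ->
  (forall x y y', w (x, y) = w (x, y')) ->
  measurable_fun setT B -> (forall x, (eta x - c) ^+ 2 <= B x) ->
  (\int[mu]_t (w t * (t.2 - c) ^+ 2)%:E <= \int[mu]_t (w t * (Ca + B t.1))%:E)%E.
Proof.
move=> mw w0 wx mB etaB.
have B0 x : 0 <= B x by exact: le_trans (sqr_ge0 _) (etaB x).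
have Ca0 (x : A) : 0 <= Ca by rewrite -lee_fin; exact: le_trans (bayes_ge0 x) (bayes_le x).
rewrite !(ge0_integral_disintegration mkappa muE)//=; last 4 first.
- apply/measurable_EFinP; apply: measurable_funM => //.
  apply: measurable_funD; first exact: measurable_cst.
  exact: measurableT_comp mB measurable_fst.
- by move=> [x y]; rewrite lee_fin mulr_ge0// addr_ge0//; exact: Ca0 x.
- apply/measurable_EFinP; apply: measurable_funM => //.
  exact: measurableT_comp (m2 c) measurable_snd.
- by move=> t; rewrite lee_fin mulr_ge0// sqr_ge0.
apply: le_integral_ge0 => x.
  by apply: integral_ge0 => y _; rewrite lee_fin mulr_ge0// sqr_ge0.
rewrite (eq_integral (fun y : realT R => ((w (x, 0))%:E * (((y : R) - c) ^+ 2)%:E)%E)); last first.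
  by move=> y _; rewrite -EFinM (wx x y 0).
rewrite ge0_integralZl//; last 3 first.
- exact/measurable_EFinP.
- by move=> y _; rewrite lee_fin sqr_ge0.
- by rewrite lee_fin.
rewrite [leRHS](eq_integral (fun=> (w (x, 0) * (Ca + B x))%:E)); last first.
  by move=> y _; rewrite (wx x y 0).
rewrite [leRHS]prob_integral_cst EFinM lee_wpmul2l ?lee_fin//.
rewrite (second_moment (mean0 x) (var_le x)) EFinD leeD//; last by rewrite lee_fin.
exact: bayes_le.
Qed.

End regression_kernel.

(** * Rates *)

Section rates.
Context {R : realType}.
Implicit Types (beta s z : R) (N : nat).

(* min (1, z ^ - s), with the value 1 also at z = 0 (where powR gives 0). *)
Definition cutpow s z : R := if z < 1 then 1 else z `^ (- s).

Lemma cutpow_ge0 s z : 0 <= cutpow s z.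
Proof. by rewrite /cutpow; case: ifP => // _; rewrite powR_ge0. Qed.

Lemma cutpow_le1 s z : 0 <= s -> cutpow s z <= 1.
Proof.
move=> s0; rewrite /cutpow; case: ltP => // z1.
by rewrite -[leRHS](powRr0 z) ler_powR// oppr_le0.
Qed.

Lemma powRN_le s z1 z2 : 0 <= s -> 0 < z1 -> z1 <= z2 -> z2 `^ (- s) <= z1 `^ (- s).
Proof.
move=> s0 z10 z12; have z20 := lt_le_trans z10 z12.
by rewrite !powRN lef_pV2 ?posrE ?powR_gt0// ge0_ler_powR ?nnegrE ?(ltW z10) ?(ltW z20).
Qed.

Let powXC (x s : R) J : 0 <= x -> (x `^ s) ^+ J = (x ^+ J) `^ s.
Proof. by move=> x0; rewrite -(powR_mulrn J (powR_ge0 x s)) -(powR_mulrn J x0) -!powRrM mulrC. Qed.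

Let pow2_gt1 r : 0 < r -> 1 < 2 `^ r :> R.
Proof. by move=> r0; have := @gt0_ltr_powR R r r0 1 2; rewrite powR1; apply; rewrite ?nnegrE// ltr1n. Qed.

(** For 2^j <= z < 2^(j+1) the power is at most 2^(-s j), and the last term covers z >= 2^J. In the
    induction, when z < 2^(J+1) the old remainder becomes the new term of the sum. *)
Lemma cutpow_dyadic s z J : 0 < s ->
  cutpow s z <= (z < 1)%R%:R + \sum_(j < J) (2 `^ (- s)) ^+ j * (z < 2 ^+ j.+1)%R%:R
    + (2 `^ (- s)) ^+ J.
Proof.
move=> s0.
have S0 J' : 0 <= (z < 1)%R%:R + \sum_(j < J') (2 `^ (- s)) ^+ j * (z < 2 ^+ j.+1)%R%:R :> R.
  by rewrite addr_ge0// sumr_ge0// => j _; rewrite mulr_ge0// exprn_ge0// ltW.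
elim: J => [|J IH].
  by rewrite expr0 (le_trans (cutpow_le1 _ (ltW s0)))// lerDr.
have [zJ|zJ] := ltP z (2 ^+ J.+1).
  apply: (le_trans IH); rewrite big_ord_recr/= zJ mulr1 addrA.
  by rewrite lerDl exprn_ge0// ltW.
apply: ler_wpDl; first exact: S0.
have z1 : 1 <= z by rewrite (le_trans _ zJ)// exprn_ege1// ler1n.
by rewrite /cutpow ltNge z1/= powXC// powRN_le ?(ltW s0)// exprn_gt0.
Qed.

Lemma knn_rate_ge0 beta s N : (0 < N)%N -> 0 <= knn_rate beta s N.
Proof.
move=> N0; rewrite /knn_rate; case: ifP => _; last exact: powR_ge0.
by rewrite mulr_ge0 ?powR_ge0// ln_ge0// ler1n.
Qed.

Let ln2 : 0 < ln (2 : R). Proof. by rewrite ln_gt0// ltr1n. Qed.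

Let lnN N : (1 < N)%N -> ln (2 : R) <= ln N%:R.
Proof. by move=> N1; rewrite ler_ln ?posrE ?ltr0n ?ler_nat// ltnW. Qed.

(** One constant for both cases of the rate: with the logarithm, ln N >= ln 2 for N >= 2. *)
Lemma powN_le_rate beta s N : (1 < N)%N ->
  N%:R `^ (- beta) <= (1 + (ln 2)^-1) * knn_rate beta s N.
Proof.
move=> N1; have N0 : 1 <= N%:R :> R by rewrite ler1n ltnW.
rewrite /knn_rate; case: eqP => [_|_].
  have h : 1 <= (ln 2)^-1 * ln N%:R :> R by rewrite mulrC ler_pdivlMr// mul1r lnN.
  rewrite mulrDl mul1r ler_wpDl//; first by rewrite mulr_ge0// ln_ge0.
  by rewrite mulrCA ler_peMr.
have le : N%:R `^ (- beta) <= N%:R `^ (- Num.min beta s) :> R.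
  by rewrite ler_powR// lerN2 ge_min lexx.
by rewrite mulrDl mul1r ler_wpDr// mulr_ge0 ?powR_ge0// invr_ge0 ltW.
Qed.

(** The exponents compare directly except for s < beta = s', where the logarithm of the faster rate
    must be absorbed. *)
Lemma knn_rate_mono beta s s' : s <= s' -> exists2 C : R, 0 < C &
  forall N, (1 < N)%N -> knn_rate beta s' N <= C * knn_rate beta s N.
Proof.
have C0 : 0 < 1 + (ln (2 : R))^-1 by rewrite addr_gt0// invr_gt0.
rewrite le_eqVlt => /orP[/eqP ->|ss'].
  by exists 1 => // N _; rewrite mul1r.
have [sb|sb|e] := ltgtP beta s.
- exists (1 + (ln 2)^-1) => // N N1; apply: le_trans (powN_le_rate beta s N1).
  by rewrite /knn_rate lt_eqF ?(lt_trans sb)// min_l ?(ltW (lt_trans sb ss')).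
- have -> : knn_rate beta s = fun N => N%:R `^ (- s).
    by apply/funext => N; rewrite /knn_rate gt_eqF// min_r// ltW.
  have [bs'|bs'] := eqVneq beta s'; last first.
    exists 1 => // N N1; rewrite mul1r /knn_rate (negbTE bs').
    by rewrite ler_powR ?ler1n ?(ltnW N1)// lerN2 le_min (ltW sb) (ltW ss').
  (* ln y <= y - 1 with y = N^(beta - s) gives N^-beta ln N <= N^-s / (beta - s). *)
  exists (beta - s)^-1; first by rewrite invr_gt0 subr_gt0.
  move=> N N1; rewrite /knn_rate bs' eqxx -bs'.
  have N0 : 0 < N%:R :> R by rewrite ltr0n ltnW.
  have bs0 : 0 < beta - s by rewrite subr_gt0.
  rewrite ler_pdivlMl//.
  have -> : N%:R `^ (- s) = N%:R `^ (- beta) * N%:R `^ (beta - s) :> R.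
    by rewrite -powRD ?(gt_eqF N0) ?implybT//; congr (_ `^ _); ring.
  rewrite mulrCA ler_wpM2l ?powR_ge0// -ln_powR.
  have := expR_ge1Dx (ln (N%:R `^ (beta - s))); rewrite lnK ?posrE ?powR_gt0//; lra.
- exists (1 + (ln 2)^-1) => // N N1; apply: le_trans (powN_le_rate beta s N1).
  by rewrite /knn_rate -e in ss' *; rewrite lt_eqF// min_l// ltW.
Qed.

Section tail.
Context {d} {T : measurableType d} (P : probability T R).
Variables (Z : T -> R) (C beta s : R).
Hypotheses (mZ : measurable_fun setT Z) (C0 : 0 <= C) (s0 : 0 < s).
Hypothesis tail : forall t, 0 < t -> (P [set w | (Z w < t)%R] <= (C * t `^ beta)%:E)%E.

Let q : R := 2 `^ (- s).
Let b : R := 2 `^ beta.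

(** The tail at t = 2^(j+1) / N turns the dyadic sum into a geometric one of ratio q b = 2^(beta -
    s). *)
Let integral_cutpow_sum N J : (0 < N)%N ->
  (\int[P]_w (cutpow s (N%:R * Z w))%:E <=
   (C * N%:R `^ (- beta) * (1 + b * \sum_(j < J) (q * b) ^+ j) + q ^+ J)%:E)%E.
Proof.
move=> N0; have NR0 : 0 < N%:R :> R by rewrite ltr0n.
have q0 : 0 < q by rewrite powR_gt0.
have mlt c : measurable_fun setT (fun w => N%:R * Z w < c).
  apply: measurable_fun_ltr; last exact: measurable_cst.
  by apply: measurable_funM => //; exact: measurable_cst.
have mltR c : measurable_fun setT (fun w => (N%:R * Z w < c)%R%:R : R).
  exact: (measurable_boolfun (fun c : bool => c%:R : R) (mlt c)).
have Plt c : 0 < c -> (\int[P]_w ((N%:R * Z w < c)%R%:R)%:E <= (C * N%:R `^ (- beta) * c `^ beta)%:E)%E.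
  move=> c0; rewrite integral_bool//.
  have -> : [set w | N%:R * Z w < c] = [set w | Z w < c / N%:R].
    by apply/seteqP; split => w /=; rewrite ltr_pdivlMr// mulrC.
  apply: (le_trans (tail _)); first by rewrite divr_gt0.
  rewrite powRM ?invr_ge0 ?(ltW c0) ?(ltW NR0)// -[N%:R^-1]powR_inv1 ?(ltW NR0)//.
  by rewrite -powRrM mulN1r -mulrA [_ `^ (- beta) * _]mulrC.
apply: (@le_trans _ _ (\int[P]_w (((N%:R * Z w < 1)%R%:R)%:E +
    (\sum_(j < J) ((q ^+ j)%:E * ((N%:R * Z w < 2 ^+ j.+1)%R%:R)%:E)) + (q ^+ J)%:E))%E).
  apply: le_integral_ge0 => w; first by rewrite lee_fin cutpow_ge0.
  under eq_bigr do rewrite -EFinM.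
  by rewrite sumEFin -!EFinD lee_fin cutpow_dyadic.
have mterm j : measurable_fun setT (fun w => ((q ^+ j)%:E * ((N%:R * Z w < 2 ^+ j.+1)%R%:R)%:E)%E).
  by apply: measurable_funeM; apply/measurable_EFinP; exact: mltR.
have term0 j w : (0 <= ((q ^+ j)%:E * ((N%:R * Z w < 2 ^+ j.+1)%R%:R)%:E))%E.
  by rewrite -EFinM lee_fin mulr_ge0// exprn_ge0// ltW.
rewrite ge0_integralD//; last 3 first.
- by move=> w _; rewrite adde_ge0// ?lee_fin//; apply: sume_ge0.
- apply: emeasurable_funD; first by apply/measurable_EFinP; exact: mltR.
  exact: emeasurable_sum.
- by move=> w _; rewrite lee_fin exprn_ge0// ltW.
rewrite prob_integral_cst EFinD leeD//.
rewrite ge0_integralD//; last 3 first.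
- by apply/measurable_EFinP; exact: mltR.
- by move=> w _; apply: sume_ge0.
- exact: emeasurable_sum.
rewrite mulrDr mulr1 EFinD leeD//.
  by have := Plt 1 ltr01; rewrite powR1 mulr1.
rewrite ge0_integral_sum//.
apply: (@le_trans _ _ (\sum_(j < J) (q ^+ j * (C * N%:R `^ (- beta) * b ^+ j.+1))%:E)%E).
  apply: lee_sum => j _; rewrite ge0_integralZl//; last 2 first.
  - by apply/measurable_EFinP; exact: mltR.
  - by rewrite lee_fin exprn_ge0// ltW.
  rewrite EFinM lee_wpmul2l ?lee_fin ?exprn_ge0 ?(ltW q0)//.
  apply: (le_trans (Plt _ _)); first by rewrite exprn_gt0.
  by rewrite /b powXC.
rewrite sumEFin lee_fin le_eqVlt; apply/orP; left; apply/eqP.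
rewrite !mulr_sumr; apply: eq_bigr => j _.
by rewrite exprMn exprS; ring.
Qed.

(** [J N] is the first J with 2^J > N, so the remainder is at most N^-s. The geometric sum stays
    bounded if beta < s, is of order N^(beta - s) if beta > s, and has about log N equal terms at
    equality: this is the logarithm of the rate. *)
Lemma integral_cutpow : exists2 C' : R, 0 <= C' & forall N, (1 < N)%N ->
  (\int[P]_w (cutpow s (N%:R * Z w))%:E <= (C' * knn_rate beta s N)%:E)%E.
Proof.
have q0 : 0 < q by rewrite powR_gt0.
have b0 : 0 < b by rewrite powR_gt0.
pose J N := (trunc_log 2 N).+1.
have qJ N : (1 < N)%N -> q ^+ J N <= N%:R `^ (- s).
  move=> N1; rewrite /q powXC//.
  rewrite powRN_le ?(ltW s0) ?ltr0n ?(ltnW N1)// -natrX ler_nat ltnW//.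
  exact: trunc_log_ltn.
have qb : q * b = 2 `^ (beta - s).
  by rewrite -powRD ?pnatr_eq0 ?implybT//; congr (_ `^ _); ring.
have D0 : 0 < 1 + (ln (2 : R))^-1 by rewrite addr_gt0// invr_gt0.
have [bs|sb|e] := ltgtP beta s.
- have qb1 : 0 < 1 - q * b.
    by rewrite subr_gt0 qb -opprB powRN invf_lt1 ?powR_gt0// pow2_gt1// subr_gt0.
  exists ((C * (1 + b / (1 - q * b)) + 1) * (1 + (ln 2)^-1)).
    by rewrite mulr_ge0 ?(ltW D0)// addr_ge0// mulr_ge0// addr_ge0// divr_ge0 ?(ltW b0) ?(ltW qb1).
  move=> N N1; apply: (le_trans (integral_cutpow_sum (J N) (ltnW N1))); rewrite lee_fin.
  have := powN_le_rate beta s N1; have := powR_ge0 N%:R (- beta).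
  have : q ^+ J N <= N%:R `^ (- beta).
    apply: (le_trans (qJ N N1)).
    by rewrite ler_powR ?ler1n ?(ltnW N1)// lerN2 ltW.
  have : \sum_(j < J N) (q * b) ^+ j <= (1 - q * b)^-1.
    rewrite -[leRHS]mul1r ler_pdivlMr// mulrC -opprB mulNr -subrX1 opprB.
    by rewrite gerBl exprn_ge0// mulr_ge0 ?(ltW q0) ?(ltW b0).
  set S := \sum_(j < _) _; set n := N%:R `^ _; set rate := knn_rate _ _ _; set m := (1 - _)^-1; set l := (ln 2)^-1.
  move=> Sm qn n0 nr.
  apply: (@le_trans _ _ ((C * (1 + b * m) + 1) * n)).
    rewrite mulrDl mul1r lerD//.
    rewrite mulrAC ler_wpM2r// ler_wpM2l// lerD2l ler_wpM2l// ltW//.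
  rewrite -mulrA ler_wpM2l// addr_ge0// mulr_ge0// addr_ge0// mulr_ge0 ?(ltW b0)//.
  by rewrite invr_ge0 ltW.
- have r1 : 1 < q * b by rewrite qb pow2_gt1// subr_gt0.
  have r0 : 0 < q * b - 1 by rewrite subr_gt0.
  exists (C * (1 + b * (q * b / (q * b - 1))) + 1).
    by rewrite addr_ge0// mulr_ge0// addr_ge0// !mulr_ge0 ?invr_ge0 ?(ltW b0) ?(ltW r0) ?(ltW q0).
  move=> N N1; apply: (le_trans (integral_cutpow_sum (J N) (ltnW N1))); rewrite lee_fin.
  have N0 : 0 < N%:R :> R by rewrite ltr0n ltnW.
  have -> : knn_rate beta s N = N%:R `^ (- s).
    by rewrite /knn_rate gt_eqF// min_r// ltW.
  have nb : N%:R `^ (- beta) * N%:R `^ (beta - s) = N%:R `^ (- s) :> R.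
    by rewrite -powRD ?(gt_eqF N0) ?implybT//; congr (_ `^ _); ring.
  have nb1 : 1 <= N%:R `^ (beta - s) :> R.
    by rewrite -[leLHS](powRr0 N%:R) ler_powR ?ler1n ?(ltnW N1)// subr_ge0 ltW.
  (* 2^J is at most 2 N, by minimality of J. *)
  have rJ : (q * b) ^+ J N <= q * b * N%:R `^ (beta - s).
    rewrite qb powXC// -powRM ?(ltW N0)// ge0_ler_powR ?nnegrE ?subr_ge0 ?(ltW sb)//.
      by rewrite exprS ler_wpM2l// -natrX ler_nat trunc_logP// ltnW.
  have S_le : \sum_(j < J N) (q * b) ^+ j <= q * b / (q * b - 1) * N%:R `^ (beta - s).
    rewrite mulrAC ler_pdivlMr// mulrC -subrX1.
    by rewrite (le_trans _ rJ)// gerBl.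
  have := qJ N N1; have n0 := powR_ge0 N%:R (- beta).
  rewrite -nb; move: S_le nb1 n0.
  set S := \sum_(j < _) _; set n := N%:R `^ (- beta); set e := N%:R `^ _; set c := _ / _.
  move=> Sm e1 n0 qn.
  rewrite mulrDl mul1r lerD//.
  apply: (@le_trans _ _ (C * n * (e + b * (c * e)))).
    by rewrite ler_wpM2l ?mulr_ge0// lerD// ler_wpM2l// ltW.
  by rewrite le_eqVlt; apply/orP; left; apply/eqP; ring.
- have qb1 : q * b = 1 by rewrite qb e subrr powRr0.
  exists ((C * (1 + b * 2) + 1) / ln 2).
    by rewrite mulr_ge0 ?invr_ge0 ?(ltW ln2)// addr_ge0// mulr_ge0// addr_ge0// mulr_ge0// ltW.
  move=> N N1; apply: (le_trans (integral_cutpow_sum (J N) (ltnW N1))); rewrite lee_fin.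
  have N0 : 0 < N%:R :> R by rewrite ltr0n ltnW.
  rewrite /knn_rate e eqxx.
  have := qJ N N1; have := powR_ge0 N%:R (- s).
  rewrite (eq_bigr (fun=> 1)) => [|j _]; last by rewrite qb1 expr1n.
  rewrite sumr_const card_ord.
  have tl : (trunc_log 2 N)%:R * ln 2 <= ln N%:R :> R.
    rewrite mulr_natl -lnXn// ler_ln ?posrE ?exprn_gt0//.
    by rewrite -natrX ler_nat trunc_logP// ltnW.
  have l2 := lnN N1.
  have JN : (J N)%:R * ln 2 <= 2 * ln N%:R :> R.
    by rewrite /J -natr1 mulrDl mul1r; lra.
  set n := N%:R `^ _ => n0 qn.
  have L1 : 1 <= ln N%:R / ln 2 :> R by rewrite ler_pdivlMr// mul1r.
  have JN' : (J N)%:R <= 2 * (ln N%:R / ln 2) :> R by rewrite mulrA ler_pdivlMr.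
  have -> : (C * (1 + b * 2) + 1) / ln 2 * (n * ln N%:R) =
     C * n * (ln N%:R / ln 2 + b * (2 * (ln N%:R / ln 2))) + n * (ln N%:R / ln 2) by ring.
  apply: lerD; last by apply: (le_trans qn); rewrite ler_peMr.
  by rewrite ler_wpM2l ?mulr_ge0// lerD// ler_wpM2l// ltW.
Qed.

End tail.

End rates.

(** * Error at a fixed test point *)

Section fixed_point.
Context {R : realType} {dT} {T : measurableType dT} {S : Type}.
Variables (mu : probability T R) (pi : T -> S) (d : nat) (d0 : (0 < d)%N).
Variables (K q A c1 D C1 C2 CB : R) (n0 : nat).
Hypotheses (K0 : 0 < K) (q0 : 0 < q) (q1 : q < 1) (A0 : 0 < A) (c10 : 0 < c1) (D0 : 0 < D).
Hypotheses (C10 : 0 <= C1) (C20 : 0 <= C2) (CB0 : 0 <= CB).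

Lemma cutpow_scale s c z w : 0 <= s -> 0 < c -> 0 <= z -> c * z <= w ->
  cutpow s w <= (1 + c `^ (- s)) * cutpow s z :> R.
Proof.
move=> s0 c0 z0 czw.
have cs0 : 0 <= c `^ (- s) by exact: powR_ge0.
have [z1|z1] := ltP z 1.
  by rewrite [in leRHS]/cutpow z1 mulr1 (le_trans (cutpow_le1 _ s0))// lerDl.
have zp : 0 < z by exact: lt_le_trans z1.
apply: (@le_trans _ _ (c `^ (- s) * cutpow s z)); last first.
  by rewrite mulrDl mul1r lerDr cutpow_ge0.
have cz0 : 0 < c * z by rewrite mulr_gt0.
rewrite [in leRHS]/cutpow ltNge z1/= -powRM ?(ltW c0) ?(ltW zp)//.
rewrite /cutpow; case: ltP => w1; last exact: powRN_le.
have cz1 : c * z <= 1 by rewrite (le_trans czw)// ltW.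
by have := powRN_le s0 cz0 cz1; rewrite powR1.
Qed.

(** [c3] is the threshold of [prob_cnt_le_knum]. [r0] stays below both A and D, so the mass bound at
    [r0] gives the ball of radius A mass at least [c2] times the density, and [k0] solves c1 k0^d =
    c3. *)
Let c3 : R := 2 * (2 `^ q * K + 1).
Let c30 : 0 < c3. Proof. by rewrite mulr_gt0// addr_gt0// mulr_gt0// powR_gt0. Qed.
Let r0 : R := Num.min A (D / 2).
Let r00 : 0 < r0. Proof. by rewrite lt_min A0 divr_gt0. Qed.
Let r0A : r0 <= A. Proof. by rewrite ge_min lexx. Qed.
Let r0D : r0 < D.
Proof.
by apply: (@le_lt_trans _ _ (D / 2)); [rewrite ge_min lexx orbT|move: D0; lra].
Qed.
Let c2 : R := c1 * r0 ^+ d.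
Let c20 : 0 < c2. Proof. by rewrite mulr_gt0// exprn_gt0. Qed.
Let s : R := 4 / d%:R * (1 - q).
Let k0 : R := (c3 / c1) `^ (d%:R^-1).
Let k00 : 0 < k0. Proof. by rewrite powR_gt0// divr_gt0. Qed.
Let dR0 : 0 < d%:R :> R. Proof. by rewrite ltr0n. Qed.

(** The constants are chosen before N, the test point and its density, so that the bound can be
    integrated over test points. M is left out of them because it grows with the test point. *)
Lemma fixed_point_bound : exists CC c4 : R, [/\ 0 <= CC, 0 < c4 &
  forall (N : nat) (Q : probability (rowT T N) R) (rho a : T -> R) (fx M : R),
  (n0.+2 <= N)%N ->
  (forall E : 'I_N -> set T, (forall i, measurable (E i)) ->
    Q (box E) = (\prod_i mu (E i))%E) ->
  measurable_fun setT rho -> measurable_fun setT a -> (forall t, 0 <= rho t) ->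
  (forall t t', pi t = pi t' -> rho t = rho t') ->
  (forall w : T -> R, measurable_fun setT w ->
    (forall t, 0 <= w t) -> (forall t t', pi t = pi t' -> w t = w t') ->
    (\int[mu]_t (w t * a t ^+ 2)%:E <= \int[mu]_t (w t * (C1 + C2 * rho t ^+ 2))%:E)%E) ->
  mu.-integrable setT (EFin \o a) ->
  (forall o (r : R), 0 <= r ->
  (`|\int[mu]_t ((inball rho o r t)%:R * a t)%:E|
     <= (CB * r ^+ 2)%:E * mu [set t | inball rho o r t])%E) ->
  (forall n, (n <= knum K q n)%N -> (n <= n0)%N /\ ((knum K q n).*2 <= N)%N) ->
  (\int[mu]_t (rho t ^+ 2)%:E <= M%:E)%E ->
  0 < fx ->
  (forall r, 0 < r < D -> c1 * fx * r ^+ d <= fine (mu [set t | rho t <= r])) ->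
  (\int[Q]_v (nn_mean rho a (knum K q) A v ^+ 2)%:E <=
    (CC * (cutpow q (N%:R * fx) +
       cutpow s (N%:R * (fx / fine (mu [set t | rho t <= A]) `^ q) `^ (1 - q)^-1)) +
     (C1 + 2 * C2 * M) * (n0.+2%:R * expR (- (c4 * N%:R * fx))))%:E)%E].
Proof.
pose Ck : R := 4 + 2 `^ q / K.
have A0' := ltW A0; have r00' := ltW r00; have k00' := ltW k00.
have Ck4 : 4 <= Ck by rewrite lerDl divr_ge0 ?powR_ge0// ltW.
pose C := C1 + C2 * A ^+ 2.
have C0 : 0 <= C by rewrite addr_ge0// mulr_ge0// sqr_ge0.
have A40 : 0 <= A ^+ 4 by rewrite exprn_ge0// ltW.
(* [Cv] gathers the variance and the probability that the chosen radius holds too few samples; [Cr]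
   is the bias at that radius. *)
pose Cv := (C * Ck + CB ^+ 2 * (3 * A ^+ 4)) * (1 + c2 `^ (- q)).
pose Cr := CB ^+ 2 * ((1 + 2 * (A / r0) ^+ 4) * (r0 ^+ 4 + k0 ^+ 4)).
have Cv0 : 0 <= Cv.
  rewrite mulr_ge0// addr_ge0 ?powR_ge0 ?mulr_ge0 ?sqr_ge0//.
  by rewrite (le_trans _ Ck4).
have Cr0 : 0 <= Cr.
  apply: mulr_ge0; first exact: sqr_ge0.
  apply: mulr_ge0; last by rewrite addr_ge0// exprn_ge0// ltW.
  by rewrite addr_ge0// mulr_ge0// exprn_ge0// divr_ge0 ?(ltW A0) ?(ltW r00).
exists (Cv + Cr); exists (c2 / (2 * n0.+2%:R)); split; first exact: addr_ge0.
  by rewrite divr_gt0// mulr_gt0.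
move=> N Q rho a fx M n0N Qbox mrho ma rho0 pi_rho cond_var ia bias few rho2M fx0 mass.
pose p r := fine (mu [set t | rho t <= r]).
have mb r : measurable_fun setT (fun t => rho t <= r).
  by apply: measurable_fun_ler => //; exact: measurable_cst.
have ple r r' : r <= r' -> p r <= p r'.
  move=> rr'; rewrite fine_le ?fin_num_measure//; try exact: measurable_set_bool.
  rewrite le_measure ?inE//; try exact: measurable_set_bool.
  by move=> t /= h; exact: le_trans rr'.
have pA : c2 * fx <= p A.
  apply: le_trans (ple _ _ r0A); apply: le_trans (mass r0 _); last by rewrite r00 r0D.
  by rewrite /c2 mulrAC.
have pA0 : 0 < p A by rewrite (lt_le_trans _ pA)// mulr_gt0.
pose u := N%:R * p A.
have NR0 : 0 < N%:R :> R by rewrite ltr0n (leq_trans _ n0N).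
have few' n : (n <= N)%N -> (n <= knum K q n)%N -> (n <= n0)%N /\ ((knum K q n).*2 <= N)%N.
  by move=> _; exact: few.
have bound r := nn_mean_bound Qbox mrho ma rho0 pi_rho C10 C20 CB0 cond_var
  (@knum_gt0 R K q) (ltW A0) (r := r) ia bias few' rho2M.
pose W := fx / p A `^ q.
have W0 : 0 < W by rewrite divr_gt0// powR_gt0.
pose z := N%:R * W `^ (1 - q)^-1.
have z0 : 0 < z by rewrite mulr_gt0// powR_gt0.
have cu : cutpow q u <= (1 + c2 `^ (- q)) * cutpow q (N%:R * fx).
  apply: cutpow_scale => //; rewrite ?(ltW q0) ?mulr_ge0 ?(ltW fx0)//.
  by rewrite mulrCA ler_wpM2l// ltW.
have invk : (\int[Q]_v ((nn_number rho (knum K q) A v)%:R^-1)%:E <= (Ck * cutpow q u)%:E)%E.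
  rewrite /cutpow; case: ltP => u1; last exact: (integral_inv_knum Qbox (mb A) K0 q0 q1 u1).
  rewrite mulr1 -[leRHS](prob_integral_cst Q); apply: le_integral_ge0 => v; rewrite lee_fin.
    by rewrite invr_ge0.
  apply: (@le_trans _ _ 1); first by rewrite invf_le1 ?ltr0n// ler1n.
  by apply: le_trans Ck4; rewrite ler1n.
(* c1 fx rs^d = c3 u^q / N, so that the ball of radius rs holds more than k samples
   with high probability. *)
pose rs := k0 * z `^ (- ((1 - q) / d%:R)).
have rs0 : 0 < rs by rewrite mulr_gt0// powR_gt0.
have rs4 : rs ^+ 4 = k0 ^+ 4 * z `^ (- s).
  rewrite exprMn; congr (_ * _); rewrite -powR_mulrn ?powR_ge0// -powRrM; congr (_ `^ _).
  by rewrite /s; field; rewrite gt_eqF.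
have rsd : c1 * fx * rs ^+ d = c3 * u `^ q / N%:R.
  have q1' : 1 - q != 0 by rewrite subr_eq0 gt_eqF.
  have k0d : k0 ^+ d = c3 / c1.
    rewrite -(powR_mulrn d k00') -powRrM mulVf ?gt_eqF// powRr1// ltW// divr_gt0//.
  have zd : (z `^ (- ((1 - q) / d%:R))) ^+ d = z `^ (- (1 - q)).
    rewrite -(powR_mulrn d (powR_ge0 _ _)) -powRrM; congr (_ `^ _).
    by field; rewrite gt_eqF.
  have zW : z `^ (- (1 - q)) = N%:R `^ q / N%:R / W.
    rewrite /z powRM ?(ltW NR0) ?powR_ge0// -powRrM mulrN mulVf// powR_inv1 ?(ltW W0)//.
    by rewrite opprB powRB ?(gt_eqF NR0) ?implybT// powRr1// ltW.
  rewrite /rs exprMn k0d zd zW /W /u powRM ?(ltW NR0) ?(ltW pA0)//.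
  by field; rewrite !gt_eqF// powR_gt0.
have rs0' := ltW rs0.
have min0 : 0 <= Num.min rs r0 by rewrite le_min rs0' r00'.
have minl : Num.min rs r0 <= rs by rewrite ge_min lexx.
have minr : Num.min rs r0 <= r0 by rewrite ge_min lexx orbT.
(* For z < 1 the radius [rs] can be arbitrarily large, and the cap [r0] keeps the bound finite. *)
have rs_min : Num.min rs r0 ^+ 4 <= (r0 ^+ 4 + k0 ^+ 4) * cutpow s z.
  rewrite /cutpow; case: ltP => z1.
    rewrite mulr1 (@le_trans _ _ (r0 ^+ 4))//; last by rewrite lerDl exprn_ge0// ltW.
    by rewrite lerXn2r ?nnegrE.
  rewrite mulrDl (@le_trans _ _ (rs ^+ 4))//.
    by rewrite lerXn2r ?nnegrE.
  by rewrite rs4 lerDr mulr_ge0 ?powR_ge0// exprn_ge0// ltW.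
have Q1 (B : set (rowT T N)) : measurable B -> (Q B <= 1)%E by move=> mB; exact: probability_le1.
have mk r : measurable [set v : rowT T N | (ncount (dist_row rho v) r <= nn_number rho (knum K q) A v)%N].
  apply: measurable_set_bool; apply: measurable_fun_leq; first exact: measurable_ncount.
  exact: measurable_nn_number.
(* If u < 1 the cut power is 1 and r = A suffices. If rs >= r0, again r = A, and A^4 is paid as (A /
   r0)^4 r0^4. Only for rs < r0 < D is the mass bound applicable at r = rs. *)
have biasterm : exists r, 0 <= r /\
  ((r ^+ 4)%:E + (A ^+ 4)%:E * Q [set v | (ncount (dist_row rho v) r <= nn_number rho (knum K q) A v)%N]
   <= (3 * A ^+ 4 * cutpow q u + (1 + 2 * (A / r0) ^+ 4) * Num.min rs r0 ^+ 4)%:E)%E.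
  have m0 : 0 <= Num.min rs r0 ^+ 4 by rewrite exprn_ge0// le_min !ltW.
  have x0 : 0 <= (A / r0) ^+ 4 by rewrite exprn_ge0// divr_ge0 ?(ltW A0) ?(ltW r00).
  have cp := cutpow_ge0 q u.
  have triv : (((A ^+ 4)%:E + (A ^+ 4)%:E * Q [set v | (ncount (dist_row rho v) A <= nn_number rho (knum K q) A v)%N]) <= (2 * A ^+ 4)%:E)%E.
    rewrite (_ : 2 * A ^+ 4 = A ^+ 4 + A ^+ 4); last by ring.
    by rewrite EFinD leeD// -[leRHS]mule1 lee_wpmul2l ?lee_fin// Q1.
  have [u1|u1] := ltP u 1.
    exists A; split; first exact: ltW.
    apply: (le_trans triv); rewrite lee_fin /cutpow u1 mulr1.
    have : 0 <= (1 + 2 * (A / r0) ^+ 4) * Num.min rs r0 ^+ 4 by rewrite mulr_ge0// addr_ge0// mulr_ge0.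
    lra.
  have [rsr0|r0rs] := ltP rs r0; last first.
    exists A; split; first exact: ltW.
    apply: (le_trans triv); rewrite lee_fin.
    have -> : (1 + 2 * (A / r0) ^+ 4) * r0 ^+ 4 = r0 ^+ 4 + 2 * A ^+ 4.
      by field; rewrite gt_eqF.
    have : 0 <= 3 * A ^+ 4 * cutpow q u by rewrite !mulr_ge0.
    have : 0 <= r0 ^+ 4 by rewrite exprn_ge0// ltW.
    lra.
  exists rs; split; first exact: ltW.
  have uw : c3 * u `^ q <= N%:R * p rs.
    have := mass rs; rewrite rs0 (lt_trans rsr0 r0D) rsd => /(_ isT).
    by rewrite ler_pdivrMr// [_ * N%:R]mulrC.
  have := prob_cnt_le_knum Qbox (mb A) (mb rs) K0 q0 q1 u1 uw => Qle.
  apply: (@le_trans _ _ ((rs ^+ 4)%:E + (A ^+ 4)%:E * (3 * u `^ (- q))%:E)%E).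
    by rewrite leeD2l// lee_wpmul2l// lee_fin.
  rewrite -EFinM -EFinD lee_fin /cutpow ltNge u1/=.
  have : 0 <= 2 * (A / r0) ^+ 4 * rs ^+ 4 by apply: mulr_ge0; [exact: mulr_ge0|exact: exprn_ge0].
  have : A ^+ 4 * (3 * u `^ (- q)) = 3 * A ^+ 4 * u `^ (- q) by ring.
  lra.
have [r [rge0 rle]] := biasterm.
apply: (le_trans (bound r rge0)).
rewrite [leRHS]EFinD [leLHS]addeA; apply: leeD.
  apply: (@le_trans _ _ (C%:E * (Ck * cutpow q u)%:E + (CB ^+ 2)%:E *
     (3 * A ^+ 4 * cutpow q u + (1 + 2 * (A / r0) ^+ 4) * Num.min rs r0 ^+ 4)%:E)%E).
    by apply: leeD; rewrite lee_wpmul2l ?lee_fin// sqr_ge0.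
  rewrite -!EFinM -EFinD lee_fin.
  have -> : C * (Ck * cutpow q u) + CB ^+ 2 *
     (3 * A ^+ 4 * cutpow q u + (1 + 2 * (A / r0) ^+ 4) * Num.min rs r0 ^+ 4) =
     (C * Ck + CB ^+ 2 * (3 * A ^+ 4)) * cutpow q u +
     CB ^+ 2 * ((1 + 2 * (A / r0) ^+ 4) * Num.min rs r0 ^+ 4) by ring.
  rewrite -/(p A) -/W -/z.
  have c1' := cutpow_ge0 q (N%:R * fx); have c2' := cutpow_ge0 s z.
  apply: (@le_trans _ _ (Cv * cutpow q (N%:R * fx) + Cr * cutpow s z)); last first.
    by rewrite mulrDr !mulrDl; have := mulr_ge0 Cr0 c1'; have := mulr_ge0 Cv0 c2'; lra.
  apply: lerD.
    rewrite /Cv -mulrA ler_wpM2l// addr_ge0 ?mulr_ge0 ?sqr_ge0//.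
    by rewrite (le_trans _ Ck4).
  rewrite /Cr -[leRHS]mulrA ler_wpM2l ?sqr_ge0// -[leRHS]mulrA ler_wpM2l// addr_ge0// mulr_ge0// exprn_ge0//.
  by rewrite divr_ge0 ?(ltW A0) ?(ltW r00).
have M0 : 0 <= M.
  rewrite -lee_fin; apply: le_trans rho2M; apply: integral_ge0 => t _.
  by rewrite lee_fin sqr_ge0.
rewrite lee_fin ler_wpM2l ?addr_ge0 ?mulr_ge0// ler_wpM2l// ler_expR lerN2 -/(p A).
have m0 : 0 < n0.+2%:R :> R by rewrite ltr0n.
(* Since N >= n0 + 2, the integer quotient is at least half of the real one; this is the 2 in the
   exponential constant. *)
have divN : N%:R / (2 * n0.+2%:R) <= (N %/ n0.+2)%:R :> R.
  rewrite ler_pdivrMr ?mulr_gt0// -natrM -natrM ler_nat.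
  apply: (leq_trans (ltnW (ltn_ceil N (ltn0Sn n0.+1)))).
  by rewrite mulnA leq_mul// muln2 -addnn -add1n leq_add2r divn_gt0.
apply: (@le_trans _ _ (p A * (N%:R / (2 * n0.+2%:R)))); last first.
  by rewrite ler_wpM2l// ltW.
have -> : c2 / (2 * n0.+2%:R) * N%:R * fx = c2 * fx * (N%:R / (2 * n0.+2%:R)).
  by field; rewrite gt_eqF.
by rewrite ler_wpM2r// divr_ge0// mulr_ge0.
Qed.

End fixed_point.

Section integral_bool_lim.
Context {R : realType} {dT} {T : measurableType dT} (mu : probability T R) (a : T -> R).
Hypotheses (ma : measurable_fun setT a) (ia : mu.-integrable setT (EFin \o a)).

Lemma integral_bool_lim (h : nat -> T -> bool) (g : T -> bool) (c : \bar R) :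
  (forall m, measurable_fun setT (h m)) -> measurable_fun setT g ->
  (forall t, \forall m \near \oo, h m t = g t) ->
  (forall m, `|\int[mu]_t ((h m t)%:R * a t)%:E| <= c)%E ->
  (`|\int[mu]_t ((g t)%:R * a t)%:E| <= c)%E.
Proof.
move=> mh mg hg hc.
have mb (b : T -> bool) : measurable_fun setT b ->
    measurable_fun setT (fun t => ((b t)%:R * a t)%:E).
  move=> mb; apply/measurable_EFinP; apply: measurable_funM => //.
  exact: (measurable_boolfun (fun c : bool => c%:R : R)).
have [|||||_ _ cvg] := @dominated_convergence _ _ _ mu setT measurableT
  (fun m t => ((h m t)%:R * a t)%:E) (fun t => ((g t)%:R * a t)%:E) (abse \o EFin \o a).
- by move=> m; exact: mb.
- exact: mb.
- apply: aeW => t _; apply: cvg_near_cst.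
  by near=> m; rewrite (near (hg t) m).
- exact: integrable_abse.
- apply: aeW => t m _ /=; rewrite lee_fin normrM.
  by case: (h m t); rewrite ?normr1 ?mul1r// normr0 mul0r.
by apply: cvge_le (cvg_abse cvg); near=> m; exact: hc.
Unshelve. all: by end_near.
Qed.

End integral_bool_lim.

Section measurable_dist.
Context {R : realType} {d : nat} {dU} {U : measurableType dU}.
Variables (nrm : 'rV[R]_d -> R) (nrm_norm : is_norm nrm).
Local Notation V := (rowT (realT R) d).

Lemma measurable_dist (g h : U -> V) : measurable_fun setT g -> measurable_fun setT h ->
  measurable_fun setT (fun u => nrm (g u - h u)).
Proof.
move=> mg mh; apply: (measurableT_comp (measurable_is_norm nrm_norm)).
apply: measurable_fun_rVP => i; under eq_fun do rewrite !mxE.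
apply: measurable_funB.
  exact: (measurableT_comp (measurable_coord i) mg).
exact: (measurableT_comp (measurable_coord i) mh).
Qed.

End measurable_dist.

(** * The hypotheses of the fixed-point bound for regression data *)

Section regression_point.
Context {R : realType} {d : nat} (d0 : (0 < d)%N).
Local Notation V := (rowT (realT R) d).
Local Notation T := (pairT V (realT R)).
Variables (kappa : V -> pprobability (realT R) R) (mkappa : measurable_fun setT kappa).
Variables (PX : probability V R) (mu : probability T R).
Hypothesis muE : forall E F, measurable E -> measurable F ->
  mu (E `*` F) = (\int[PX]_(x in E) kappa x F)%E.
Variables (eta : V -> R) (Ca : R).
Hypothesis mean0 : forall x, ('E_(kappa x)[fun y => (y - eta x)%R] = 0)%E.
Hypothesis var_le : forall x, ('V_(kappa x)[idfun] <= Ca%:E)%E.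
Variables (nrm : V -> R) (nrm_norm : is_norm nrm) (f : V -> R).
Variables (K q A c1 D L1 Cc MX : R).
Hypotheses (K0 : 0 < K) (q0 : 0 < q) (q1 : q < 1) (A0 : 0 < A) (c10 : 0 < c1) (D0 : 0 < D).
Hypothesis eta_lip : forall x1 x2, `|eta x1 - eta x2| <= L1 * (1 + nrm (x1 - x2)).
Hypothesis nrm2 : (\int[PX]_x (nrm x ^+ 2)%:E <= MX%:E)%E.
Hypothesis mass : forall x r, 0 < r < D -> c1 * f x * r ^+ d <= fine (PX (nball nrm x r)).
Hypothesis Cc0 : 0 <= Cc.
Hypothesis bias : forall r x, 0 < r -> 0 < f x ->
  (`|\int[mu]_t ((nrm (t.1 - x) <= r)%R%:R * (t.2 - eta x))%:E|
    <= (Cc * r ^+ 2)%:E * PX (nball nrm x r))%E.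

Lemma integral_fst (h : V -> R) : measurable_fun setT h -> (forall x, 0 <= h x) ->
  (\int[mu]_t (h t.1)%:E = \int[PX]_x (h x)%:E)%E.
Proof.
move=> mh h0; rewrite (ge0_integral_disintegration mkappa muE)//=; last 2 first.
- by apply/measurable_EFinP; exact: measurableT_comp mh measurable_fst.
- by move=> t; rewrite lee_fin.
by apply: eq_integral => x _; exact: (prob_integral_cst (kappa x)).
Qed.

Let meta := measurable_eta mkappa mean0.

Definition test_dist (x : V) (t : T) : R := nrm (t.1 - x).
Definition test_err (x : V) (t : T) : R := t.2 - eta x.

Lemma measurable_test_dist x : measurable_fun setT (test_dist x).
Proof. by apply: (measurable_dist nrm_norm) => //. Qed.

Lemma measurable_test_err x : measurable_fun setT (test_err x).
Proof. by apply: measurable_funB; [exact: measurable_snd|exact: measurable_cst]. Qed.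

Let Ca0 : 0 <= Ca.
Proof.
rewrite -lee_fin (le_trans _ (bayes_le mean0 var_le 0))//; exact: bayes_ge0.
Qed.

(** From (L1 (1 + s))^2 <= 2 L1^2 (1 + s^2), added to the conditional variance [Ca]. *)
Let C1 : R := Ca + 2 * L1 ^+ 2.
Let C2 : R := 2 * L1 ^+ 2.
Let C20 : 0 <= C2. Proof. by rewrite mulr_ge0// sqr_ge0. Qed.
Let C10 : 0 <= C1. Proof. by rewrite addr_ge0. Qed.

Let MX0 : 0 <= MX.
Proof.
rewrite -lee_fin; apply: le_trans nrm2; apply: integral_ge0 => x _.
by rewrite lee_fin sqr_ge0.
Qed.

Lemma test_err_cond_var x (w : T -> R) : measurable_fun setT w -> (forall t, 0 <= w t) ->
  (forall t t', t.1 = t'.1 -> w t = w t') ->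
  (\int[mu]_t (w t * test_err x t ^+ 2)%:E <=
   \int[mu]_t (w t * (C1 + C2 * test_dist x t ^+ 2))%:E)%E.
Proof.
move=> mw w0 wx.
pose B (x' : V) := 2 * L1 ^+ 2 * (1 + nrm (x' - x) ^+ 2).
have mB : measurable_fun setT B.
  apply: measurable_funM; first exact: measurable_cst.
  apply: measurable_funD; first exact: measurable_cst.
  apply: measurable_funX; apply: measurable_dist => //; exact: measurable_cst.
have etaB x' : (eta x' - eta x) ^+ 2 <= B x'.
  rewrite -real_normK ?num_real//.
  apply: (@le_trans _ _ ((L1 * (1 + nrm (x' - x))) ^+ 2)).
    by rewrite lerXn2r ?nnegrE// (le_trans _ (eta_lip x' x)).
  rewrite exprMn /B [2 * _]mulrC -[leRHS]mulrA ler_wpM2l ?sqr_ge0//.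
  by have := sqr_ge0 (1 - nrm (x' - x)); move: (nrm _) => s; lra.
apply: (le_trans (cond_sqr_le mkappa muE mean0 var_le mw w0 _ mB etaB)) => //.
  by move=> x' y y'; exact: wx.
rewrite le_eqVlt; apply/orP; left; apply/eqP; apply: eq_integral => t _.
by congr EFin; rewrite /C1 /C2 /B /test_dist; ring.
Qed.

(** This is the moment M at the test point x; its growth in |x|^2 matches the weight of (b'). *)
Lemma test_dist_sqr x : (\int[mu]_t (test_dist x t ^+ 2)%:E <= (2 * MX + 2 * nrm x ^+ 2)%:E)%E.
Proof.
have mn : measurable_fun setT (fun x : V => nrm x ^+ 2).
  by apply: measurable_funX; exact: measurable_is_norm.
rewrite (integral_fst (h := fun x' => nrm (x' - x) ^+ 2)); last 2 first.
- by apply: measurable_funX; apply: measurable_dist => //; exact: measurable_cst.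
- by move=> x'; exact: sqr_ge0.
apply: (@le_trans _ _ (\int[PX]_x' (2%:E * (nrm x' ^+ 2)%:E + (2 * nrm x ^+ 2)%:E))%E).
  apply: le_integral_ge0 => x'; first by rewrite lee_fin sqr_ge0.
  rewrite -EFinM -EFinD lee_fin.
  have := is_norm_dist_triangle nrm_norm 0 x' x; rewrite subr0 sub0r is_normN//.
  have := is_norm_ge0 nrm_norm (x' - x); have := is_norm_ge0 nrm_norm x'.
  have := is_norm_ge0 nrm_norm x; move: (nrm (x' - x)) (nrm x') (nrm x) => s s1 s2 h0 h1 h2 h.
  apply: (@le_trans _ _ ((s1 + s2) ^+ 2)); first by rewrite lerXn2r ?nnegrE ?addr_ge0.
  by have := sqr_ge0 (s1 - s2); lra.
rewrite ge0_integralD//; last 3 first.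
- by move=> x' _; rewrite lee_fin mulr_ge0// sqr_ge0.
- by apply: measurable_funeM; exact/measurable_EFinP.
- by move=> x' _; rewrite lee_fin mulr_ge0// sqr_ge0.
rewrite ge0_integralZl//; last 2 first.
- exact/measurable_EFinP.
- by move=> x' _; rewrite lee_fin sqr_ge0.
by rewrite prob_integral_cst [leRHS]EFinD leeD// [leRHS]EFinM lee_wpmul2l ?lee_fin.
Qed.

Lemma test_err_integrable x : mu.-integrable setT (EFin \o test_err x).
Proof.
have ma := measurable_test_err x; have mr := measurable_test_dist x.
apply/integrableP; split; first exact/measurable_EFinP.
have cv : (\int[mu]_t (1 * test_err x t ^+ 2)%:E <=
   \int[mu]_t (1 * (C1 + C2 * test_dist x t ^+ 2))%:E)%E.
  by apply: test_err_cond_var => //; exact: measurable_cst.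
apply: (@le_lt_trans _ _ (\int[mu]_t (1 + (1 * test_err x t ^+ 2)%:E))%E).
  apply: le_integral_ge0 => t; rewrite /= lee_fin// mul1r.
  by rewrite -real_normK ?num_real//; move: `|_| (sqr_ge0 (`|test_err x t| - 1)) => s; nra.
rewrite ge0_integralD//; last 2 first.
- by move=> t _; rewrite lee_fin mulr_ge0// sqr_ge0.
- apply/measurable_EFinP; apply: measurable_funM; first exact: measurable_cst.
  exact: measurable_funX.
rewrite prob_integral_cst; apply: lte_add_pinfty; first exact: ltry.
apply: (le_lt_trans cv).
rewrite (eq_integral (fun t => (C1%:E + C2%:E * (test_dist x t ^+ 2)%:E)%E)); last first.
  by move=> t _; rewrite mul1r.
rewrite ge0_integralD//; last 2 first.
- by move=> t _; rewrite lee_fin mulr_ge0// sqr_ge0.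
- by apply: measurable_funeM; apply/measurable_EFinP; exact: measurable_funX.
rewrite prob_integral_cst ge0_integralZl//; last 2 first.
- by apply/measurable_EFinP; exact: measurable_funX.
- by move=> t _; rewrite lee_fin sqr_ge0.
apply: lte_add_pinfty; first exact: ltry.
apply: (@le_lt_trans _ _ (C2%:E * (2 * MX + 2 * nrm x ^+ 2)%:E)%E); last by rewrite ltry.
by rewrite lee_wpmul2l ?lee_fin//; exact: test_dist_sqr.
Qed.

Lemma mu_ball x r : mu [set t | test_dist x t <= r] = PX (nball nrm x r).
Proof.
have -> : [set t | test_dist x t <= r] = nball nrm x r `*` setT.
  by apply/seteqP; split => -[x' y] /=; [|case].
rewrite muE//; last exact: measurable_nball.
rewrite (eq_integral (fun=> 1%E)).
  by rewrite integral_cst//= ?mul1e//; exact: measurable_nball.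
by move=> x' _; rewrite probability_setT.
Qed.

(* Open balls are increasing limits of the closed balls of positive radius to which
   the hypothesis applies, and the ball of radius 0 is a decreasing one. *)
Lemma test_err_bias x : 0 < f x -> forall o r, 0 <= r ->
  (`|\int[mu]_t ((inball (test_dist x) o r t)%:R * test_err x t)%:E|
     <= (Cc * r ^+ 2)%:E * mu [set t | inball (test_dist x) o r t])%E.
Proof.
move=> fx.
have ma := measurable_test_err x; have mr := measurable_test_dist x.
have ia := test_err_integrable x.
have mb o r : measurable_fun setT (inball (test_dist x) o r).
  rewrite /inball; case: o; [apply: measurable_fun_ler => //|apply: measurable_fun_ltr => //];
    exact: measurable_cst.
have closed r : 0 < r ->
  (`|\int[mu]_t ((inball (test_dist x) true r t)%:R * test_err x t)%:E|
     <= (Cc * r ^+ 2)%:E * mu [set t | inball (test_dist x) true r t])%E.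
  by move=> r0; have := bias r0 fx; rewrite -mu_ball.
have inv0 (e : R) : 0 < e -> \forall m \near \oo, m.+1%:R^-1 < e.
  by move=> e0; near=> m; near: m; exact: near_infty_natSinv_lt (PosNum e0).
move=> o r; rewrite le_eqVlt => /orP[/eqP <-|r0].
  rewrite expr0n/= mulr0 mul0e; apply/lee_addgt0Pr => e e0; rewrite add0e.
  case: o; last first.
    rewrite integral0_eq ?abse0 ?lee_fin ?(ltW e0)// => t _.
    by rewrite /inball ltNge is_norm_ge0// mul0r.
  (* r1 <= 1 gives r1^2 <= r1, and then Cc r1^2 <= (1 + Cc) r1 <= e. *)
  pose r1 := Num.min 1 (e / (1 + Cc)).
  have C10' : 0 < 1 + Cc by rewrite ltr_pwDl.
  have r10 : 0 < r1 by rewrite lt_min ltr01 divr_gt0.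
  apply: (integral_bool_lim ma ia (h := fun m => inball (test_dist x) true (r1 * m.+1%:R^-1))) => //.
    move=> t; have := is_norm_ge0 nrm_norm (t.1 - x); rewrite le_eqVlt => /orP[/eqP t0|t0].
      by near=> m; rewrite /inball /test_dist -t0 lexx; apply/ltW/mulr_gt0.
    near=> m; rewrite /inball /test_dist [RHS]leNgt t0; apply/negbTE; rewrite -ltNge mulrC -ltr_pdivlMr//.
    by near: m; apply: inv0; rewrite divr_gt0.
  move=> m; have rm0 : 0 < r1 * m.+1%:R^-1 by rewrite mulr_gt0.
  apply: (le_trans (closed _ rm0)).
  rewrite -[leRHS]mule1; apply: lee_pmul => //; last first.
  - by apply: probability_le1; exact: measurable_set_bool.
  - rewrite lee_fin.
    have rm1 : r1 * m.+1%:R^-1 <= r1 by rewrite ler_piMr ?(ltW r10)// invf_le1// ler1n.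
    apply: (@le_trans _ _ (Cc * r1)).
      rewrite ler_wpM2l// expr2; apply: (@le_trans _ _ (r1 * r1)); first by apply: ler_pM; rewrite ?(ltW rm0).
      by rewrite ler_piMr ?(ltW r10)// ge_min lexx.
    apply: (@le_trans _ _ ((1 + Cc) * r1)); first by rewrite mulrDl mul1r lerDr ltW.
    by rewrite mulrC -ler_pdivlMr// ge_min lexx orbT.
  - by rewrite lee_fin; apply: mulr_ge0 => //; exact: sqr_ge0.
case: o; first exact: closed.
pose r_ m : R := r - r / 2 * m.+1%:R^-1.
have r_r m : r_ m < r by rewrite ltrBlDr ltrDl mulr_gt0// divr_gt0.
have r_0 m : 0 < r_ m.
  rewrite subr_gt0; apply: (@le_lt_trans _ _ (r / 2)); last by move: r0; lra.
  by rewrite ler_piMr ?divr_ge0 ?(ltW r0)// invf_le1// ler1n.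
apply: (integral_bool_lim ma ia (h := fun m => inball (test_dist x) true (r_ m))) => //.
  move=> t; have [tr|rt] := ltP (test_dist x t) r; last first.
    by near=> m; rewrite /inball ltNge rt; apply/negbTE; rewrite -ltNge (lt_le_trans (r_r m)).
  near=> m; rewrite /inball tr /r_ lerBrDr -lerBrDl ltW// mulrC -ltr_pdivlMr ?divr_gt0//.
  by near: m; apply: inv0; rewrite divr_gt0 ?divr_gt0// subr_gt0.
move=> m; apply: (le_trans (closed _ (r_0 m))); apply: lee_pmul => //.
- by rewrite lee_fin mulr_ge0// sqr_ge0.
- by rewrite lee_fin ler_wpM2l// lerXn2r ?nnegrE// ltW.
- apply: le_measure; rewrite ?inE; try exact: measurable_set_bool.
  by move=> t /= h; apply: le_lt_trans h (r_r m).
Unshelve. all: by end_near.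
Qed.

Lemma regression_point_bound : exists N0 CC C3 c4, [/\ 0 <= CC, 0 <= C3, 0 < c4 &
  forall (N : nat) (Q : probability (rowT T N) R) (x : V), (N0 <= N)%N ->
  (forall E : 'I_N -> set T, (forall i, measurable (E i)) ->
    Q (box E) = (\prod_i mu (E i))%E) -> 0 < f x ->
  (\int[Q]_v (nn_mean (test_dist x) (test_err x) (knum K q) A v ^+ 2)%:E <=
    (CC * (cutpow q (N%:R * f x) + cutpow (4 / d%:R * (1 - q))
       (N%:R * (f x / fine (PX (nball nrm x A)) `^ q) `^ (1 - q)^-1)) +
     C3 * ((1 + nrm x ^+ 2) * expR (- (c4 * N%:R * f x))))%:E)%E].
Proof.
have [n0 [N0 few]] := knum_few K0 q0 q1.
have [CC [c4 [CC0 c40 bound]]] := @fixed_point_bound R _ T V mu fst d d0 K q A c1 D C1 C2 Cc n0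
  K0 q0 q1 A0 c10 D0 C10 C20 Cc0.
(* With M = 2 MX + 2 |x|^2, the term 2 C2 M is 4 C2 MX + 4 C2 |x|^2, absorbed by the factor 1 +
   |x|^2. *)
exists (maxn N0 n0.+2), CC, (n0.+2%:R * (C1 + 4 * C2 * MX + 4 * C2)), c4; split => //.
  by apply: mulr_ge0 => //; move: (mulr_ge0 C20 MX0) C10 C20; lra.
move=> N Q x; rewrite geq_max => /andP[N0N n0N] Qbox fx.
have := bound N Q (test_dist x) (test_err x) (f x) (2 * MX + 2 * nrm x ^+ 2) n0N Qbox.
move/(_ (measurable_test_dist x) (measurable_test_err x)).
move/(_ (fun t => is_norm_ge0 nrm_norm _)).
move/(_ (fun t t' e => congr1 (fun y => nrm (y - x)) e)).
move/(_ (@test_err_cond_var x) (test_err_integrable x) (test_err_bias fx) (few _ N0N)).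
move/(_ (test_dist_sqr x) fx) => h.
apply: (le_trans (h _)).
  by move=> r rD; rewrite mu_ball; exact: mass.
rewrite mu_ball lee_fin lerD2l.
move: (expR _) (expR_ge0 (- (c4 * N%:R * f x))) => e e0.
have := sqr_ge0 (nrm x); move: (nrm x ^+ 2) => s s0.
rewrite -subr_ge0 (_ : _ - _ = n0.+2%:R * e *
  ((C1 + 4 * C2 * MX + 4 * C2) * (1 + s) - (C1 + 2 * C2 * (2 * MX + 2 * s)))); last by ring.
apply: mulr_ge0; first by rewrite mulr_ge0.
by have := mulr_ge0 C10 s0; have := mulr_ge0 (mulr_ge0 C20 MX0) s0; move: C20; lra.
Qed.

End regression_point.

Section lipschitz.
Context {R : realType} {d : nat} (d0 : (0 < d)%N).
Variables (nrm : 'rV[R]_d -> R) (nrm_norm : is_norm nrm) (eta : 'rV[R]_d -> R) (L D : R).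
Hypotheses (D0 : 0 < D) (lip : large_scale_lipschitz nrm eta L D).

(* Points closer than D are compared through a third point at distance 3 D. *)
Lemma large_scale_lipschitz_affine : exists L1 : R, forall x1 x2,
  `|eta x1 - eta x2| <= L1 * (1 + nrm (x1 - x2)).
Proof.
(* The detour through the third point has legs of length 3 D and at most 4 D. *)
exists (`|L| * (1 + 7 * D)) => x1 x2.
have n0 := is_norm_ge0 nrm_norm.
have D0' := ltW D0; have Lge := ler_norm L.
have lip' y1 y2 : D <= nrm (y1 - y2) -> `|eta y1 - eta y2| <= `|L| * nrm (y1 - y2).
  by move=> h; apply: le_trans (lip h) _; rewrite ler_wpM2r.
have [far|close] := leP D (nrm (x1 - x2)).
  apply: (le_trans (lip' _ _ far)); rewrite -mulrA ler_wpM2l//.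
  by have := n0 (x1 - x2); move: (nrm _) => s s0; nra.
have [e ne] := is_norm_exists nrm_norm d0 (mulr_ge0 (ler0n R 3) D0').
pose z := x1 + e.
have zx1 : nrm (z - x1) = 3 * D by rewrite /z addrC addKr.
have zx2 : nrm (z - x2) <= 4 * D.
  have := is_norm_dist_triangle nrm_norm x1 z x2; rewrite zx1; move: close.
  by move: (nrm (x1 - x2)) (nrm (z - x2)) => s s'; lra.
have zx2' : D <= nrm (z - x2).
  have := is_norm_dist_triangle nrm_norm x2 z x1; rewrite zx1 [nrm (x2 - x1)](is_norm_distC nrm_norm).
  by move: close; move: (nrm (x1 - x2)) (nrm (z - x2)) => s s' h; move: D0; lra.
have h1 := lip' z x1; have h2 := lip' _ _ zx2'.
rewrite zx1 in h1; have {h1} := h1 (_ : D <= 3 * D); rewrite ler_peMl// ?ler1n// => /(_ isT) h1.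
apply: (@le_trans _ _ (`|L| * (7 * D))).
  rewrite distrC in h1; apply: (le_trans (ler_distD (eta z) _ _)).
  apply: (le_trans (lerD h1 h2)); rewrite -mulrDr ler_wpM2l//.
  by move: zx2; move: (nrm _) => s; lra.
rewrite -mulrA ler_wpM2l//; have := n0 (x1 - x2); move: (nrm _) => s s0; nra.
Qed.

End lipschitz.

(** * Risk of the adaptive regressor *)

Section knn_regressor.
Context {R : realType} {d : nat}.
Local Notation V := (rowT (realT R) d).
Local Notation T := (pairT V (realT R)).
Variables (nrm : V -> R) (nrm_norm : is_norm nrm) (eta : V -> R) (K q A : R) (N : nat).
Hypothesis few : forall n, (n <= knum K q n)%N -> ((knum K q n).*2 <= N)%N.

Definition row_knn (p : V * 'rV[T]_N) : R :=
  adaptive_knn nrm K A q (fun i : 'I_N => (p.2 ord0 i).1) (fun i : 'I_N => (p.2 ord0 i).2) p.1.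

(** With k <= N the regressor averages exactly k values, so subtracting eta x from the average
    centres each of them. *)
Lemma row_knn_err x (v : 'rV[T]_N) :
  row_knn (x, v) - eta x = nn_mean (test_dist nrm x) (test_err eta x) (knum K q) A v.
Proof.
rewrite /row_knn /adaptive_knn /nn_mean /=.
set delta := dist_row _ v.
have -> : adaptive_k nrm K A q (fun i => (v ord0 i).1) x = nn_number (test_dist nrm x) (knum K q) A v.
  rewrite /adaptive_k /nn_number /knum; congr (Num.truncn (_ * _%:R `^ _)).+1.
  apply: eq_bigr => i _; congr nat_of_bool; apply/idP/idP; rewrite inE//.
set k := nn_number _ _ _ _.
have kN : (k <= N)%N.
  rewrite /k /nn_number; have := ncount_le delta A; rewrite -/delta.
  move: (ncount _ _) => n nN; have [/few|/ltnW nk] := leqP n (knum K q n).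
    by apply: leq_trans; rewrite -addnn leq_addr.
  exact: leq_trans nk nN.
have kR0 : k%:R != 0 :> R by rewrite pnatr_eq0.
have -> : eta x = k%:R^-1 * \sum_i ((nrank delta i < k)%N%:R * eta x).
  by rewrite -mulr_suml -natr_sum sum_nrank_lt// mulrA mulVf// mul1r.
rewrite -mulrBr; congr (_ * _).
rewrite big_uniq ?take_uniq ?neighbors_uniq//= big_mkcond/= -sumrB.
apply: eq_bigr => i _; rewrite mem_take_neighbors -/delta.
by case: ifP => _; rewrite ?mul1r// !mul0r subrr.
Qed.

Lemma measurable_row_knn : measurable_fun setT eta ->
  measurable_fun [set: pairT V (rowT T N)] row_knn.
Proof.
move=> meta.
(* Pairing every sample with x makes the test point a coordinate of the row. *)
pose T' := pairT V T.
pose rho (t : T') := test_dist nrm t.1 t.2.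
pose a (t : T') := test_err eta t.1 t.2.
have mrho : measurable_fun setT rho.
  apply: (measurable_dist nrm_norm); last exact: measurable_fst.
  exact: measurableT_comp measurable_fst measurable_snd.
have ma : measurable_fun setT a.
  apply: measurable_funB; first exact: measurableT_comp measurable_snd measurable_snd.
  exact: measurableT_comp meta measurable_fst.
pose pairing (p : pairT V (rowT T N)) : rowT T' N := \row_i (p.1, p.2 ord0 i).
have mpairing : measurable_fun setT pairing.
  apply: measurable_fun_rVP => i; under eq_fun do rewrite mxE.
  apply: measurable_fun_pair; first exact: measurable_fst.
  exact: measurableT_comp (measurable_coord i) measurable_snd.
have -> : row_knn = fun p => nn_mean rho a (knum K q) A (pairing p) + eta p.1.
  apply/funext => -[x v]; rewrite -[LHS](subrK (eta x)) row_knn_err; congr (_ + _).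
  rewrite /nn_mean /nn_number.
  have -> : dist_row rho (pairing (x, v)) = dist_row (test_dist nrm x) v.
    by apply/funext => i; rewrite /dist_row mxE.
  by congr (_ * _); apply: eq_bigr => i _; rewrite mxE.
apply: measurable_funD; last exact: measurableT_comp meta measurable_fst.
exact: (measurableT_comp (measurable_nn_mean mrho ma _ _) mpairing).
Qed.

End knn_regressor.

Section excess.
Context {R : realType} {dA dB} {A : measurableType dA} {B : measurableType dB}.
Variables (kappa : A -> pprobability (realT R) R) (mkappa : measurable_fun setT kappa).
Variables (PX : probability A R) (mu : probability (pairT A (realT R)) R) (Q : probability B R).
Hypothesis muE : forall E F, measurable E -> measurable F ->
  mu (E `*` F) = (\int[PX]_(x in E) kappa x F)%E.
Variables (eta : A -> R) (Ca : R).
Hypothesis mean0 : forall x, ('E_(kappa x)[fun y => (y - eta x)%R] = 0)%E.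
Hypothesis var_le : forall x, ('V_(kappa x)[idfun] <= Ca%:E)%E.

(** With the training row v frozen, g (., v) is a fixed measurable function, to which the
    decomposition applies; the noise term does not depend on v. *)
Lemma integral_sqr_error_train (g : pairT A B -> R) : measurable_fun setT g ->
  (\int[mu]_t \int[Q]_v ((g (t.1, v) - t.2) ^+ 2)%:E =
   \int[PX]_x \int[Q]_v ((g (x, v) - eta x) ^+ 2)%:E + \int[mu]_t ((t.2 - eta t.1) ^+ 2)%:E)%E.
Proof.
move=> mg.
rewrite (@fubini_tonelli _ _ _ _ _ mu Q (fun p => ((g (p.1.1, p.2) - p.1.2) ^+ 2)%:E))//=; last 2 first.
- apply/measurable_EFinP; apply: measurable_funX; apply: measurable_funB.
    apply: (measurableT_comp mg); apply: measurable_fun_pair; last exact: measurable_snd.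
    exact: measurableT_comp measurable_fst measurable_fst.
  exact: measurableT_comp measurable_snd measurable_fst.
- by move=> p; rewrite lee_fin sqr_ge0.
have meta := measurable_eta mkappa mean0.
have mge : measurable_fun setT (fun p : pairT A B => ((g p - eta p.1) ^+ 2)%:E).
  apply/measurable_EFinP; apply: measurable_funX; apply: measurable_funB => //.
  exact: measurableT_comp meta measurable_fst.
rewrite (@fubini_tonelli _ _ _ _ _ PX Q (fun p => ((g p - eta p.1) ^+ 2)%:E))//=; last first.
  by move=> p; rewrite lee_fin sqr_ge0.
under eq_integral => v _.
  rewrite (integral_sqr_error mkappa muE mean0 var_le (g := fun x => g (x, v))); last first.
    by apply: (measurableT_comp mg); exact: measurable_pair2.
  over.
rewrite ge0_integralD//; last 3 first.
- by move=> v _; apply: integral_ge0 => x _; rewrite lee_fin sqr_ge0.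
- apply: (@measurable_fun_fubini_tonelli_G _ _ _ _ _ PX (fun p : pairT A B => ((g p - eta p.1) ^+ 2)%:E)) => // p.
  by rewrite lee_fin sqr_ge0.
- by move=> v _; apply: integral_ge0 => t _; rewrite lee_fin sqr_ge0.
by rewrite prob_integral_cst.
Qed.

End excess.

Section knn_rates.
Context {R : realType} {d : nat} (d_gt0 : (0 < d)%N).
Local Notation V := (rowT (realT R) d).
Local Notation T := (pairT V (realT R)).
Variables (nrm : 'rV[R]_d -> R) (nrm_norm : is_norm nrm).
Context {dO : measure_display} {Omega : measurableType dO} (P : probability Omega R).
Variables (X : {RV P >-> 'rV[R]_d}) (Y eps : {RV P >-> R})
  (Xs : nat -> {RV P >-> 'rV[R]_d}) (Ys : nat -> {RV P >-> R})
  (f eta : 'rV[R]_d -> R) (kappa : {mfun 'rV[R]_d >-> pprobability R R})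
  (A Ca Cb' Cc Cd D L MX beta' : R).
Hypotheses (A_gt0 : 0 < A) (Cd_gt0 : 0 < Cd) (D_gt0 : 0 < D)
    (Xdensity : has_density X f)
    (XY_iid : iid_data X Y Xs Ys)
    (Ymodel : regression_model X Y eps eta kappa)
    (Ha : cond_variance_le kappa Ca)
    (Hb : weighted_tail nrm X f MX Cb' beta')
    (Hc : local_bias nrm X Y f eta Cc)
    (Hd : ball_mass_ge nrm X f Cd D)
    (He : large_scale_lipschitz nrm eta L D).

Let mX : measurable_fun [set: Omega] (X : Omega -> V).
Proof. exact: measurable_funPT. Qed.

Let mZ i : measurable_fun setT (data X Y Xs Ys i : Omega -> T).
Proof. by case: i => [i|]; apply: measurable_fun_pair; exact: measurable_funPT. Qed.

Let mu : probability T R := law P (mZ None).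
Let PX : probability V R := distribution P X.

Let mkappa : measurable_fun setT (kappa : V -> pprobability (realT R) R).
Proof. exact: measurable_funPT. Qed.

Let muE E F : measurable E -> measurable F -> mu (E `*` F) = (\int[PX]_(x in E) kappa x F)%E.
Proof. by case: Ymodel => _ h _ mE mF; rewrite -h. Qed.

Let mean0 x : ('E_(kappa x)[fun y => (y - eta x)%R] = 0)%E.
Proof. by case: Ymodel => _ _; exact. Qed.

Let mf : measurable_fun [set: V] (f : V -> R). Proof. by case: Xdensity. Qed.
Let f0 x : 0 <= f x. Proof. by case: Xdensity. Qed.
Let PXE E : measurable E -> PX E = (\int[@lebesgue_rV R d]_(x in E) (f x)%:E)%E.
Proof. by case: Xdensity => _ _; exact. Qed.

Let ge0_integral_PX (F : V -> \bar R) : measurable_fun setT F -> (forall x, 0 <= F x)%E ->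
  (\int[PX]_x F x = \int[P]_w F (X w))%E.
Proof. by move=> mF F0; have := ge0_integral_law P mX mF F0. Qed.

Let PX_set (B : V -> bool) : PX [set x | B x] = P [set w | B (X w)].
Proof. by []. Qed.

Let nrm2 : (\int[PX]_x (nrm x ^+ 2)%:E <= MX%:E)%E.
Proof.
case: Hb => h _; move: h; rewrite unlock ge0_integral_PX//.
- by apply/measurable_EFinP; apply: measurable_funX; exact: measurable_is_norm.
- by move=> x; rewrite lee_fin sqr_ge0.
Qed.

Lemma density_ball_mass : exists2 c1 : R, 0 < c1 & forall x r, 0 < r < D ->
  c1 * f x * r ^+ d <= fine (PX (nball nrm x r)).
Proof.
have [c c0 vol] := nball_volume nrm_norm.
exists (Cd * c) => [|x r rD]; first exact: mulr_gt0.
have /andP[r0 _] := rD.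
rewrite -lee_fin fineK ?fin_num_measure//; last exact: measurable_nball.
apply: le_trans (Hd x rD).
rewrite (_ : Cd * c * f x * r ^+ d = (Cd * f x) * (c * r ^+ d)); last by ring.
by rewrite EFinM lee_wpmul2l ?lee_fin ?vol// mulr_ge0// ltW.
Qed.

Lemma ball_mass_gt0 x r : 0 < f x -> 0 < r -> 0 < fine (PX (nball nrm x r)).
Proof.
move=> fx r0; have [c1 c10 mass] := density_ball_mass.
pose r' := Num.min r (D / 2).
have r'0 : 0 < r' by rewrite lt_min r0 divr_gt0.
have r'D : r' < D.
  by apply: (@le_lt_trans _ _ (D / 2)); [rewrite ge_min lexx orbT|move: D_gt0; lra].
apply: (@lt_le_trans _ _ (fine (PX (nball nrm x r')))).
  apply: lt_le_trans (mass _ _ _); last by rewrite r'0.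
  by rewrite mulr_gt0 ?exprn_gt0// mulr_gt0.
apply: fine_le; rewrite ?fin_num_measure//; try exact: measurable_nball.
apply: le_measure; rewrite ?inE; try exact: measurable_nball.
by move=> y /= h; rewrite /nball/= (le_trans h)// ge_min lexx.
Qed.

Let L1 := projT1 (cid (large_scale_lipschitz_affine d_gt0 nrm_norm D_gt0 He)).
Let eta_lip : forall x1 x2, `|eta x1 - eta x2| <= L1 * (1 + nrm (x1 - x2)).
Proof. exact: (projT2 (cid (large_scale_lipschitz_affine d_gt0 nrm_norm D_gt0 He))). Qed.

(** This is (c) multiplied by the mass of the ball, which is positive as f x > 0. The integral is
    E[Y 1_B] - eta x P(B), a subtraction that requires integrability first. *)
Lemma ball_bias r x : 0 < r -> 0 < f x ->
  (`|\int[mu]_t ((nrm (t.1 - x) <= r)%R%:R * (t.2 - eta x))%:E|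
    <= (Cc * r ^+ 2)%:E * PX (nball nrm x r))%E.
Proof.
move=> r0 fx; have p0 := ball_mass_gt0 fx r0.
pose B : set V := nball nrm x r.
have mB : measurable B by exact: measurable_nball.
have Pfin : PX B = (fine (PX B))%:E by rewrite fineK// fin_num_measure.
have := Hc r0 fx; rewrite /cond_mean_on -/PX -/B.
have ie := test_err_integrable mkappa muE mean0 Ha nrm_norm eta_lip nrm2 x.
have me : measurable_fun setT (test_err eta x) by exact: measurable_test_err.
have iY : P.-integrable setT (EFin \o (fun w => Y w - eta x)).
  apply/integrableP; split; first by apply/measurable_EFinP; exact: measurable_funB.
  move/integrableP : ie => [_]; rewrite ge0_integral_law//.
  by apply: measurableT_comp => //; exact/measurable_EFinP.
have mb : measurable_fun setT (fun t : T => \1_B t.1 : R).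
  exact: measurableT_comp (measurable_indic mB) measurable_fst.
pose h (t : T) : R := \1_B t.1 * (t.2 - eta x).
have mh : measurable_fun setT h by exact: measurable_funM.
have hE (t : T) : (nrm (t.1 - x) <= r)%R%:R * (t.2 - eta x) = h t.
  rewrite /h indicE; congr (_%:R * _); congr nat_of_bool.
  by apply/idP/idP; rewrite inE.
under [in X in _ -> X]eq_integral do rewrite hE.
have ih : P.-integrable setT (EFin \o (fun w => \1_B (X w) * (Y w - eta x))).
  apply: (@le_integrable _ _ _ _ _ measurableT _ _ _ _ iY).
    apply/measurable_EFinP; apply: measurable_funM; last exact: measurable_funB.
    exact: measurableT_comp (measurable_indic mB) mX.
  move=> w _ /=; rewrite lee_fin normrM indicE.
  by case: (_ \in _); rewrite ?normr1 ?mul1r// normr0 mul0r.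
have mXB : measurable_fun setT (fun w => \1_B (X w) : R).
  exact: measurableT_comp (measurable_indic mB) mX.
have iB : P.-integrable setT (EFin \o (fun w => \1_B (X w) : R)).
  apply: (@le_integrable _ _ _ _ _ measurableT _ _ _ _ (finite_measure_integrable_cst P 1 measurableT)).
    exact/measurable_EFinP.
  by move=> w _ /=; rewrite lee_fin indicE; case: (_ \in _); rewrite ?normr1// normr0.
have i1 : P.-integrable setT (EFin \o (fun w => eta x * \1_B (X w))).
  exact: integrableZl iB.
have muh : (\int[mu]_t (h t)%:E = \int[P]_w (\1_B (X w) * (Y w - eta x))%:E)%E.
  by rewrite integral_law//; exact/measurable_EFinP.
have hfin : (\int[mu]_t (h t)%:E)%E \is a fin_num.
  by rewrite muh; exact: integrable_fin_num ih.
have EY : ('E_P[fun w => (Y w * \1_B (X w))%R] =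
    \int[mu]_t (h t)%:E + (eta x * fine (PX B))%:E)%E.
  rewrite unlock (eq_integral (fun w => ((EFin \o (fun w => \1_B (X w) * (Y w - eta x))%R) w +
     (EFin \o (fun w => eta x * \1_B (X w))%R) w)%E)); last first.
    by move=> w _ /=; rewrite -EFinD; congr EFin; ring.
  rewrite integralD// muh; congr (_ + _)%E.
  rewrite EFinM -Pfin.
  have <- : (\int[PX]_x (\1_B x)%:E = PX B)%E by rewrite integral_indic// setIT.
  rewrite ge0_integral_PX//; last exact/measurable_EFinP/measurable_indic.
  by rewrite -integralZl.
rewrite EY -(fineK hfin) -EFinD /= => bias.
rewrite Pfin -EFinM/= lee_fin -ler_pdivrMr//.
move: bias; move: (fine (\int[mu]_t _)%E) => I.
rewrite (_ : _ - eta x = I / fine (PX B)); last by field; rewrite gt_eqF.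
by rewrite normrM normfV (gtr0_norm p0).
Qed.

Lemma measurable_exp_weight b :
  measurable_fun [set: V] (fun x : V => (1 + nrm x ^+ 2) * expR (- (b * f x))).
Proof.
apply: measurable_funM.
  apply: measurable_funD; first exact: measurable_cst.
  by apply: measurable_funX; exact: measurable_is_norm.
apply: (measurableT_comp (@measurable_expR R)); apply: measurable_funN.
by apply: measurable_funM => //; exact: measurable_cst.
Qed.

Lemma exp_tail b : 0 < b ->
  (\int[PX]_x ((1 + nrm x ^+ 2) * expR (- (b * f x)))%:E <= (Cb' * b `^ (- beta'))%:E)%E.
Proof.
move=> b0; case: Hb => _ tail.
rewrite (ge0_integral_density mf f0 PXE)//.
- exact: tail.
- exact: measurable_exp_weight.
- by move=> x; rewrite mulr_ge0 ?expR_ge0// addr_ge0// sqr_ge0.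
Qed.

Lemma Cb_ge0 : 0 <= Cb'.
Proof.
have := exp_tail ltr01; rewrite powR1 mulr1 => h.
rewrite -lee_fin (le_trans _ h)//; apply: integral_ge0 => x _.
by rewrite lee_fin mulr_ge0 ?expR_ge0// addr_ge0// sqr_ge0.
Qed.

(* With b = 1 / t in (b'), as 1 <= e exp (- f x / t) when f x < t. *)
Lemma density_tail t : 0 < t -> (PX [set x | (f x < t)%R] <= (expR 1 * Cb' * t `^ beta')%:E)%E.
Proof.
move=> t0; have ti0 : 0 < t^-1 by rewrite invr_gt0.
have mb : measurable_fun [set: V] (fun x => f x < t).
  by apply: measurable_fun_ltr => //; exact: measurable_cst.
rewrite -integral_bool//.
apply: (@le_trans _ _ (\int[PX]_x ((expR 1)%:E * ((1 + nrm x ^+ 2) * expR (- (t^-1 * f x)))%:E))%E).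
  apply: le_integral_ge0 => x; first by rewrite lee_fin.
  rewrite -EFinM lee_fin; case: ltP => ft /=; last first.
    by rewrite !mulr_ge0 ?expR_ge0// addr_ge0// sqr_ge0.
  rewrite mulrCA -expRD -[leLHS]mulr1; apply: ler_pM => //.
    by rewrite lerDl sqr_ge0.
  by rewrite -[leLHS]expR0 ler_expR subr_ge0 mulrC ler_pdivrMr// mul1r ltW.
rewrite ge0_integralZl//; last 2 first.
- by apply/measurable_EFinP; exact: measurable_exp_weight.
- by move=> x _; rewrite lee_fin mulr_ge0 ?expR_ge0// addr_ge0// sqr_ge0.
rewrite -mulrA EFinM lee_wpmul2l ?lee_fin ?expR_ge0//.
by have := exp_tail ti0; rewrite -[in X in _ * X](powR_inv1 (ltW t0)) -powRrM mulN1r opprK.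
Qed.

(** The fixed-point bound assumes a positive density; this makes it hold almost everywhere. *)
Lemma density_zero : PX [set x | f x = 0] = 0%E.
Proof.
rewrite PXE; first by rewrite integral0_eq// => x ->.
by rewrite -[X in measurable X]setTI; exact: (mf measurableT (measurable_set1 0)).
Qed.

Lemma measurable_cutpow s : measurable_fun [set: R] (cutpow s).
Proof.
apply: measurable_fun_if => //.
- by apply: measurable_fun_ltr; [exact: measurable_id|exact: measurable_cst].
- by apply: measurable_funTS; exact: measurable_powR.
Qed.

Let Q N : probability (rowT T N) R :=
  law P (measurable_sample_row mZ (fun i : 'I_N => Some (val i))).

Let Qbox N (E : 'I_N -> set T) : (forall i, measurable (E i)) ->
  Q N (box E) = (\prod_i mu (E i))%E.
Proof. by case: XY_iid => ? ? mE; exact: train_row_box. Qed.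

Lemma knn_excess_riskE K q N :
  (forall n, (n <= knum K q n)%N -> ((knum K q n).*2 <= N)%N) ->
  knn_excess_risk nrm X Y eps Xs Ys K A q N =
  (\int[PX]_x \int[Q N]_v (nn_mean (test_dist nrm x) (test_err eta x) (knum K q) A v ^+ 2)%:E)%E.
Proof.
move=> few; have meta := measurable_eta mkappa mean0.
have mg := measurable_row_knn nrm_norm A few meta.
pose H (p : T * 'rV[T]_N) := ((row_knn nrm K q A (p.1.1, p.2) - p.1.2) ^+ 2)%:E.
have mH : measurable_fun [set: pairT T (rowT T N)] H.
  apply/measurable_EFinP; apply: measurable_funX; apply: measurable_funB.
    apply: (measurableT_comp mg); apply: measurable_fun_pair; last exact: measurable_snd.
    exact: measurableT_comp measurable_fst measurable_fst.
  exact: measurableT_comp measurable_snd measurable_fst.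
have H0 p : (0 <= H p)%E by rewrite lee_fin sqr_ge0.
have bayesE : bayes_risk eps = (\int[mu]_t ((t.2 - eta t.1) ^+ 2)%:E)%E.
  rewrite /bayes_risk unlock [RHS](ge0_integral_law P (mZ None)).
  - by apply: eq_integral => w _; case: Ymodel => YE _ _; rewrite /= YE addrC addKr.
  - apply/measurable_EFinP; apply: measurable_funX; apply: measurable_funB; first exact: measurable_snd.
    exact: measurableT_comp meta measurable_fst.
  - by move=> t; rewrite lee_fin sqr_ge0.
(* Finiteness of the Bayes risk is what permits cancelling it in [\bar R]. *)
have bayes_fin : bayes_risk eps \is a fin_num.
  rewrite ge0_fin_numE; first by rewrite bayesE (le_lt_trans (integral_noise_le mkappa muE mean0 Ha)) ?ltry.
  by rewrite bayesE; apply: integral_ge0 => t _; rewrite lee_fin sqr_ge0.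
rewrite /knn_excess_risk /risk.
transitivity ((\int[P]_w H (data X Y Xs Ys None w,
    sample_row (data X Y Xs Ys) (fun i : 'I_N => Some (val i)) w)) - bayes_risk eps)%E.
  congr (_ - _)%E; rewrite unlock; apply: eq_integral => w _; rewrite /H.
  set v := sample_row _ _ w.
  have e1 : (fun i => (v ord0 i).1) = (fun i => Xs i w) by apply/funext => i; rewrite mxE.
  have e2 : (fun i => (v ord0 i).2) = (fun i => Ys i w) by apply/funext => i; rewrite mxE.
  by rewrite /row_knn /= e1 e2.
case: (XY_iid) => indep ident.
rewrite (ge0_integral_test_train mZ indep ident mH H0).
have := integral_sqr_error_train mkappa (Q N) muE mean0 Ha mg.
rewrite -bayesE => step; apply: (eq_trans (congr1 (fun r => r - bayes_risk eps)%E step)).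
rewrite addeK; last exact: bayes_fin.
by apply: eq_integral => x _; apply: eq_integral => v _; rewrite row_knn_err.
Qed.

Let W q x : R := f x / fine (PX (nball nrm x A)) `^ q.

Let W0 q x : 0 <= W q x.
Proof. by rewrite divr_ge0// powR_ge0. Qed.

Lemma measurable_ball_mass : measurable_fun [set: V] (fun x : V => fine (PX (nball nrm x A))).
Proof.
apply: (measurableT_comp (fine_measurable measurableT)).
have mB : measurable [set p : pairT V V | nrm (p.2 - p.1) <= A].
  apply: measurable_set_bool; apply: measurable_fun_ler; last exact: measurable_cst.
  exact: (measurable_dist nrm_norm measurable_snd measurable_fst).
have := measurable_fun_xsection PX mB.
rewrite (_ : PX \o _ = fun x => PX (nball nrm x A))//.
by apply/funext => x /=; congr (PX _); apply/seteqP; split => y; rewrite /xsection/= inE.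
Qed.

Lemma measurable_mass_ratio q : measurable_fun [set: V] (W q).
Proof.
apply: measurable_funM => //.
under eq_fun do rewrite -powRN.
exact: measurableT_comp (measurable_powR _) measurable_ball_mass.
Qed.

Lemma knn_excess_risk_le K q Cb'' : 0 < K -> 0 < q < 1 ->
  mass_ratio_tail nrm X f A q Cb'' beta' ->
  exists N0 (C : R), forall N, (N0 <= N)%N ->
  (0 <= knn_excess_risk nrm X Y eps Xs Ys K A q N <=
    (C * knn_rate beta' (2 * knn_lambda d q) N)%:E)%E.
Proof.
move=> K0 /andP[q0 q1] tailW.
have [c1 c10 mass] := density_ball_mass.
(* [Cc] has no assumed sign, while the constant of the fixed-point bound must be nonnegative. *)
have bias r x : 0 < r -> 0 < f x ->
  (`|\int[mu]_t ((nrm (t.1 - x) <= r)%R%:R * (t.2 - eta x))%:E|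
    <= (`|Cc| * r ^+ 2)%:E * PX (nball nrm x r))%E.
  move=> r0 fx; apply: (le_trans (ball_bias r0 fx)).
  by rewrite lee_wpmul2r ?measure_ge0// lee_fin ler_wpM2r ?sqr_ge0// ler_norm.
have [N0 [CC [C3 [c4 [CC0 C30 c40 bound]]]]] := regression_point_bound d_gt0 mkappa muE
  mean0 Ha nrm_norm K0 q0 q1 A_gt0 c10 D_gt0 eta_lip nrm2 mass (normr_ge0 Cc) bias.
have [n0 [N1 few]] := knum_few K0 q0 q1.
have meta := measurable_eta mkappa mean0.
pose s : R := 4 / d%:R * (1 - q).
have s0 : 0 < s by rewrite mulr_gt0 ?subr_gt0// divr_gt0 ?ltr0n.
have q10 : 0 < 1 - q by rewrite subr_gt0.
(* This power turns the event of (T) into Z < t, the same form as the tail of f, so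
   [integral_cutpow] serves both. *)
pose Z x := W q x `^ (1 - q)^-1.
have mZW : measurable_fun [set: V] Z.
  exact: measurableT_comp (measurable_powR _) (measurable_mass_ratio q).
have Cb''0 : 0 <= Cb''.
  by have := tailW _ ltr01; rewrite !powR1 mulr1 => h; rewrite -lee_fin (le_trans _ h)//.
have tailZ t : 0 < t -> (PX [set x | (Z x < t)%R] <= (Cb'' * t `^ beta')%:E)%E.
  move=> t0; apply: le_trans (tailW _ t0).
  rewrite -(PX_set (fun x => W q x < t `^ (1 - q))).
  apply: le_measure; rewrite ?inE.
  - apply: measurable_set_bool; apply: measurable_fun_ltr => //; exact: measurable_cst.
  - apply: measurable_set_bool; apply: measurable_fun_ltr; last exact: measurable_cst.
    exact: measurable_mass_ratio.
  - move=> x /= Zt; have := gt0_ltr_powR q10 _ _ Zt.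
    rewrite !nnegrE powR_ge0 (ltW t0) => /(_ isT isT).
    by rewrite /Z -powRrM mulVf ?gt_eqF// powRr1.
have [Cf Cf0 intf] := integral_cutpow mf (mulr_ge0 (expR_ge0 1) Cb_ge0) q0 density_tail.
have [CW CW0 intW] := integral_cutpow mZW Cb''0 s0 tailZ.
have lam : 2 * knn_lambda d q = Num.min q s.
  rewrite /knn_lambda minr_pMr//; congr Num.min; first by rewrite mulrC divfK.
  by rewrite /s !mulrA; congr (_ * _ * _); ring.
have [M1 M10 rate1] : exists2 C : R, 0 < C & forall N, (1 < N)%N ->
    knn_rate beta' q N <= C * knn_rate beta' (Num.min q s) N.
  by apply: knn_rate_mono; rewrite ge_min lexx.
have [M2 M20 rate2] : exists2 C : R, 0 < C & forall N, (1 < N)%N ->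
    knn_rate beta' s N <= C * knn_rate beta' (Num.min q s) N.
  by apply: knn_rate_mono; rewrite ge_min lexx orbT.
(* The exponential term is (b') at b = c4 N, of order N^-beta', which [powN_le_rate] puts below the
   rate. *)
pose C4 : R := C3 * (Cb' * c4 `^ (- beta') * (1 + (ln 2)^-1)).
exists (maxn 2 (maxn N0 N1)), (CC * (Cf * M1 + CW * M2) + C4) => N.
rewrite !geq_max => /and3P[N2 N0N N1N].
have NR0 : 0 < N%:R :> R by rewrite ltr0n ltnW.
have fewN n : (n <= knum K q n)%N -> ((knum K q n).*2 <= N)%N.
  by move=> /(few _ N1N)[].
have EE := knn_excess_riskE fewN.
set F := (fun x => \int[Q N]_v _)%E in EE.
have F0 x : (0 <= F x)%E by apply: integral_ge0 => v _; rewrite lee_fin sqr_ge0.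
have mF : measurable_fun [set: V] F.
  pose h (p : pairT V (rowT T N)) := ((row_knn nrm K q A p - eta p.1) ^+ 2)%:E.
  have mh : measurable_fun setT h.
    apply/measurable_EFinP; apply: measurable_funX; apply: measurable_funB.
      exact: (measurable_row_knn nrm_norm A fewN meta).
    exact: measurableT_comp meta measurable_fst.
  have h0 p : (0 <= h p)%E by rewrite lee_fin sqr_ge0.
  have := @measurable_fun_fubini_tonelli_F _ _ _ _ _ (Q N) h mh h0.
  rewrite (_ : fubini_F _ _ = F)//.
  by apply/funext => x; apply: eq_integral => v _; rewrite /h row_knn_err.
rewrite EE; apply/andP; split; first by apply: integral_ge0 => x _; exact: F0.
rewrite lam; set rate := knn_rate _ _ _.
have mcut t (h : V -> R) : measurable_fun setT h ->
    measurable_fun [set: V] (fun x => cutpow t (N%:R * h x)).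
  move=> mh; apply: (measurableT_comp (measurable_cutpow t)).
  by apply: measurable_funM => //; exact: measurable_cst.
pose G1 x : R := cutpow q (N%:R * f x).
pose G2 x : R := cutpow s (N%:R * Z x).
pose G3 x : R := (1 + nrm x ^+ 2) * expR (- (c4 * N%:R * f x)).
have mG1 : measurable_fun [set: V] G1 by exact: mcut.
have mG2 : measurable_fun [set: V] G2 by exact: mcut.
have mG3 : measurable_fun [set: V] G3 by exact: measurable_exp_weight.
have G10 x : 0 <= G1 x by exact: cutpow_ge0.
have G20 x : 0 <= G2 x by exact: cutpow_ge0.
have G30 x : 0 <= G3 x by rewrite mulr_ge0 ?expR_ge0// addr_ge0// sqr_ge0.
have GE0 x : (0 <= CC%:E * ((G1 x)%:E + (G2 x)%:E) + C3%:E * (G3 x)%:E)%E.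
  by apply: adde_ge0; apply: mule_ge0; rewrite ?lee_fin ?addr_ge0.
apply: (@le_trans _ _ (\int[PX]_x (CC%:E * ((G1 x)%:E + (G2 x)%:E) + C3%:E * (G3 x)%:E))%E).
  apply: ae_ge0_le_integral => //.
  - by move=> x _; exact: F0.
  - apply: emeasurable_funD; apply: measurable_funeM; last exact/measurable_EFinP.
    by apply: emeasurable_funD; exact/measurable_EFinP.
  - exists [set x | f x = 0]; split.
    + by rewrite -[X in measurable X]setTI; exact: (mf measurableT (measurable_set1 0)).
    + exact: density_zero.
    + move=> x /=; apply: contra_notP => fx0 _.
      have fx : 0 < f x by rewrite lt_neqAle f0 andbT eq_sym; apply/eqP.
      exact: (bound N (Q N) x N0N (@Qbox N) fx).
rewrite ge0_integralD//; last 4 first.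
- by move=> x _; apply: mule_ge0; rewrite ?lee_fin ?addr_ge0.
- by apply: measurable_funeM; apply: emeasurable_funD; exact/measurable_EFinP.
- by move=> x _; apply: mule_ge0; rewrite ?lee_fin.
- by apply: measurable_funeM; exact/measurable_EFinP.
rewrite ge0_integralZl//; last 2 first.
- by apply: emeasurable_funD; apply/measurable_EFinP.
- by move=> x _; rewrite lee_fin addr_ge0.
have E1 : measurable_fun [set: V] (fun x => (G1 x)%:E) by apply/measurable_EFinP.
have E2 : measurable_fun [set: V] (fun x => (G2 x)%:E) by apply/measurable_EFinP.
have E3 : measurable_fun [set: V] (fun x => (G3 x)%:E) by apply/measurable_EFinP.
have E10 x : [set: V] x -> (0 <= (G1 x)%:E)%E by rewrite lee_fin.
have E20 x : [set: V] x -> (0 <= (G2 x)%:E)%E by rewrite lee_fin.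
have E30 x : [set: V] x -> (0 <= (G3 x)%:E)%E by rewrite lee_fin.
rewrite (ge0_integralD PX measurableT E10 E1 E20 E2) (ge0_integralZl_EFin PX measurableT E30 E3 C30).
have i1 := intf N N2; have i2 := intW N N2.
have i3 := exp_tail (mulr_gt0 c40 NR0).
have rateN := powN_le_rate beta' (Num.min q s) N2.
apply: (@le_trans _ _ (CC * (Cf * knn_rate beta' q N + CW * knn_rate beta' s N) +
   C3 * (Cb' * (c4 * N%:R) `^ (- beta')))%:E).
  rewrite [leRHS]EFinD; apply: leeD; rewrite [leRHS]EFinM; apply: lee_wpmul2l; rewrite ?lee_fin//.
  by rewrite [leRHS]EFinD; apply: leeD.
rewrite lee_fin mulrDl; apply: lerD.
  rewrite -mulrA ler_wpM2l// mulrDl -!mulrA.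
  by apply: lerD; apply: ler_wpM2l => //; [exact: rate1|exact: rate2].
rewrite powRM ?(ltW c40) ?(ltW NR0)//.
rewrite (_ : C4 * rate = C3 * (Cb' * (c4 `^ (- beta') * ((1 + (ln 2)^-1) * rate)))); last first.
  by rewrite /C4; ring.
apply: ler_wpM2l => //; apply: ler_wpM2l; first exact: Cb_ge0.
by apply: ler_wpM2l => //; exact: powR_ge0.
Qed.

End knn_rates.

(** * Comparison of the rates and the optimal exponent *)

Section rate_comparison.
Context {R : realType}.

Lemma ebigO_squeeze (u : nat -> \bar R) (v : nat -> R) (N0 : nat) (C : R) :
  (forall N, (N0 <= N)%N -> 0 <= u N <= (C * v N)%:E)%E ->
  (forall N, (N0 <= N)%N -> 0 <= v N) -> ebigO u v.
Proof.
move=> uv v0; split.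
  exists N0 => // N /= /uv/andP[u0 ule].
  by rewrite ge0_fin_numE// (le_lt_trans ule)// ltry.
apply/eqO_exP; exists (`|C| + 1); first by rewrite ltr_wpDl.
exists N0 => // N /= N0N; have /andP[u0 ule] := uv N N0N.
have ufin : u N \is a fin_num by rewrite ge0_fin_numE// (le_lt_trans ule)// ltry.
have vN := v0 N N0N.
rewrite (ger0_norm (fine_ge0 u0)) (ger0_norm vN).
move: ule; rewrite -(fineK ufin) lee_fin => ule; apply: (le_trans ule).
by apply: ler_wpM2r => //; have := ler_norm C; lra.
Qed.

Lemma knn_rate_eqO (beta s s' : R) : s <= s' ->
  (fun N => knn_rate beta s' N : R^o) =O_\oo (fun N => knn_rate beta s N : R^o).
Proof.
move=> ss'; have [C C0 CP] := knn_rate_mono beta ss'.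
apply/eqO_exP; exists C => //; exists 2 => // N /= N2.
by rewrite !ger0_norm ?knn_rate_ge0 ?CP// (leq_trans _ N2).
Qed.

Variables (d : nat) (d_gt0 : (0 < d)%N).
Let qstar : R := 4 / (d%:R + 4).
Let dR0 : 0 < d%:R :> R. Proof. by rewrite ltr0n. Qed.
Lemma qstar_itv : 0 < qstar < 1.
Proof. by rewrite divr_gt0//= /qstar ltr_pdivrMr// mul1r ltrDr. Qed.

Lemma knn_lambda_qstar : knn_lambda d qstar = 2 / (d%:R + 4).
Proof.
rewrite /knn_lambda (_ : qstar / 2 = 2 / (d%:R + 4)); last by rewrite /qstar; field; rewrite gt_eqF.
rewrite (_ : 2 / d%:R * (1 - qstar) = 2 / (d%:R + 4)) ?minxx//.
by rewrite /qstar; field; rewrite !gt_eqF.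
Qed.

(** [knn_lambda] is the minimum of an increasing and a decreasing affine function of q, which cross
    at [qstar]; on either side one of them is strictly below the common value. *)
Lemma knn_lambda_lt q : q != qstar -> knn_lambda d q < knn_lambda d qstar.
Proof.
rewrite neq_lt => /orP[qq|qq]; rewrite [ltRHS]knn_lambda_qstar /knn_lambda gt_min.
  rewrite (_ : 2 / (d%:R + 4) = qstar / 2); last by rewrite /qstar; field; rewrite gt_eqF.
  by rewrite ltr_pM2r ?invr_gt0// qq.
rewrite (_ : 2 / (d%:R + 4) = 2 / d%:R * (1 - qstar)); last by rewrite /qstar; field; rewrite !gt_eqF.
by rewrite ltr_pM2l ?divr_gt0// ltrD2l ltrN2 qq orbT.
Qed.

End rate_comparison.

Theorem theorem9 (R : realType) (d : nat) (d_gt0 : (0 < d)%N)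
    (nrm : 'rV[R]_d -> R) (nrm_norm : is_norm nrm)
    (dO : measure_display) (Omega : measurableType dO)
    (P : probability Omega R)
    (X : {RV P >-> 'rV[R]_d}) (Y eps : {RV P >-> R})
    (Xs : nat -> {RV P >-> 'rV[R]_d}) (Ys : nat -> {RV P >-> R})
    (f eta : 'rV[R]_d -> R) (kappa : {mfun 'rV[R]_d >-> pprobability R R})
    (K A Ca Cb' Cc Cd D L MX beta' : R)
    (K_gt0 : 0 < K) (A_gt0 : 0 < A) (Cd_gt0 : 0 < Cd) (D_gt0 : 0 < D)
    (beta_gt0 : 0 < beta')
    (Xdensity : has_density X f)
    (XY_iid : iid_data X Y Xs Ys)
    (Ymodel : regression_model X Y eps eta kappa)
    (Ha : cond_variance_le kappa Ca)
    (Hb : weighted_tail nrm X f MX Cb' beta')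
    (Hc : local_bias nrm X Y f eta Cc)
    (Hd : ball_mass_ge nrm X f Cd D)
    (He : large_scale_lipschitz nrm eta L D) :
  let qstar : R := 4 / (d%:R + 4) in
  [/\ forall q Cb'' : R, 0 < q < 1 -> mass_ratio_tail nrm X f A q Cb'' beta' ->
        ebigO (knn_excess_risk nrm X Y eps Xs Ys K A q)
              (knn_rate beta' (2 * knn_lambda d q)),
      0 < qstar < 1,
      (forall q : R, 0 < q < 1 -> q != qstar -> knn_lambda d q < knn_lambda d qstar),
      (forall q : R, 0 < q < 1 ->
        (fun N => knn_rate beta' (2 * knn_lambda d qstar) N : R^o) =O_\oo
        (fun N => knn_rate beta' (2 * knn_lambda d q) N : R^o)) &
      forall Cb'' : R, mass_ratio_tail nrm X f A qstar Cb'' beta' ->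
        ebigO (knn_excess_risk nrm X Y eps Xs Ys K A qstar)
              (knn_rate beta' (4 / (d%:R + 4)))].
Proof.
move=> qstar.
have rate q Cb'' : 0 < q < 1 -> mass_ratio_tail nrm X f A q Cb'' beta' ->
    ebigO (knn_excess_risk nrm X Y eps Xs Ys K A q)
          (knn_rate beta' (2 * knn_lambda d q)).
  move=> q01 tail; have [N0 [C le]] := knn_excess_risk_le d_gt0 nrm_norm A_gt0
    Cd_gt0 D_gt0 Xdensity XY_iid Ymodel Ha Hb Hc Hd He K_gt0 q01 tail.
  apply: (@ebigO_squeeze _ _ _ (maxn 1 N0) C) => N; rewrite geq_max => /andP[N1 N0N].
    exact: le.
  exact: knn_rate_ge0.
have qstar01 := @qstar_itv R d d_gt0.
split => //.
- by move=> q _; exact: knn_lambda_lt.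
- move=> q _; apply: knn_rate_eqO; rewrite ler_pM2l//.
  by have [->//|/(knn_lambda_lt d_gt0)/ltW] := eqVneq q qstar.
- move=> Cb'' /(rate _ _ qstar01).
  by rewrite knn_lambda_qstar// mulrA -natrM.
Qed.
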